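(* Let $f$ be a slice regular function on $\Delta:=\{q\in\mathbb{H}:\|q\|>1\}$ such that $f(q)=q+\sum_{n=0}^{\infty}q^{-n}a_n$. Assume that for some $I\in\mathbb{S}$ and $J\in\mathbb{S}$ orthogonal to $I$ one has $f|_{\Delta_I}=f_1+f_2J$, where $\Delta_I=\Delta\cap\mathbb{C}_I$ and where $f_1(z)$ and $z+f_2(z)$ are univalent functions. Then: (1) $$m\left(\left[\tfrac12(f-IfI)(\Delta_I)\right]^{c}\right)+m\left(\left[\left(\mathcal{I}+\tfrac12(f+IfI)\bar J\right)(\Delta_I)\right]^{c}\right)=\pi\left(2-\sum_{n=1}^{\infty}n\|a_n\|^2\right),$$ where $\mathcal{I}$ is the identity function, $m$ is the two-dimensional outer measure, and $A^{c}$ denotes $\mathbb{H}\setminus A$. (2) $\sum_{n=1}^{\infty}n\|a_n\|^2\le 2$. (3) $\|a_1\|\le\sqrt2$, with equality if and only if $f(q)=q+a_0+a_1q^{-1}$.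
   Context: $\mathbb{H}$ is the skew field of quaternions with Euclidean norm $\|\cdot\|$, $\mathbb{S}$ is the sphere of purely imaginary quaternions of norm $1$ (so $I^2=-1$ for $I\in\mathbb{S}$), and $\mathbb{C}_I=\mathbb{R}+I\mathbb{R}$ for $I\in\mathbb{S}$, identified with the complex plane. The coefficients $a_n$ are quaternions. A real differentiable function $f$ on an open set $U\subseteq\mathbb{H}$ with values in $\mathbb{H}$ is (left) slice regular if for every $I\in\mathbb{S}$ one has $\frac12\left(\frac{\partial}{\partial x}+I\frac{\partial}{\partial y}\right)f(x+Iy)=0$ on $U\cap\mathbb{C}_I$. For orthogonal $I,J\in\mathbb{S}$, the restriction of $f$ to $\Delta_I$ is written as $f_1+f_2J$ with $f_1,f_2:\Delta_I\to\mathbb{C}_I$ holomorphic; then $f_1=\frac12(f-IfI)$ and $f_2=\frac12(f+IfI)\bar J$ on $\Delta_I$. Univalent means injective.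
   Formalization: In (1), m is planar Lebesgue outer measure of the part of the complement lying in C_I (in all of H it is infinite). In (3), the extremal form is read as q + a_0 + q^{-1}a_1, and the converse requires its coefficient to have norm √2, since f(q)=q and f(q)=q+q^{-1}(1+J) refute the literal text. *)

(* Defs.v *)
From HB Require Import structures.
From mathcomp Require Import all_boot all_order all_algebra.
From mathcomp Require Import all_classical all_reals all_analysis.
From mathcomp Require Import ring lra.

Set Implicit Arguments.
Unset Strict Implicit.
Unset Printing Implicit Defensive.

Import Order.TTheory GRing.Theory Num.Theory.
Import numFieldNormedType.Exports.

Local Open Scope classical_set_scope.
Local Open Scope ring_scope.

(* The quaternion a + b i + c j + d k is the row vector (a, b, c, d).  The    *)
(* library norm `|q| inherited from 'rV[R]_4 is the sup norm: it is used only *)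
(* for the topology and for differentiability; the Euclidean norm is qnorm.   *)
Definition quat (R : realType) : Type := 'rV[R]_4.

HB.instance Definition _ (R : realType) :=
  NormedModule.copy (quat R) 'rV[R]_4.

Definition Quat (R : realType) (a b c d : R) : quat R :=
  \row_(i < 4) [:: a; b; c; d]`_i.

Definition qre (R : realType) (q : quat R) : R := q 0 0.
Definition qi (R : realType) (q : quat R) : R := q 0 1.
Definition qj (R : realType) (q : quat R) : R := q 0 2.
Definition qk (R : realType) (q : quat R) : R := q 0 3.

Definition qmul (R : realType) (p q : quat R) : quat R :=
  Quat (qre p * qre q - qi p * qi q - qj p * qj q - qk p * qk q)
       (qre p * qi q + qi p * qre q + qj p * qk q - qk p * qj q)
       (qre p * qj q - qi p * qk q + qj p * qre q + qk p * qi q)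
       (qre p * qk q + qi p * qj q - qj p * qi q + qk p * qre q).

Definition qconj (R : realType) (q : quat R) : quat R :=
  Quat (qre q) (- qi q) (- qj q) (- qk q).

Definition qdot (R : realType) (p q : quat R) : R :=
  \sum_(i < 4) p 0 i * q 0 i.

Definition qnorm (R : realType) (q : quat R) : R := Num.sqrt (qdot q q).

Definition qinv (R : realType) (q : quat R) : quat R :=
  (qdot q q)^-1 *: qconj q.

Lemma quatP (R : realType) (p q : quat R) :
  qre p = qre q -> qi p = qi q -> qj p = qj q -> qk p = qk q -> p = q.
Proof.
rewrite /qre /qi /qj /qk => h0 h1 h2 h3; apply/rowP => i.
have : [|| i == 0, i == 1, i == 2 | i == 3] by case: i => [[|[|[|[|]]]]].
by case/or4P => /eqP ->.
Qed.

Lemma qreE (R : realType) (a b c d : R) : qre (Quat a b c d) = a.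
Proof. by rewrite /qre mxE. Qed.
Lemma qiE (R : realType) (a b c d : R) : qi (Quat a b c d) = b.
Proof. by rewrite /qi mxE. Qed.
Lemma qjE (R : realType) (a b c d : R) : qj (Quat a b c d) = c.
Proof. by rewrite /qj mxE. Qed.
Lemma qkE (R : realType) (a b c d : R) : qk (Quat a b c d) = d.
Proof. by rewrite /qk mxE. Qed.
Definition qE := (qreE, qiE, qjE, qkE).

Lemma qcoordD (R : realType) (p q : quat R) :
  (qre (p + q) = qre p + qre q) * (qi (p + q) = qi p + qi q) *
  (qj (p + q) = qj p + qj q) * (qk (p + q) = qk p + qk q).
Proof. by rewrite /qre /qi /qj /qk !mxE. Qed.

Lemma qcoordZ (R : realType) (k : R) (q : quat R) :
  (qre (k *: q) = k * qre q) * (qi (k *: q) = k * qi q) *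
  (qj (k *: q) = k * qj q) * (qk (k *: q) = k * qk q).
Proof. by rewrite /qre /qi /qj /qk !mxE. Qed.

Lemma qdotE (R : realType) (p q : quat R) :
  qdot p q = qre p * qre q + qi p * qi q + qj p * qj q + qk p * qk q.
Proof.
rewrite /qdot !big_ord_recr big_ord0 /= add0r /qre /qi /qj /qk.
by congr (_ + _ + _ + _); congr (p _ _ * q _ _); apply/val_inj.
Qed.

Lemma qmulA (R : realType) : associative (@qmul R).
Proof. by move=> p q r; apply: quatP; rewrite /qmul !qE; ring. Qed.
Lemma qmul1q (R : realType) : left_id (Quat 1 0 0 0) (@qmul R).
Proof. by move=> q; apply: quatP; rewrite /qmul !qE; ring. Qed.
Lemma qmulq1 (R : realType) : right_id (Quat 1 0 0 0) (@qmul R).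
Proof. by move=> q; apply: quatP; rewrite /qmul !qE; ring. Qed.
Lemma qmulDl (R : realType) : left_distributive (@qmul R) +%R.
Proof. by move=> p q r; apply: quatP; rewrite /qmul !(qE, qcoordD); ring. Qed.
Lemma qmulDr (R : realType) : right_distributive (@qmul R) +%R.
Proof. by move=> p q r; apply: quatP; rewrite /qmul !(qE, qcoordD); ring. Qed.
Lemma quat1_neq0 (R : realType) : Quat 1 0 0 0 != 0 :> quat R.
Proof.
apply/eqP => /(congr1 (@qre R)); rewrite qreE /qre mxE => /eqP.
by rewrite oner_eq0.
Qed.

HB.instance Definition _ (R : realType) :=
  GRing.Zmodule_isNzRing.Build (quat R) (@qmulA R) (@qmul1q R) (@qmulq1 R)
    (@qmulDl R) (@qmulDr R) (@quat1_neq0 R).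

Lemma qscalerAl (R : realType) (k : R) (p q : quat R) :
  k *: (p * q) = (k *: p) * q.
Proof. by apply: quatP; rewrite !(qE, qcoordZ); ring. Qed.
HB.instance Definition _ (R : realType) :=
  GRing.Lmodule_isLalgebra.Build R (quat R) (@qscalerAl R).

Lemma qscalerAr (R : realType) (k : R) (p q : quat R) :
  k *: (p * q) = p * (k *: q).
Proof. by apply: quatP; rewrite !(qE, qcoordZ); ring. Qed.
HB.instance Definition _ (R : realType) :=
  GRing.Lalgebra_isAlgebra.Build R (quat R) (@qscalerAr R).

Lemma qdot_eq0 (R : realType) (q : quat R) : (qdot q q == 0) = (q == 0).
Proof.
apply/eqP/eqP => [|->]; last by rewrite /qdot big1 // => i _; rewrite mxE mul0r.
rewrite /qdot => /eqP; rewrite psumr_eq0 => [/allP h|i _]; last first.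
  by rewrite -expr2 sqr_ge0.
apply/rowP => i; rewrite mxE; apply/eqP.
by have := h i (mem_index_enum i); rewrite mulf_eq0 orbb.
Qed.

Lemma qmulVq (R : realType) :
  {in [pred q : quat R | q != 0], left_inverse 1 (@qinv R) *%R}.
Proof.
move=> q; rewrite inE -qdot_eq0 qdotE => q0.
by apply: quatP; rewrite /qinv /qconj !(qE, qcoordZ) qdotE; field.
Qed.
Lemma qmulqV (R : realType) :
  {in [pred q : quat R | q != 0], right_inverse 1 (@qinv R) *%R}.
Proof.
move=> q; rewrite inE -qdot_eq0 qdotE => q0.
by apply: quatP; rewrite /qinv /qconj !(qE, qcoordZ) qdotE; field.
Qed.
Lemma qunitP (R : realType) (p q : quat R) : q * p = 1 /\ p * q = 1 -> p != 0.
Proof.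
by case=> h _; apply/eqP => p0; move/eqP: h; rewrite p0 mulr0 eq_sym oner_eq0.
Qed.
Lemma qinv_out (R : realType) :
  {in [predC [pred q : quat R | q != 0]], @qinv R =1 id}.
Proof.
move=> q; rewrite !inE negbK => /eqP ->; rewrite /qinv.
by rewrite (eqP (_ : qdot 0 0 == 0)) ?qdot_eq0// invr0 scale0r.
Qed.

HB.instance Definition _ (R : realType) :=
  GRing.NzRing_hasMulInverse.Build (quat R) (@qmulVq R) (@qmulqV R)
    (@qunitP R) (@qinv_out R).

Definition imag_unit (R : realType) : set (quat R) :=
  [set I | qre I = 0 /\ qnorm I = 1].

Definition slice_pt (R : realType) (I : quat R) (x y : R) : quat R :=
  x%:A + y *: I.

Definition slice_plane (R : realType) (I : quat R) : set (quat R) :=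
  [set q | exists x y : R, q = slice_pt I x y].

Definition Delta (R : realType) : set (quat R) := [set q | 1 < qnorm q].

Definition Delta_slice (R : realType) (I : quat R) : set (quat R) :=
  @Delta R `&` slice_plane I.

Definition slice_regular (R : realType) (U : set (quat R))
    (f : quat R -> quat R) : Prop :=
  (forall q, U q -> differentiable f q) /\
  (forall (I : quat R) (x y : R), imag_unit I -> U (slice_pt I x y) ->
     2^-1 *: (derive1 (fun s => f (slice_pt I s y)) x
              + I * derive1 (fun t => f (slice_pt I x t)) y) = 0).

(* Existence, inside the plane C_I, of the complex derivative.  The functions *)
(* are total on H; only their values on D are constrained.                    *)
Definition slice_holomorphic (R : realType) (I : quat R) (D : set (quat R))
    (g : quat R -> quat R) : Prop :=
  set_fun D (slice_plane I) g /\
  forall z, D z ->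
    cvg ((fun h => h^-1 * (g (z + h) - g z)) @ within (slice_plane I) 0^').

(* Lebesgue outer measure of the plane C_I = R^2; a set A of quaternions is   *)
(* measured through A `&` slice_plane I, so that ~` may be the complement in  *)
(* the whole of H.                                                            *)
Definition slice_outer_measure (R : realType) (I : quat R) (A : set (quat R)) :
    \bar R :=
  mu_ext (lebesgue_measure \x lebesgue_measure)%E
    [set p : measurableTypeR R * measurableTypeR R | A (slice_pt I p.1 p.2)].

(* Main.v *)
(* Identify C_I with the complex plane. The quaternions are C_I + C_I J, and this
   splitting is C_I-linear on the left and orthogonal, so the components of the
   coefficients satisfy |a n|^2 = |b n|^2 + |c n|^2 and f1(z) = z + sum b n / z^n,
   z + f2(z) = z + sum c n / z^n. Everything reduces to the classical area theorem for
   each of these two univalent functions: the omitted set of g(z) = z + sum b n / z^n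
   has area pi (1 - sum n |b n|^2).

   The area theorem is proved here without Green's formula. The area of the image of
   an annulus is a Riemann sum over small rectangles in logarithmic coordinates, on
   which g is nearly affine; Parseval on roots of unity evaluates the sum, giving
   pi (H r' - H r) with H r = r^2 - sum n |b n|^2 r^-2n. For large r, the set omitted
   by g on |z| > r is squeezed between two affine images of discs, whose area is
   pi r^2 + o(1); this fixes the constant, and r tends to 1. In (3), equality leaves
   no room for a n with n >= 2, and the coefficient a 1 is determined by f. *)
From HB Require Import structures.
Require Import Defs.
From mathcomp Require Import all_boot all_order all_algebra.
From mathcomp Require Import complex.
From mathcomp Require Import all_classical all_reals all_analysis.
From mathcomp Require Import measurable_realfun.
From mathcomp Require Import ring lra.

Set Implicit Arguments.
Unset Strict Implicit.
Unset Printing Implicit Defensive.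

Import Order.TTheory GRing.Theory Num.Theory.
Import numFieldNormedType.Exports.

Local Open Scope classical_set_scope.
Local Open Scope ring_scope.

Import Normc.

(** * Planar Lebesgue measure under affine maps *)

(** Univalence is used only to make images of disjoint sets disjoint. No open mapping theorem,
    winding number or boundary curve occurs. Where these would normally give surjectivity,
    [perturbation_onto] does: it bounds the image of a small cell from below, and it shows that g,
    extended inside a large circle, takes every value.

    The linearisation error has two sources. The mesh 1/N can be refined, but the tail of the series
    beyond order m contributes an error independent of N. So N tends to infinity first with m fixed,
    and then m does. Both limits rest on the uniform geometric decay of n^2 |b n| e^(-sn/2),
    available only for s = log r > 0. At s = 0 no decay is left, and the passage to r = 1 relies on
    monotonicity instead. *)

Lemma lebesgue_measure_affine (R : realType) (t e : R) (B : set (measurableTypeR R)) :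
  e != 0 -> measurable B ->
  (lebesgue_measure [set y | B (t + e * y)%R] = `|e|^-1%:E * lebesgue_measure B)%E.
Proof.
move=> e0 mB.
have ae : 0 < `|e| by rewrite normr_gt0.
pose g : measurableTypeR R -> measurableTypeR R := fun y => t + e * y.
have mg : measurable_fun setT g.
  by apply: measurable_funD => //; exact: measurable_funM.
suff -> : lebesgue_measure B = mscale (NngNum (ltW ae)) (pushforward lebesgue_measure g) B.
  by rewrite /= /mscale/= muleA -EFinM mulVf ?gt_eqF// mul1e.
move=> m; apply: lebesgue_measure_unique => //= _ [[a b]] _ <- /=.
rewrite /mscale/= /pushforward.
have [e_gt0|e_lt0] : 0 < e \/ e < 0 by case: ltrgtP e0; tauto.
(* The sign matters for the shape: for e < 0 the preimage of a left-open interval is right-open. *)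
- have -> : g @^-1` `]a, b]%classic = `](a - t) / e, (b - t) / e]%classic.
    apply/seteqP; split => y /=; rewrite !in_itv/= /g ltr_pdivrMr// ler_pdivlMr//;
    by rewrite ltrBlDl lerBrDl [y * e]mulrC.
  rewrite !lebesgue_measure_itv/= !lte_fin ltr_pM2r ?invr_gt0// ltrD2r.
  case: ifPn => ab; last by rewrite mule0.
  rewrite -!EFinD -EFinM gtr0_norm//; congr EFin; field.
  by rewrite gt_eqF.
- have -> : g @^-1` `]a, b]%classic = `[(b - t) / e, (a - t) / e[%classic.
    apply/seteqP; split => y /=; rewrite !in_itv/= /g ltr_ndivlMr// ler_ndivrMr//;
    by rewrite ltrBlDl lerBrDl [y * e]mulrC andbC.
  rewrite !lebesgue_measure_itv/= !lte_fin ltr_nM2r ?invr_lt0// ltrD2r.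
  case: ifPn => ab; last by rewrite mule0.
  rewrite -!EFinD -EFinM ltr0_norm//; congr EFin; field.
  by rewrite lt_eqF.
Qed.

Definition leb2 (R : realType) : set (measurableTypeR R * measurableTypeR R) -> \bar R :=
  (@lebesgue_measure R \x @lebesgue_measure R)%E.
HB.instance Definition _ (R : realType) := Measure.on (@leb2 R).

(** Preimages rather than images, so that measurability is transported without inverting T; for an
    invertible affine T the factor k is the inverse of |det T|. *)
Definition scales_area (R : realType) (T : measurableTypeR R * measurableTypeR R ->
  measurableTypeR R * measurableTypeR R) (k : R) :=
  forall A, measurable A ->
    measurable (T @^-1` A) /\ leb2 (T @^-1` A) = (k%:E * leb2 A)%E.

Lemma scales_area_comp (R : realType) S T (k l : R) :
  scales_area S k -> scales_area T l -> scales_area (S \o T) (l * k).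
Proof.
move=> hS hT A /hS[/hT[mTA TA] SA]; split=> //.
by rewrite comp_preimage TA SA EFinM muleA.
Qed.

Lemma scales_area_swap (R : realType) : @scales_area R (fun p => (p.2, p.1)) 1.
Proof.
have ms : measurable_fun setT (fun p : measurableTypeR R * measurableTypeR R => (p.2, p.1)).
  exact: measurable_fun_pair.
move=> A mA; split; first by rewrite -[X in measurable X]setTI; exact: ms.
rewrite mul1e; apply/esym.
apply: (@product_measure_unique _ _ _ _ R _ _ (pushforward (@leb2 R) (fun p => (p.2, p.1)))) => //.
move=> B C mB mC; rewrite /= /pushforward.
have -> : (fun p : measurableTypeR R * measurableTypeR R => (p.2, p.1)) @^-1` (B `*` C) = C `*` B.
  by apply/seteqP; split=> -[x y]/= [].
by rewrite /leb2 product_measure1E// muleC.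
Qed.

(** Fubini along the first coordinate: every vertical section is transformed by a one-dimensional
    affine map with slope e. *)
Lemma scales_area_shear (R : realType) (c d e : R) : e != 0 ->
  scales_area (fun p => (p.1, c * p.1 + d + e * p.2)) `|e|^-1.
Proof.
move=> e0.
set T := fun p => _.
have mT : measurable_fun setT T.
  apply: measurable_fun_pair; first exact: measurable_fst.
  apply: measurable_funD => /=; last by apply: measurable_funM => //; exact: measurable_snd.
  by apply: measurable_funD => //; apply: measurable_funM => //; exact: measurable_fst.
move=> A mA; split; first by rewrite -[X in measurable X]setTI; exact: mT.
rewrite /leb2 /product_measure1 -ge0_integralZl//; last exact: measurable_fun_xsection.
apply: eq_integral => x _ /=.
by rewrite -(@lebesgue_measure_affine _ (c * x + d))//; exact: measurable_xsection.
Qed.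

(** LU factorisation: if a is nonzero, the map is a shear in the first coordinate (a shear
    conjugated by the swap) followed by a shear in the second one with slope d - bc/a. If a = 0 then
    b is nonzero, and exchanging the variables reduces to this case. *)
Lemma scales_area_affine (R : realType) (a b c d p q : R) :
  a * d - b * c != 0 ->
  scales_area (fun z => (p + a * z.1 + b * z.2, q + c * z.1 + d * z.2))
    `|a * d - b * c|^-1.
Proof.
have gen (a' b' c' d' p' q' : R) : a' != 0 -> a' * d' - b' * c' != 0 ->
    scales_area (fun z => (p' + a' * z.1 + b' * z.2, q' + c' * z.1 + d' * z.2))
      `|a' * d' - b' * c'|^-1.
  move=> a0 det0.
  have d0 : d' - b' * c' / a' != 0.
    have -> : d' - b' * c' / a' = (a' * d' - b' * c') / a' by field.
    by rewrite mulf_neq0// invr_neq0.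
  have h := scales_area_comp
    (scales_area_shear (c' / a') (q' - c' / a' * p') d0)
    (scales_area_comp (scales_area_comp (@scales_area_swap R)
      (scales_area_shear b' p' a0)) (@scales_area_swap R)).
  have -> : `|a' * d' - b' * c'|^-1 = 1 * (`|a'|^-1 * 1) * `|d' - b' * c' / a'|^-1.
    rewrite mulr1 mul1r -invfM -normrM; congr (`| _ |^-1).
    by field.
  move: h; congr (scales_area _ _); apply/funext => -[x y] /=; congr pair; first ring.
  by field.
move=> det0; have [a0|a0] := eqVneq a 0; last exact: gen.
have b0 : b != 0.
  by apply: contraNneq det0 => ->; rewrite a0 !mul0r subrr.
have := scales_area_comp (@gen b a d c p q b0 _) (@scales_area_swap R).
have -> : b * c - a * d = - (a * d - b * c) by ring.
rewrite oppr_eq0 normrN mul1r => /(_ det0).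
by congr (scales_area _ _); apply/funext => -[x y] /=; rewrite addrAC [X in (_, X)]addrAC.
Qed.

Lemma open_measurable_plane (R : realType) (U : set (R * R)) : open U ->
  measurable (U : set (measurableTypeR R * measurableTypeR R)).
Proof.
move=> oU.
(* The inclusion in U is part of the set, so that the union runs over all indices: [D k p q] is a
   small square or empty. *)
pose D (k : nat) (p q : rat) : set (measurableTypeR R * measurableTypeR R) :=
  [set z | (ball (ratr p : R) k.+1%:R^-1 `*` ball (ratr q : R) k.+1%:R^-1) z /\
    ball (ratr p : R) k.+1%:R^-1 `*` ball (ratr q : R) k.+1%:R^-1 `<=` U].
suff -> : U = \bigcup_k \bigcup_p \bigcup_q D k p q.
  apply: bigcupT_measurable => k; apply: bigcupT_measurable_rat => p.
  apply: bigcupT_measurable_rat => q; rewrite /D.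
  have [H|H] := pselect (ball (ratr p : R) k.+1%:R^-1 `*` ball (ratr q : R) k.+1%:R^-1 `<=` U).
    rewrite (_ : mkset _ = ball (ratr p : R) k.+1%:R^-1 `*` ball (ratr q : R) k.+1%:R^-1).
      by apply: measurableX; exact: measurable_ball.
    by apply/seteqP; split=> z /=; tauto.
  rewrite (_ : mkset _ = set0) //.
  by apply/seteqP; split=> z /=; tauto.
apply/seteqP; split => [[x y] Uxy|z [k _ [p _ [q _ [Dz /(_ _ Dz)]]]]]//.
have /nbhs_ballP[e /= e0 xyU] := open_nbhs_nbhs (conj oU Uxy).
have [k ke] : exists k : nat, k.+1%:R^-1 < e / 2.
  have := @near_infty_natSinv_lt R (PosNum (divr_gt0 e0 (ltr0n R 2))).
  by case=> N _ /(_ N (leqnn N)) /= h; exists N.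
have k0 : 0 < k.+1%:R^-1 :> R by rewrite invr_gt0.
have rat_near (t : R) : exists r : rat, ball t k.+1%:R^-1 (ratr r : R).
  have /rat_in_itvoo[r] : t - k.+1%:R^-1 < t + k.+1%:R^-1 by rewrite ltrD2l; exact: gtrN.
  rewrite in_itv/= => /andP[r1 r2]; exists r.
  by rewrite /ball/= ltr_distlC r1 r2.
have [p px] := rat_near x; have [q qy] := rat_near y.
exists k => //; exists p => //; exists q => //; split => /=.
  by split; apply: ball_sym.
move=> [u v] /= [pu qv]; apply: xyU; split => /=.
  by apply: (le_ball (ltW _) (ball_triangle px pu)); rewrite (splitr e) ltrD.
by apply: (le_ball (ltW _) (ball_triangle qy qv)); rewrite (splitr e) ltrD.
Qed.

Lemma compact_measurable_plane (R : realType) (K : set (R * R)) : compact K ->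
  measurable (K : set (measurableTypeR R * measurableTypeR R)).
Proof.
move=> cK; rewrite -[K]setCK; apply: measurableC; apply: open_measurable_plane.
by apply: closed_openC; apply: compact_closed => //; exact: norm_hausdorff.
Qed.

(** * The complex modulus *)

Definition toC (R : realType) (p : R * R) : R[i] := (p.1 +i* p.2)%C.

Lemma ReD (R : realType) (z w : R[i]) : complex.Re (z + w) = complex.Re z + complex.Re w.
Proof. by case: z w => [? ?] [? ?]. Qed.
Lemma ImD (R : realType) (z w : R[i]) : complex.Im (z + w) = complex.Im z + complex.Im w.
Proof. by case: z w => [? ?] [? ?]. Qed.
Lemma ReN (R : realType) (z : R[i]) : complex.Re (- z) = - complex.Re z.
Proof. by case: z => [? ?]. Qed.
Lemma ImN (R : realType) (z : R[i]) : complex.Im (- z) = - complex.Im z.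
Proof. by case: z => [? ?]. Qed.
Definition ReImE (R : realType) := (@ReD R, @ImD R, @ReN R, @ImN R).

Lemma normc_ge0 (R : realType) (z : R[i]) : 0 <= normc z.
Proof. by case: z => x y; rewrite sqrtr_ge0. Qed.

Lemma normc_sqr (R : realType) (z : R[i]) : normc z ^+ 2 = complex.Re z ^+ 2 + complex.Im z ^+ 2.
Proof. by case: z => x y /=; rewrite sqr_sqrtr// addr_ge0 ?sqr_ge0. Qed.

Lemma normc_eq0 (R : realType) (z : R[i]) : (normc z == 0) = (z == 0).
Proof.
by apply/eqP/eqP => [/eq0_normc//|->]; exact: normc0.
Qed.

Lemma normc_gt0 (R : realType) (z : R[i]) : (0 < normc z) = (z != 0).
Proof. by rewrite lt_def normc_ge0 andbT normc_eq0. Qed.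

Lemma le_normc_Re (R : realType) (z : R[i]) : `|complex.Re z| <= normc z.
Proof.
by case: z => x y /=; rewrite -sqrtr_sqr ler_wsqrtr// lerDl sqr_ge0.
Qed.

Lemma le_normc_Im (R : realType) (z : R[i]) : `|complex.Im z| <= normc z.
Proof.
by case: z => x y /=; rewrite -sqrtr_sqr ler_wsqrtr// lerDr sqr_ge0.
Qed.

Lemma normc_le (R : realType) (z : R[i]) : normc z <= `|complex.Re z| + `|complex.Im z|.
Proof.
rewrite -(@ler_pXn2r _ 2)// ?nnegrE ?addr_ge0 ?normc_ge0//.
by rewrite normc_sqr sqrrD !real_normK ?num_real// addrAC lerDl mulrn_wge0// mulr_ge0.
Qed.

Lemma normcB (R : realType) (z w : R[i]) : normc (z - w) = normc (w - z).
Proof. by rewrite -opprB normcN. Qed.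

Lemma normc_triangle (R : realType) (z v w : R[i]) :
  normc (z - w) <= normc (z - v) + normc (v - w).
Proof. by have := le_normcD (z - v) (v - w); rewrite addrA subrK. Qed.

Lemma ler_dist_normc (R : realType) (z w : R[i]) : `|normc z - normc w| <= normc (z - w).
Proof.
have h (u v : R[i]) : normc u - normc v <= normc (u - v).
  by rewrite lerBlDr; have := le_normcD (u - v) v; rewrite subrK.
by rewrite ler_norml h andbT lerNl opprB normcB h.
Qed.

Lemma normcX (R : realType) (z : R[i]) n : normc (z ^+ n) = normc z ^+ n.
Proof. by elim: n => [|n IH]; rewrite ?expr0 ?normc1// !exprS normcM IH. Qed.

Lemma normc_sum (R : realType) (J : Type) (r : seq J) (P : pred J) (F : J -> R[i]) :
  normc (\sum_(j <- r | P j) F j) <= \sum_(j <- r | P j) normc (F j).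
Proof.
elim/big_ind2 : _ => [|x1 x2 y1 y2 h1 h2|//]; first by rewrite normc0.
by apply: le_trans (le_normcD _ _) _; exact: lerD.
Qed.

Lemma normcR (R : realType) (x : R) : normc (x%:C)%C = `|x|.
Proof. by rewrite /= expr0n addr0 sqrtr_sqr. Qed.

Lemma normc_conj (R : realType) (z : R[i]) : normc (z^*)%C = normc z.
Proof. by case: z => x y /=; rewrite sqrrN. Qed.

Lemma lipschitz_continuous_within (R : realType) (V : normedModType R)
    (A : set (R * R)) (h : R * R -> V) (L : R) :
  (forall p r, A p -> A r -> `|h p - h r| <= L * normc (toC p - toC r)) ->
  {within A, continuous h}.
Proof.
move=> hL; have L0 : 0 < `|L| + 1 by rewrite ltr_wpDl.
apply/subspace_continuousP => p Ap; apply/cvgrPdist_lt => e e0.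
have d0 : 0 < e / (2 * (`|L| + 1)) by rewrite divr_gt0// mulr_gt0.
apply/(nbhs_ballP p); exists (e / (2 * (`|L| + 1))) => //= r [pr1 pr2] Ar.
apply: le_lt_trans (hL _ _ Ap Ar) _.
have : normc (toC p - toC r) < e / (2 * (`|L| + 1)) + e / (2 * (`|L| + 1)).
  by apply: le_lt_trans (normc_le _) _; exact: ltrD.
rewrite (_ : _ + _ = e / (`|L| + 1)); last by field; rewrite gt_eqF.
rewrite ltr_pdivlMr// mulrC; apply: le_lt_trans.
by rewrite ler_wpM2r ?normc_ge0// ler_wpDr// ler_norm.
Qed.

(* A contraction principle proved by minimising |x + k x - y| over the compact set S. *)
Lemma perturbation_onto (R : realType) (S : set R[i]) (k : R[i] -> R[i]) (q : R) (y : R[i]) :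
  compact (@toC R @^-1` S) -> S !=set0 -> q < 1 ->
  (forall z w, S z -> S w -> normc (k z - k w) <= q * normc (z - w)) ->
  (forall z, S z -> S (y - k z)) ->
  exists2 x, S x & x + k x = y.
Proof.
move=> cS [s Ss] q1 kq kS.
pose h (p : R * R) := normc (toC p + k (toC p) - y).
have ch : {within (@toC R @^-1` S), continuous h}.
  apply: (@lipschitz_continuous_within _ _ _ _ (1 + q)) => p r Sp Sr.
  apply: le_trans (ler_dist_normc _ _) _.
  rewrite (_ : _ - _ = (toC p - toC r) + (k (toC p) - k (toC r))); last by ring.
  by apply: le_trans (le_normcD _ _) _; rewrite mulrDl mul1r lerD2l kq.
have [|p] := compact_EVT_min _ cS ch.
  by exists (complex.Re s, complex.Im s); rewrite /preimage/= /toC/=; case: (s) Ss.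
rewrite inE => Sp minp; exists (toC p) => //.
apply/eqP; rewrite -subr_eq0 -normc_eq0; apply/eqP.
(* The next Picard iterate: its residual is k z - k p, at most q times the residual at the minimiser
   p. Minimality and q < 1 force the latter to be 0. *)
pose z := y - k (toC p).
have := minp (complex.Re z, complex.Im z); rewrite inE /preimage/=.
have zE : toC (complex.Re z, complex.Im z) = z by rewrite /toC/=; case: (z).
rewrite /h zE => /(_ (kS _ Sp)).
rewrite (_ : z + k z - y = k z - k (toC p)); last by rewrite /z; ring.
move=> /le_trans /(_ (kq _ _ (kS _ Sp) Sp)).
rewrite /z (_ : y - k (toC p) - toC p = - (toC p + k (toC p) - y)); last by ring.
rewrite normcN.
set n := normc _ => hn.
have : 0 <= n by exact: normc_ge0.
move: hn q1; nra.
Qed.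

(** * Area of subsets of the complex plane *)

Definition cmeas (R : realType) (S : set R[i]) : Prop :=
  measurable (@toC R @^-1` S : set (measurableTypeR R * measurableTypeR R)).

Definition carea (R : realType) (S : set R[i]) : \bar R := leb2 (@toC R @^-1` S).

Definition cbox (R : realType) (s s' t t' : R) : set R[i] :=
  [set w | s <= complex.Re w <= s' /\ t <= complex.Im w <= t'].

(** Half-open, so that adjacent boxes tile exactly and a strip of height 2 pi meets each fibre of
    the exponential once. *)
Definition hbox (R : realType) (s s' t t' : R) : set R[i] :=
  [set w | s < complex.Re w <= s' /\ t < complex.Im w <= t'].

Lemma le_carea (R : realType) (S T : set R[i]) : cmeas S -> cmeas T -> S `<=` T ->
  (carea S <= carea T)%E.
Proof. by move=> mS mT ST; apply: le_measure; rewrite ?inE// => p; exact: ST. Qed.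

Lemma carea_affine (R : realType) (S : set R[i]) (c d : R[i]) : c != 0 -> cmeas S ->
  cmeas [set z | S (c * z + d)] /\
  carea [set z | S (c * z + d)] = ((normc c ^+ 2)^-1%:E * carea S)%E.
Proof.
case: c d => [cr ci] [dr di] c0 mS.
have det : cr * cr - - ci * ci = normc (cr +i* ci)%C ^+ 2 by rewrite normc_sqr/=; ring.
have det0 : cr * cr - - ci * ci != 0 by rewrite det expf_neq0// normc_eq0.
have := scales_area_affine dr di det0 mS.
rewrite det ger0_norm ?sqr_ge0//.
rewrite /cmeas /carea; suff -> : @toC R @^-1` [set z | S ((cr +i* ci)%C * z + (dr +i* di)%C)] =
  (fun z : R * R => (dr + cr * z.1 + - ci * z.2, di + ci * z.1 + cr * z.2)) @^-1` (@toC R @^-1` S) by [].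
apply/seteqP; split=> -[x y] /=; rewrite /toC/=;
 by congr S; congr Complex; ring.
Qed.

(** As a real-linear map, z + b conj z has determinant 1 - |b|^2. *)
Lemma carea_conj_affine (R : realType) (S : set R[i]) (b d : R[i]) : normc b < 1 ->
  cmeas S ->
  cmeas [set z | S (z + b * z^*%C + d)] /\
  carea [set z | S (z + b * z^*%C + d)] = ((1 - normc b ^+ 2)^-1%:E * carea S)%E.
Proof.
case: b d => [u v] [dr di] b1 mS.
have det : (1 + u) * (1 - u) - v * v = 1 - normc (u +i* v)%C ^+ 2 by rewrite normc_sqr/=; ring.
have det0 : 0 < (1 + u) * (1 - u) - v * v.
  by rewrite det subr_gt0 -(expr1n R 2) ltr_pXn2r// nnegrE ?normc_ge0.
have := scales_area_affine dr di (lt0r_neq0 det0) mS.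
rewrite gtr0_norm// det.
rewrite /cmeas /carea; suff -> : @toC R @^-1` [set z | S (z + (u +i* v)%C * z^*%C + (dr +i* di)%C)] =
  (fun z : R * R => (dr + (1 + u) * z.1 + v * z.2, di + v * z.1 + (1 - u) * z.2)) @^-1` (@toC R @^-1` S) by [].
apply/seteqP; split=> -[x y] /=; rewrite /toC/=;
 by congr S; congr Complex; ring.
Qed.

Lemma toC_cbox (R : realType) (s s' t t' : R) :
  @toC R @^-1` (cbox s s' t t') = `[s, s']%classic `*` `[t, t']%classic.
Proof. by apply/seteqP; split=> -[x y]; rewrite /cbox /= !in_itv/=. Qed.

Lemma carea_cbox (R : realType) (s s' t t' : R) : s <= s' -> t <= t' ->
  carea (cbox s s' t t') = ((s' - s) * (t' - t))%:E.
Proof.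
move=> ss' tt'; rewrite /carea toC_cbox.
have h (u u' : R) : u <= u' -> lebesgue_measure `[u, u']%classic = (u' - u)%:E.
  rewrite lebesgue_measure_itv/= lte_fin le_eqVlt => /predU1P[->|->].
    by rewrite ltxx subrr.
  by rewrite EFinB.
by rewrite /leb2 product_measure1E// EFinM -!h.
Qed.

Lemma cmeas_cbox (R : realType) (s s' t t' : R) : cmeas (cbox s s' t t').
Proof. by rewrite /cmeas toC_cbox; apply: measurableX. Qed.

Lemma compact_cbox (R : realType) (s s' t t' : R) : compact (@toC R @^-1` (cbox s s' t t')).
Proof. by rewrite toC_cbox; apply: compact_setX; exact: segment_compact. Qed.

(** * Area of the image of a nearly affine map *)

Definition ofC (R : realType) (z : R[i]) : R * R := (complex.Re z, complex.Im z).

Lemma toCK (R : realType) : cancel (@toC R) (@ofC R).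
Proof. by case. Qed.

Lemma ofCK (R : realType) : cancel (@ofC R) (@toC R).
Proof. by case. Qed.

Lemma preimage_toC_image (R : realType) (S : set R[i]) (F : R[i] -> R[i]) :
  @toC R @^-1` (F @` S) = (@ofC R \o F \o @toC R) @` (@toC R @^-1` S).
Proof.
apply/seteqP; split=> [p [z Sz Fz]|_ [r Sr <-]].
  exists (ofC z); first by rewrite /preimage/= ofCK.
  by rewrite /= ofCK Fz toCK.
by exists (toC r) => //=; rewrite ofCK.
Qed.

Definition lip_on (R : realType) (S : set R[i]) (L : R) (F : R[i] -> R[i]) : Prop :=
  forall z w, S z -> S w -> normc (F z - F w) <= L * normc (z - w).

Lemma compact_lip_image (R : realType) (S : set R[i]) (F : R[i] -> R[i]) (L : R) :
  compact (@toC R @^-1` S) -> lip_on S L F -> compact (@toC R @^-1` (F @` S)).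
Proof.
move=> cS LF; rewrite preimage_toC_image; apply: continuous_compact => //.
apply: (@lipschitz_continuous_within _ _ _ _ L) => p r Sp Sr.
apply: le_trans (LF _ _ Sp Sr); rewrite /ofC/=.
rewrite /Num.norm/= ge_max/=.
case: (F (toC p)) (F (toC r)) => x y [u v]/=.
by rewrite (le_normc_Re (_ +i* _)%C) (le_normc_Im (_ +i* _)%C).
Qed.

Lemma cmeas_compact (R : realType) (S : set R[i]) : compact (@toC R @^-1` S) -> cmeas S.
Proof. exact: compact_measurable_plane. Qed.

Lemma cmeas_bigcup (R : realType) (F : nat -> set R[i]) :
  (forall n, cmeas (F n)) -> cmeas (\bigcup_n F n).
Proof. by move=> mF; rewrite /cmeas preimage_bigcup; exact: bigcupT_measurable. Qed.

Lemma hbox_bigcup (R : realType) (s s' t t' : R) :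
  hbox s s' t t' = \bigcup_n cbox (s + n.+1%:R^-1) s' (t + n.+1%:R^-1) t'.
Proof.
apply/seteqP; split => [w [/andP[s1 s2] /andP[t1 t2]]|w [n _ [/andP[s1 s2] /andP[t1 t2]]]].
  have h (u v : R) : u < v -> exists N : nat, forall n, (N <= n)%N -> u + n.+1%:R^-1 <= v.
    move=> uv; have uv0 : 0 < v - u by rewrite subr_gt0.
    have [N _ /= hN] := near_infty_natSinv_lt (PosNum uv0).
    by exists N => n /hN /= /ltW; rewrite lerBrDl.
  have [N hN] := h _ _ s1; have [M hM] := h _ _ t1.
  exists (maxn N M) => //; split; apply/andP; split=> //.
    by apply: hN; exact: leq_maxl.
  by apply: hM; exact: leq_maxr.
have n0 : 0 < n.+1%:R^-1 :> R by rewrite invr_gt0.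
by split; apply/andP; split=> //; apply: lt_le_trans; try exact: s1; try exact: t1; rewrite ltrDl.
Qed.

(** A half-open box is a countable union of closed ones, and a Lipschitz map sends these to compact
    sets. *)
Lemma cmeas_lip_hbox (R : realType) (s s' t t' L : R) (F : R[i] -> R[i]) :
  lip_on (hbox s s' t t') L F -> cmeas (F @` hbox s s' t t').
Proof.
move=> LF; rewrite hbox_bigcup image_bigcup; apply: cmeas_bigcup => n.
apply: cmeas_compact; apply: (@compact_lip_image _ _ _ L); first exact: compact_cbox.
by move=> z w hz hw; apply: LF; rewrite hbox_bigcup; exists n.
Qed.

Lemma normc_hbox (R : realType) (s t a b : R) (z w : R[i]) :
  hbox s (s + a) t (t + b) z -> hbox s (s + a) t (t + b) w -> normc (z - w) <= a + b.
Proof.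
move=> [/andP[? ?] /andP[? ?]] [/andP[? ?] /andP[? ?]].
apply: le_trans (normc_le _) _; apply: lerD.
  by rewrite !ReImE ler_norml; apply/andP; split; lra.
by rewrite !ReImE ler_norml; apply/andP; split; lra.
Qed.

Lemma hbox_corner (R : realType) (s t a b : R) : 0 < a -> 0 < b ->
  exists w, [/\ complex.Re w = s + a, complex.Im w = t + b &
    hbox s (s + a) t (t + b) w].
Proof.
move=> a0 b0; exists ((s + a) +i* (t + b))%C; split=> //.
by split; rewrite lexx andbT ltrDl.
Qed.

Lemma near_linear_lip (R : realType) (F : R[i] -> R[i]) (c : R[i]) (s t a b e : R) :
  lip_on (hbox s (s + a) t (t + b)) e (fun w => F w - c * w) ->
  lip_on (hbox s (s + a) t (t + b)) (normc c + e) F.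
Proof.
move=> near z w Qz Qw.
rewrite (_ : F z - F w = (F z - c * z - (F w - c * w)) + c * (z - w)); last by ring.
apply: le_trans (le_normcD _ _) _; rewrite mulrDl addrC normcM lerD2l.
exact: near.
Qed.

Lemma near_linear_cmeas (R : realType) (F : R[i] -> R[i]) (c : R[i]) (s t a b e : R) :
  lip_on (hbox s (s + a) t (t + b)) e (fun w => F w - c * w) ->
  cmeas (F @` (hbox s (s + a) t (t + b))).
Proof. by move=> near; exact: cmeas_lip_hbox (near_linear_lip near). Qed.

Lemma near_linear_corner (R : realType) (F : R[i] -> R[i]) (c : R[i]) (s t a b e : R) w w1 d :
  0 < a -> 0 < b -> 0 < e -> lip_on (hbox s (s + a) t (t + b)) e (fun w => F w - c * w) ->
  (hbox s (s + a) t (t + b)) w -> hbox s (s + a) t (t + b) w1 -> e * (a + b) <= d ->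
  normc (F w - F w1 - c * (w - w1)) <= d.
Proof.
move=> a0 b0 e0 near Qw Qw1; apply: le_trans.
rewrite (_ : _ - _ = F w - c * w - (F w1 - c * w1)); last by ring.
apply: le_trans (near _ _ Qw Qw1) _; apply: ler_wpM2l; [exact: ltW|exact: normc_hbox Qw Qw1].
Qed.

(** In the coordinate c^-1 z, based at the upper right corner [w1], the image stays within r = d /
    |c| of the original box, hence in a box with sides a + 2r and b + 2r. *)
Lemma carea_near_linear_le (R : realType) (F : R[i] -> R[i]) (c : R[i]) (s t a b e : R) d :
  0 < a -> 0 < b -> 0 < e -> lip_on (hbox s (s + a) t (t + b)) e (fun w => F w - c * w) ->
  e * (a + b) <= d ->
  (carea (F @` (hbox s (s + a) t (t + b))) <= ((normc c * a + 2 * d) * (normc c * b + 2 * d))%:E)%E.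
Proof.
move=> a0 b0 e0 near de; have d0 : 0 < d by apply: lt_le_trans de; rewrite mulr_gt0// addr_gt0.
have [w1 [w1r w1i Qw1]] := hbox_corner s t a0 b0.
have near1 w (Qw : (hbox s (s + a) t (t + b)) w) := near_linear_corner a0 b0 e0 near Qw Qw1 de.
(* Without c^-1, the image still lies in a square of side 2d around F w1. *)
have [c0|c0] := eqVneq c 0.
  rewrite c0 normc0 !mul0r !add0r.
  pose B := cbox (complex.Re (F w1) - d) (complex.Re (F w1) + d)
              (complex.Im (F w1) - d) (complex.Im (F w1) + d).
  have : F @` (hbox s (s + a) t (t + b)) `<=` B.
    move=> _ [w Qw <-]; have := near1 w Qw; rewrite c0 mul0r subr0 => h.
    have := le_trans (le_normc_Re _) h; have := le_trans (le_normc_Im _) h.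
    by rewrite !ReImE !ler_distl /B /cbox/= => /andP[-> ->] /andP[-> ->].
  move=> /(le_carea (near_linear_cmeas near) (cmeas_cbox _ _ _ _)) /le_trans; apply.
  by rewrite carea_cbox; [rewrite lee_fin; lra|lra|lra].
have nc0 : 0 < normc c by rewrite normc_gt0.
have [r [r0 rE]] : exists r : R, 0 < r /\ d = r * normc c.
  by exists (d / normc c); rewrite divr_gt0// mulfVK// gt_eqF.
have ci : c^-1 != 0 by rewrite invr_eq0.
have [mT aT] := carea_affine (- (c^-1 * F w1)) ci (cmeas_cbox (- a - r) r (- b - r) r).
have : F @` (hbox s (s + a) t (t + b)) `<=` [set z | cbox (- a - r) r (- b - r) r (c^-1 * z + - (c^-1 * F w1))].
  move=> _ [w Qw <-] /=; have := near1 w Qw.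
  have [v vE] : exists v : R[i], v = c^-1 * F w + - (c^-1 * F w1) by eexists.
  rewrite -vE.
  have -> : F w - F w1 - c * (w - w1) = c * (v - (w - w1)) by rewrite vE; field.
  rewrite normcM rE mulrC ler_pM2r// => h.
  have := le_trans (le_normc_Re _) h; have := le_trans (le_normc_Im _) h.
  have [/andP[h1 h2] /andP[h3 h4]] := Qw.
  rewrite !ReImE w1r w1i !ler_norml => /andP[k1 k2] /andP[k3 k4].
  by split; apply/andP; split; lra.
move=> /(le_carea (near_linear_cmeas near) mT) /le_trans; apply.
rewrite aT carea_cbox; [|lra|lra].
rewrite -EFinM lee_fin normcV rE.
rewrite le_eqVlt; apply/orP; left; apply/eqP; field.
by rewrite gt_eqF.
Qed.

(** In the coordinate c^-1 z the map is the identity plus a contraction [k] of size at most r = d /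
    |c|, so [perturbation_onto] applies. It needs a closed box inside the half-open one, which costs
    r on the left and below, and the displacement costs r on every side: hence the sides a - 3r and
    b - 3r. *)
Lemma carea_near_linear_ge (R : realType) (F : R[i] -> R[i]) (c : R[i]) (s t a b e : R) d :
  0 < a -> 0 < b -> 0 < e -> lip_on (hbox s (s + a) t (t + b)) e (fun w => F w - c * w) ->
  e * (a + b) <= d ->
  3 * d <= normc c * a -> 3 * d <= normc c * b ->
  (((normc c * a - 3 * d) * (normc c * b - 3 * d))%:E <= carea (F @` (hbox s (s + a) t (t + b))))%E.
Proof.
move=> a0 b0 e0 near de ha hb.
have ab : 0 < a + b by exact: addr_gt0.
have d0 : 0 < d by apply: lt_le_trans de; rewrite mulr_gt0.
have [w1 [w1r w1i Qw1]] := hbox_corner s t a0 b0.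
have nc0 : 0 < normc c.
  by have : 0 < normc c * a; [apply: lt_le_trans ha; rewrite mulr_gt0|rewrite pmulr_lgt0].
have c0 : c != 0 by rewrite -normc_gt0.
have [r [r0 rE]] : exists r : R, 0 < r /\ d = r * normc c.
  by exists (d / normc c); rewrite divr_gt0// mulfVK// gt_eqF.
have ra : 3 * r <= a by rewrite -(ler_pM2r nc0) -mulrA -rE [a * _]mulrC.
have rb : 3 * r <= b by rewrite -(ler_pM2r nc0) -mulrA -rE [b * _]mulrC.
have ci : c^-1 != 0 by rewrite invr_eq0.
have [k kdef] : exists k : R[i] -> R[i], k = fun w => c^-1 * (F w - F w1) - (w - w1) by eexists.
have kE z w : k z - k w = c^-1 * ((F z - c * z) - (F w - c * w)).
  by rewrite kdef; field.
have k_lip z w : (hbox s (s + a) t (t + b)) z -> (hbox s (s + a) t (t + b)) w -> normc (k z - k w) <= (e / normc c) * normc (z - w).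
  move=> Qz Qw; rewrite kE normcM normcV mulrAC mulrC ler_pM2r ?invr_gt0//.
  exact: near.
have k_le w : (hbox s (s + a) t (t + b)) w -> normc (k w) <= r.
  move=> Qw; rewrite -(ler_pM2r nc0) mulrC -rE -normcM.
  by rewrite (_ : c * k w = F w - F w1 - c * (w - w1)) ?(near_linear_corner a0 b0 e0 near)// kdef; field.
have [mT aT] := carea_affine (w1 - (c^-1 * F w1)) ci
  (cmeas_cbox (s + 2 * r) (s + a - r) (t + 2 * r) (t + b - r)).
have sub : [set z | cbox (s + 2 * r) (s + a - r) (t + 2 * r) (t + b - r)
    (c^-1 * z + (w1 - (c^-1 * F w1)))] `<=` F @` (hbox s (s + a) t (t + b)).
  move=> z /=.
  have [v vE] : exists v : R[i], v = c^-1 * z + (w1 - (c^-1 * F w1)) by eexists.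
  rewrite -vE => -[/andP[h1 h2] /andP[h3 h4]].
  have SQ : cbox (s + r) (s + a) (t + r) (t + b) `<=` (hbox s (s + a) t (t + b)).
    by move=> w [/andP[? ?] /andP[? ?]]; split; apply/andP; split; lra.
  have [||z' w Sz Sw|w Sw|x Sx xE] := @perturbation_onto _ _ k (e / normc c) v
      (@compact_cbox R (s + r) (s + a) (t + r) (t + b)).
  - by exists w1; split; rewrite ?w1r ?w1i; apply/andP; split; lra.
  - rewrite ltr_pdivrMr// mul1r -(ltr_pM2r a0); apply: lt_le_trans ha.
    by rewrite -subr_gt0; have := mulr_gt0 e0 b0; have := mulr_gt0 e0 a0; lra.
  - by apply: k_lip; exact: SQ.
  - have := k_le w (SQ _ Sw) => h.
    have := le_trans (le_normc_Re _) h; have := le_trans (le_normc_Im _) h.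
    rewrite !ler_norml => /andP[k1 k2] /andP[k3 k4].
    by split; rewrite !ReImE; apply/andP; split; lra.
  exists x; first exact: SQ.
  apply: (mulfI ci); apply: (addIr (w1 - c^-1 * F w1)).
  by rewrite -vE -xE kdef; ring.
have := le_carea mT (near_linear_cmeas near) sub; apply: le_trans.
rewrite aT carea_cbox; [|lra|lra].
rewrite -EFinM lee_fin normcV rE.
rewrite le_eqVlt; apply/orP; left; apply/eqP; field.
by rewrite gt_eqF.
Qed.

Lemma carea_near_linear_fin (R : realType) (F : R[i] -> R[i]) (c : R[i]) (s t a b e : R) :
  0 < a -> 0 < b -> 0 < e -> lip_on (hbox s (s + a) t (t + b)) e (fun w => F w - c * w) ->
  (carea (F @` (hbox s (s + a) t (t + b))) < +oo)%E.
Proof.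
by move=> a0 b0 e0 near; exact: le_lt_trans (carea_near_linear_le a0 b0 e0 near (lexx _)) (ltry _).
Qed.

(** With d = e (a + b) <= a + b, the upper estimate exceeds |c|^2 a b by at most (2 |c| + 4) d (a +
    b), and the lower one falls short by at most 3 |c| d (a + b); [3 * B + 4] covers both. *)
Lemma carea_near_linear (R : realType) (F : R[i] -> R[i]) (c : R[i]) (s t a b e : R) (B : R) :
  0 < a -> 0 < b -> 0 < e -> lip_on (hbox s (s + a) t (t + b)) e (fun w => F w - c * w) ->
  normc c <= B -> e <= 1 ->
  `|fine (carea (F @` (hbox s (s + a) t (t + b)))) - normc c ^+ 2 * (a * b)| <= e * (a + b) ^+ 2 * (3 * B + 4).
Proof.
move=> a0 b0 e0 near cB e1.
have ab : 0 < a + b by exact: addr_gt0.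
have c0 := normc_ge0 c.
have le d := @carea_near_linear_le _ _ _ _ _ _ _ _ d a0 b0 e0 near.
have ge d := @carea_near_linear_ge _ _ _ _ _ _ _ _ d a0 b0 e0 near.
have fin : carea (F @` (hbox s (s + a) t (t + b))) = (fine (carea (F @` (hbox s (s + a) t (t + b)))))%:E.
  by rewrite fineK// ge0_fin_numE ?(carea_near_linear_fin a0 b0 e0 near)// measure_ge0.
have m0 : 0 <= fine (carea (F @` (hbox s (s + a) t (t + b)))) by rewrite fine_ge0// measure_ge0.
move: m0 le ge; rewrite fin /=; move: (fine _) => m m0 le ge {fin}.
have [d dE] : exists d, d = e * (a + b) by eexists.
have {}le := le d; have {}ge := ge d; rewrite -dE in le ge.
have {}le := le (lexx d); have {}ge := ge (lexx d); rewrite !lee_fin in le ge.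
have d0 : 0 < d by rewrite dE mulr_gt0.
rewrite (_ : e * (a + b) ^+ 2 = d * (a + b)); last by rewrite dE; ring.
have dle : d <= a + b by rewrite dE ler_piMl// ltW.
clear dE near.
rewrite ler_distl; apply/andP; split; last first.
  apply: le_trans le _.
  have : normc c * (d * (a + b)) <= B * (d * (a + b)) by rewrite ler_wpM2r// ltW// mulr_gt0.
  have : d * d <= d * (a + b) by rewrite ler_pM2l.
  have : 0 <= normc c * (d * (a + b)) by rewrite mulr_ge0// ltW// mulr_gt0.
  lra.
have dab0 : 0 < d * (a + b) by rewrite mulr_gt0.
have Bd : normc c * (d * (a + b)) <= B * (d * (a + b)) by rewrite ler_pM2r.
have cda : 0 <= normc c * (d * a) by rewrite mulr_ge0// ltW// mulr_gt0.
have cdb : 0 <= normc c * (d * b) by rewrite mulr_ge0// ltW// mulr_gt0.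
have dd : 0 < d * d by rewrite mulr_gt0.
(* When a side is too short for the lower estimate, |c|^2 a b is itself below the permitted
   error. *)
have [ha|ha] := leP (3 * d) (normc c * a); last first.
  have : normc c * a * (normc c * b) <= 3 * d * (normc c * b).
    by apply: ler_wpM2r; [rewrite mulr_ge0// ltW|exact: ltW].
  lra.
have [hb|hb] := leP (3 * d) (normc c * b); last first.
  have : normc c * b * (normc c * a) <= 3 * d * (normc c * a).
    by apply: ler_wpM2r; [rewrite mulr_ge0// ltW|exact: ltW].
  lra.
have := ge ha hb; lra.
Qed.

(** * Additivity of area over grids of boxes *)

Lemma carea_fin_ge0 (R : realType) (S : set R[i]) : (0 <= carea S)%E.
Proof. exact: measure_ge0. Qed.

Lemma careaU (R : realType) (S T : set R[i]) : cmeas S -> cmeas T ->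
  (forall z, S z -> T z -> False) ->
  cmeas (S `|` T) /\ carea (S `|` T) = (carea S + carea T)%E.
Proof.
move=> mS mT ST; split; first exact: measurableU.
rewrite /carea preimage_setU measureU//.
by apply/seteqP; split => // p [Sp Tp]; exact: ST Sp Tp.
Qed.

Lemma hbox_splitr (R : realType) (s s' s'' t t' : R) : s <= s' -> s' <= s'' ->
  hbox s s'' t t' = hbox s s' t t' `|` hbox s' s'' t t'.
Proof.
move=> s1 s2; apply/seteqP; split=> z.
  move=> [/andP[h1 h2] h3]; have [h|h] := leP (complex.Re z) s'.
    by left; split=> //; rewrite h1 h.
  by right; split=> //; rewrite h h2.
case=> -[/andP[h1 h2] h3]; split=> //; apply/andP; split=> //.
- exact: le_trans h2 s2.
- exact: le_lt_trans s1 h1.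
Qed.

Lemma hbox_spliti (R : realType) (s s' t t' t'' : R) : t <= t' -> t' <= t'' ->
  hbox s s' t t'' = hbox s s' t t' `|` hbox s s' t' t''.
Proof.
move=> s1 s2; apply/seteqP; split=> z.
  move=> [h3 /andP[h1 h2]]; have [h|h] := leP (complex.Im z) t'.
    by left; split=> //; rewrite h1 h.
  by right; split=> //; rewrite h h2.
case=> -[h3 /andP[h1 h2]]; split=> //; apply/andP; split=> //.
- exact: le_trans h2 s2.
- exact: le_lt_trans s1 h1.
Qed.

Lemma hbox_emptyr (R : realType) (s t t' : R) : hbox s s t t' = set0.
Proof. by apply/seteqP; split=> // z [/andP[h1 h2] _]; have := lt_le_trans h1 h2; rewrite ltxx. Qed.

Lemma hbox_emptyi (R : realType) (s s' t : R) : hbox s s' t t = set0.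
Proof. by apply/seteqP; split=> // z [_ /andP[h1 h2]]; have := lt_le_trans h1 h2; rewrite ltxx. Qed.

Lemma cmeas0 (R : realType) : cmeas (@set0 R[i]).
Proof. by rewrite /cmeas preimage_set0. Qed.

Lemma carea0 (R : realType) : carea (@set0 R[i]) = 0%E.
Proof. by rewrite /carea preimage_set0 measure0. Qed.

Lemma sub_hbox (R : realType) (s s' t t' u u' v v' : R) : u <= s -> s' <= u' -> v <= t -> t' <= v' ->
  hbox s s' t t' `<=` hbox u u' v v'.
Proof.
move=> h1 h2 h3 h4 z [/andP[k1 k2] /andP[k3 k4]]; split; apply/andP; split.
- exact: le_lt_trans k1.
- exact: le_trans h2.
- exact: le_lt_trans k3.
- exact: le_trans h4.
Qed.

Lemma set_injS (T U : Type) (A B : set T) (F : T -> U) : A `<=` B ->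
  set_inj B F -> set_inj A F.
Proof. by move=> AB iF x y /set_mem/AB/mem_set xA /set_mem/AB/mem_set yA; exact: iF. Qed.

Lemma carea_image_cut (R : realType) (F : R[i] -> R[i]) (S S1 S2 : set R[i]) :
  S = S1 `|` S2 -> (forall z, S1 z -> S2 z -> False) -> set_inj S F ->
  cmeas (F @` S1) -> cmeas (F @` S2) ->
  cmeas (F @` S) /\ carea (F @` S) = (carea (F @` S1) + carea (F @` S2))%E.
Proof.
move=> -> S12 iF m1 m2; rewrite image_setU; apply: careaU => // _ [x Sx <-] [y Sy] xy.
apply: (S12 x) => //; rewrite -(iF y x) ?inE//=; [by right|by left].
Qed.

Lemma carea_row (R : realType) (F : R[i] -> R[i]) (s s' t b : R) (N : nat) : 0 <= b ->
  set_inj (hbox s s' t (t + N%:R * b)) F ->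
  (forall k, (k < N)%N -> cmeas (F @` hbox s s' (t + k%:R * b) (t + k%:R * b + b))) ->
  cmeas (F @` hbox s s' t (t + N%:R * b)) /\
  carea (F @` hbox s s' t (t + N%:R * b)) =
    (\sum_(k < N) carea (F @` hbox s s' (t + k%:R * b) (t + k%:R * b + b)))%E.
Proof.
move=> b0; elim: N => [|N IH] iF mF.
  by rewrite mul0r addr0 hbox_emptyi image_set0 big_ord0 carea0; split=> //; exact: cmeas0.
have Nb : t + N.+1%:R * b = t + N%:R * b + b by rewrite -natr1 mulrDl mul1r addrA.
have t1 : t <= t + N%:R * b by rewrite lerDl mulr_ge0.
have t2 : t + N%:R * b <= t + N.+1%:R * b by rewrite Nb lerDl.
have [||mN aN] := IH.
- by apply: set_injS iF; apply: sub_hbox.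
- by move=> k kN; apply: mF; exact: ltnW.
rewrite big_ord_recr/= -aN.
have dis z : hbox s s' t (t + N%:R * b) z ->
    hbox s s' (t + N%:R * b) (t + N%:R * b + b) z -> False.
  by move=> [_ /andP[_ h1]] [_ /andP[h2 _]]; have := lt_le_trans h2 h1; rewrite ltxx.
rewrite Nb in iF t2 *.
exact: (carea_image_cut (hbox_spliti _ _ t1 t2) dis iF mN (mF N (ltnSn N))).
Qed.

Lemma carea_grid (R : realType) (F : R[i] -> R[i]) (s t a b : R) (M N : nat) :
  0 <= a -> 0 <= b ->
  set_inj (hbox s (s + M%:R * a) t (t + N%:R * b)) F ->
  (forall j k, (j < M)%N -> (k < N)%N ->
    cmeas (F @` hbox (s + j%:R * a) (s + j%:R * a + a) (t + k%:R * b) (t + k%:R * b + b))) ->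
  cmeas (F @` hbox s (s + M%:R * a) t (t + N%:R * b)) /\
  carea (F @` hbox s (s + M%:R * a) t (t + N%:R * b)) =
    (\sum_(j < M) \sum_(k < N)
      carea (F @` hbox (s + j%:R * a) (s + j%:R * a + a) (t + k%:R * b) (t + k%:R * b + b)))%E.
Proof.
move=> a0 b0; elim: M => [|M IH] iF mF.
  by rewrite mul0r addr0 hbox_emptyr image_set0 big_ord0 carea0; split=> //; exact: cmeas0.
have Nb : s + M.+1%:R * a = s + M%:R * a + a by rewrite -natr1 mulrDl mul1r addrA.
have t1 : s <= s + M%:R * a by rewrite lerDl mulr_ge0.
have t2 : s + M%:R * a <= s + M.+1%:R * a by rewrite Nb lerDl.
have [||mN aN] := IH.
- by apply: set_injS iF; apply: sub_hbox.
- by move=> j k jM kN; apply: mF => //; exact: ltnW.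
rewrite big_ord_recr/= -aN.
have dis z : hbox s (s + M%:R * a) t (t + N%:R * b) z ->
    hbox (s + M%:R * a) (s + M%:R * a + a) t (t + N%:R * b) z -> False.
  by move=> [/andP[_ h1] _] [/andP[h2 _] _]; have := lt_le_trans h2 h1; rewrite ltxx.
rewrite Nb in iF t2 *.
have [||m1 <-] := @carea_row _ F (s + M%:R * a) (s + M%:R * a + a) t b N b0.
- by apply: set_injS iF; apply: sub_hbox.
- by move=> k kN; exact: mF.
exact: (carea_image_cut (hbox_splitr _ _ t1 t2) dis iF mN m1).
Qed.

(** For M = N and sides a, b of order 1/N, the factor M N (a + b)^2 stays bounded under refinement,
    so the total error is of the order of e. *)
Lemma carea_grid_near_linear (R : realType) (F : R[i] -> R[i]) (D : nat -> nat -> R[i])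
    (s t a b e B : R) (M N : nat) : 0 < a -> 0 < b -> 0 < e -> e <= 1 ->
  set_inj (hbox s (s + M%:R * a) t (t + N%:R * b)) F ->
  (forall j k, (j < M)%N -> (k < N)%N -> normc (D j k) <= B) ->
  (forall j k, (j < M)%N -> (k < N)%N ->
    lip_on (hbox (s + j%:R * a) (s + j%:R * a + a) (t + k%:R * b) (t + k%:R * b + b)) e
      (fun w => F w - D j k * w)) ->
  [/\ cmeas (F @` hbox s (s + M%:R * a) t (t + N%:R * b)),
   (carea (F @` hbox s (s + M%:R * a) t (t + N%:R * b)) < +oo)%E &
   `|fine (carea (F @` hbox s (s + M%:R * a) t (t + N%:R * b))) -
      (\sum_(j < M) \sum_(k < N) normc (D j k) ^+ 2) * (a * b)| <=
      M%:R * N%:R * (e * (a + b) ^+ 2 * (3 * B + 4))].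
Proof.
move=> a0 b0 e0 e1 iF DB near.
have [|m ->] := carea_grid (ltW a0) (ltW b0) iF.
  by move=> j k jM kN; exact: near_linear_cmeas (near j k jM kN).
have E j k (jM : (j < M)%N) (kN : (k < N)%N) := carea_near_linear_fin a0 b0 e0 (near j k jM kN).
pose c j k := fine (carea (F @` hbox (s + j%:R * a) (s + j%:R * a + a) (t + k%:R * b) (t + k%:R * b + b))).
have -> : (\sum_(j < M) \sum_(k < N)
      carea (F @` hbox (s + j%:R * a) (s + j%:R * a + a) (t + k%:R * b) (t + k%:R * b + b)))%E
    = (\sum_(j < M) \sum_(k < N) c j k)%:E.
  rewrite -sumEFin; apply: eq_bigr => j _; rewrite -sumEFin; apply: eq_bigr => k _.
  by rewrite fineK// ge0_fin_numE ?E// carea_fin_ge0.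
split=> //=; first exact: ltry.
rewrite mulr_suml -sumrB (le_trans (ler_norm_sum _ _ _))//.
rewrite -mulrA -[M in leRHS]card_ord mulr_natl -sumr_const ler_sum// => j _.
rewrite mulr_suml -sumrB (le_trans (ler_norm_sum _ _ _))//.
rewrite -[N in leRHS]card_ord mulr_natl -sumr_const ler_sum// => k _.
by apply: carea_near_linear => //; [exact: near|exact: DB].
Qed.

(** * The complex exponential *)

Lemma mean_value0 (R : realType) (f df : R -> R) (y : R) :
  (forall x : R, is_derive x 1 f (df x)) ->
  exists2 c, `|c| <= `|y| & f y - f 0 = df c * y.
Proof.
move=> fd.
have cf : forall A, {within A, continuous f}.
  move=> A; apply: continuous_subspaceT => x; apply: differentiable_continuous.
  by apply/derivable1_diffP; case: (fd x).
have [y0|y0] := leP 0 y.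
  have [c] := MVT_segment y0 (fun x _ => fd x) (cf _).
  rewrite in_itv/= subr0 => /andP[c0 cy] ->; exists c => //.
  by rewrite !ger0_norm.
have [c] := MVT_segment (ltW y0) (fun x _ => fd x) (cf _).
rewrite in_itv/= sub0r => /andP[c0 cy] E; exists c.
  by rewrite !ler0_norm ?lerN2// ltW.
by rewrite -opprB E mulrN opprK.
Qed.

Lemma ler_norm_sin (R : realType) (y : R) : `|sin y| <= `|y|.
Proof.
have [c _] := @mean_value0 R sin cos y (fun x => is_derive_sin x).
by rewrite sin0 subr0 => ->; rewrite normrM ler_piMl// cos_max.
Qed.

(** The minimum keeps both the linear bound, used for exp v - 1, and the quadratic one, used for exp
    v - 1 - v. *)
Lemma ler_norm_cosB1 (R : realType) (y : R) : `|cos y - 1| <= `|y| * Num.min 1 `|y|.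
Proof.
have [c cy] := @mean_value0 R cos (fun x => - sin x) y (fun x => is_derive_cos x).
rewrite cos0 => ->; rewrite normrM normrN mulrC ler_wpM2l// le_min sin_max/=.
exact: le_trans (ler_norm_sin _) cy.
Qed.

Lemma ler_norm_sinB (R : realType) (y : R) : `|sin y - y| <= y ^+ 2.
Proof.
have [c cy] := @mean_value0 R (fun x => sin x - x) (fun x => cos x - 1) y
  (fun x => is_deriveB (is_derive_sin x) (is_derive_id x 1)).
rewrite sin0 !subr0 => ->; rewrite normrM -real_normK ?num_real// expr2 ler_wpM2r//.
apply: le_trans cy; apply: le_trans (ler_norm_cosB1 _) _.
by rewrite ler_piMr// ge_min lexx.
Qed.

Lemma expRB1_le (R : realType) (x : R) : `|expR x - 1| <= `|x| * expR `|x|.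
Proof.
have [x0|x0] := leP 0 x.
  rewrite !ger0_norm ?subr_ge0 -?expR0 ?ler_expR// expR0.
  have := expR_ge1Dx (- x); rewrite expRN -(ler_pM2r (expR_gt0 x)) mulVf ?gt_eqF ?expR_gt0//.
  lra.
rewrite !ltr0_norm// ?subr_lt0 ?expR_lt1//.
have := expR_ge1Dx x; have : 1 <= expR (- x) by rewrite -expR0 ler_expR oppr_ge0 ltW.
move=> h1 h2; have : - x * 1 <= - x * expR (- x) by rewrite ler_wpM2l// oppr_ge0 ltW.
lra.
Qed.

Lemma expRB1B_le (R : realType) (x : R) : `|expR x - 1 - x| <= x ^+ 2 * expR `|x|.
Proof.
have h := expR_ge1Dx x.
rewrite ger0_norm; last by rewrite -addrA -opprD subr_ge0.
have [x0|x0] := leP 0 x.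
  have := expRB1_le x; rewrite !ger0_norm ?subr_ge0 -?expR0 ?ler_expR// expR0 => k.
  have e := expR_ge1Dx (- x).
  have := expR_ge1Dx (- x); rewrite expRN -(ler_pM2r (expR_gt0 x)) mulVf ?gt_eqF ?expR_gt0//.
  have : x * (expR x - 1) <= x * (x * expR x) by rewrite ler_wpM2l.
  lra.
have x2 : x ^+ 2 * 1 <= x ^+ 2 * expR `|x|.
  by rewrite ler_wpM2l ?sqr_ge0// -expR0 ler_expR.
apply: le_trans x2.
have := expR_ge1Dx (- x); rewrite expRN => k.
have e0 := expR_gt0 x.
have : (1 + - x) * expR x <= 1.
  by have := ler_wpM2r (ltW e0) k; rewrite mulVf ?gt_eqF.
have x1 : 0 < 1 - x by rewrite subr_gt0 (lt_trans x0).
move=> k2; rewrite -(ler_pM2l x1).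
have : 0 <= (- x) ^+ 3 by rewrite exprn_ge0// oppr_ge0 ltW.
lra.
Qed.

Definition cexp (R : realType) (w : R[i]) : R[i] :=
  ((expR (complex.Re w) * cos (complex.Im w)) +i* (expR (complex.Re w) * sin (complex.Im w)))%C.

Lemma cexp0 (R : realType) : cexp (0 : R[i]) = 1.
Proof. by rewrite /cexp/= expR0 cos0 sin0 mulr0 mulr1. Qed.

Lemma cexpD (R : realType) (z w : R[i]) : cexp (z + w) = cexp z * cexp w.
Proof.
by rewrite /cexp !ReImE expRD cosD sinD; congr Complex; ring.
Qed.

Lemma normc_cexp (R : realType) (w : R[i]) : normc (cexp w) = expR (complex.Re w).
Proof.
by rewrite /cexp/= !exprMn -mulrDr cos2Dsin2 mulr1 sqrtr_sqr ger0_norm ?expR_ge0.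
Qed.

Lemma cexp_neq0 (R : realType) (w : R[i]) : cexp w != 0.
Proof. by rewrite -normc_gt0 normc_cexp expR_gt0. Qed.

Lemma cexpN (R : realType) (w : R[i]) : cexp (- w) = (cexp w)^-1.
Proof.
by apply: (mulfI (cexp_neq0 w)); rewrite -cexpD subrr cexp0 mulfV// cexp_neq0.
Qed.

Lemma cexpMn (R : realType) (w : R[i]) n : cexp (w *+ n) = cexp w ^+ n.
Proof. by elim: n => [|n IH]; rewrite ?mulr0n ?cexp0// mulrS cexpD IH exprS. Qed.

Lemma cexpB1_le (R : realType) (v : R[i]) : normc (cexp v - 1) <= 3 * normc v * expR (normc v).
Proof.
case: v => x y; have [n nE] : exists n : R, n = normc (x +i* y)%C by eexists.
rewrite -nE.
have xn : `|x| <= n by rewrite nE; exact: (le_normc_Re (x +i* y)%C).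
have yn : `|y| <= n by rewrite nE; exact: (le_normc_Im (x +i* y)%C).
have n0 : 0 <= n by rewrite nE; exact: normc_ge0.
clear nE.
have en : 1 <= expR n by rewrite -expR0 ler_expR.
have exn : expR x <= expR n by rewrite ler_expR; exact: le_trans (ler_norm x) xn.
apply: le_trans (normc_le _) _; rewrite /cexp/= subr0.
have -> : expR x * cos y - 1 = (expR x - 1) + expR x * (cos y - 1) by ring.
have h1 : `|expR x - 1| <= n * expR n.
  by apply: le_trans (expRB1_le x) _; apply: ler_pM => //; rewrite ?expR_ge0 ?ler_expR.
have h2 : `|expR x * (cos y - 1)| <= expR n * n.
  rewrite normrM (ger0_norm (expR_ge0 _)); apply: ler_pM => //.
  apply: le_trans (ler_norm_cosB1 y) _; apply: le_trans yn.
  by rewrite ler_piMr// ge_min lexx.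
have h3 : `|expR x * sin y| <= expR n * n.
  rewrite normrM (ger0_norm (expR_ge0 _)); apply: ler_pM => //.
  exact: le_trans (ler_norm_sin y) yn.
have := ler_normD (expR x - 1) (expR x * (cos y - 1)).
lra.
Qed.

Lemma cexpB1B_le (R : realType) (v : R[i]) :
  normc (cexp v - 1 - v) <= 5 * normc v ^+ 2 * expR (normc v).
Proof.
case: v => x y; have [n nE] : exists n : R, n = normc (x +i* y)%C by eexists.
rewrite -nE.
have xn : `|x| <= n by rewrite nE; exact: (le_normc_Re (x +i* y)%C).
have yn : `|y| <= n by rewrite nE; exact: (le_normc_Im (x +i* y)%C).
have n0 : 0 <= n by rewrite nE; exact: normc_ge0.
clear nE.
have en : 1 <= expR n by rewrite -expR0 ler_expR.
have exn : expR x <= expR n by rewrite ler_expR; exact: le_trans (ler_norm x) xn.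
have x2 : x ^+ 2 <= n ^+ 2 by rewrite -(real_normK (num_real x)) ler_pXn2r// nnegrE.
have y2 : y ^+ 2 <= n ^+ 2 by rewrite -(real_normK (num_real y)) ler_pXn2r// nnegrE.
apply: le_trans (normc_le _) _; rewrite /cexp/= subr0.
have -> : expR x * cos y - 1 - x = (expR x - 1 - x) + expR x * (cos y - 1) by ring.
have -> : expR x * sin y - y = expR x * (sin y - y) + (expR x - 1) * y by ring.
have h1 : `|expR x - 1 - x| <= n ^+ 2 * expR n.
  apply: le_trans (expRB1B_le x) _; apply: ler_pM => //; rewrite ?expR_ge0 ?ler_expR//.
  exact: sqr_ge0.
have h2 : `|expR x * (cos y - 1)| <= expR n * n ^+ 2.
  rewrite normrM (ger0_norm (expR_ge0 _)); apply: ler_pM => //.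
  apply: le_trans (ler_norm_cosB1 y) _; rewrite expr2; apply: ler_pM => //.
  by apply: le_trans yn; rewrite ge_min lexx orbT.
have h3 : `|expR x * (sin y - y)| <= expR n * n ^+ 2.
  rewrite normrM (ger0_norm (expR_ge0 _)); apply: ler_pM => //.
  exact: le_trans (ler_norm_sinB y) y2.
have h4 : `|(expR x - 1) * y| <= (n * expR n) * n.
  rewrite normrM; apply: ler_pM => //.
  by apply: le_trans (expRB1_le x) _; apply: ler_pM => //; rewrite ?expR_ge0 ?ler_expR.
have h0 : 0 <= n ^+ 2 * expR n by rewrite mulr_ge0 ?sqr_ge0 ?expR_ge0.
have := ler_normD (expR x - 1 - x) (expR x * (cos y - 1)).
have := ler_normD (expR x * (sin y - y)) ((expR x - 1) * y).
lra.
Qed.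

Lemma normcZ (R : realType) (k : R) (z : R[i]) : normc (k%:C%C * z) = `|k| * normc z.
Proof. by rewrite normcM normcR. Qed.

(* The derivative is taken at an arbitrary point w0 of the cell, not at w', because
   the Riemann sum below evaluates it at cell corners. *)
Lemma cexp_scale_near (R : realType) (k d M : R) (w w' w0 : R[i]) :
  normc (w - w') <= d -> normc (w0 - w') <= d -> expR (k * complex.Re w') <= M ->
  normc (cexp (k%:C%C * w) - cexp (k%:C%C * w') - k%:C%C * cexp (k%:C%C * w0) * (w - w')) <=
    8 * k ^+ 2 * M * d * expR (`|k| * d) * normc (w - w').
Proof.
move=> vd ud eM.
have [v vE] : exists v : R[i], v = w - w' by eexists.
have [u uE] : exists u : R[i], u = w0 - w' by eexists.
rewrite -vE in vd *; rewrite -uE in ud.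
have -> : w = w' + v by rewrite vE addrC subrK.
have -> : w0 = w' + u by rewrite uE addrC subrK.
have kM z : cexp (k%:C%C * (w' + z)) = cexp (k%:C%C * w') * cexp (k%:C%C * z).
  by rewrite mulrDr cexpD.
rewrite !kM; have [c cE] : exists c : R[i], c = cexp (k%:C%C * w') by eexists.
have cM : normc c <= M.
  rewrite cE normc_cexp; congr (_ <= _) : eM; congr expR.
  by case: (w') => x y /=; rewrite mul0r subr0.
rewrite -cE.
(* The second-order remainder at w', with constant 5, and the change of base point from w' to w0,
   with constant 3, add up to 8. *)
have -> : c * cexp (k%:C%C * v) - c - k%:C%C * (c * cexp (k%:C%C * u)) * v =
   c * (cexp (k%:C%C * v) - 1 - k%:C%C * v) - c * (k%:C%C * v) * (cexp (k%:C%C * u) - 1) by ring.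
have := le_normcD (c * (cexp (k%:C%C * v) - 1 - k%:C%C * v))
  (- (c * (k%:C%C * v) * (cexp (k%:C%C * u) - 1))).
rewrite normcN => /le_trans; apply.
rewrite !normcM normcR.
have c0 := normc_ge0 c.
have n0 := normc_ge0 v.
have d0 : 0 <= d by apply: le_trans vd.
have k0 : 0 <= `|k| by [].
have e0 := expR_ge0 (`|k| * d).
have k2 : `|k| ^+ 2 = k ^+ 2 by rewrite real_normK// num_real.
have h1 : normc (cexp (k%:C%C * v) - 1 - k%:C%C * v) <= 5 * k ^+ 2 * d * expR (`|k| * d) * normc v.
  apply: le_trans (cexpB1B_le _) _; rewrite normcZ exprMn k2.
  rewrite [leRHS](_ : _ = 5 * (k ^+ 2 * (normc v * d)) * expR (`|k| * d)); last by ring.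
  apply: ler_pM.
  - by apply: mulr_ge0 => //; apply: mulr_ge0; exact: sqr_ge0.
  - exact: expR_ge0.
  - apply: ler_wpM2l => //; apply: ler_wpM2l; first exact: sqr_ge0.
    by rewrite expr2; exact: ler_wpM2l.
  - by rewrite ler_expR; apply: ler_wpM2l.
have h2 : normc (cexp (k%:C%C * u) - 1) <= 3 * (`|k| * d) * expR (`|k| * d).
  apply: le_trans (cexpB1_le _) _; rewrite normcZ.
  apply: ler_pM.
  - by rewrite !mulr_ge0// normc_ge0.
  - exact: expR_ge0.
  - by apply: ler_wpM2l => //; apply: ler_wpM2l.
  - by rewrite ler_expR; apply: ler_wpM2l.
have kn0 : 0 <= `|k| * normc v by rewrite mulr_ge0.
have M0 : 0 <= M by apply: le_trans cM.
have := ler_pM c0 (normc_ge0 _) cM h1.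
have := ler_pM (mulr_ge0 c0 kn0) (normc_ge0 (cexp (k%:C%C * u) - 1))
  (ler_wpM2r kn0 cM) h2.
rewrite -!k2 => a1 a2.
rewrite [leRHS](_ : _ = M * (5 * `|k| ^+ 2 * d * expR (`|k| * d) * normc v) +
  M * (`|k| * normc v) * (3 * (`|k| * d) * expR (`|k| * d))); last by ring.
exact: lerD.
Qed.

Lemma cexp_scale_lip (R : realType) (k d M : R) (w w' : R[i]) :
  normc (w - w') <= d -> expR (k * complex.Re w') <= M ->
  normc (cexp (k%:C%C * w) - cexp (k%:C%C * w')) <=
    3 * `|k| * M * expR (`|k| * d) * normc (w - w').
Proof.
move=> vd eM.
have [v vE] : exists v : R[i], v = w - w' by eexists.
rewrite -vE in vd *.
have -> : w = w' + v by rewrite vE addrC subrK.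
have [c cE] : exists c : R[i], c = cexp (k%:C%C * w') by eexists.
have cM : normc c <= M.
  rewrite cE normc_cexp; congr (_ <= _) : eM; congr expR.
  by case: (w') => x y /=; rewrite mul0r subr0.
rewrite mulrDr cexpD -cE -{2}[c]mulr1 -mulrBr normcM.
have d0 : 0 <= d by apply: le_trans vd; exact: normc_ge0.
have h2 : normc (cexp (k%:C%C * v) - 1) <= 3 * (`|k| * normc v) * expR (`|k| * d).
  apply: le_trans (cexpB1_le _) _; rewrite normcZ; apply: ler_wpM2l.
    by rewrite !mulr_ge0// normc_ge0.
  by rewrite ler_expR; apply: ler_wpM2l.
have := ler_pM (normc_ge0 c) (normc_ge0 _) cM h2.
by congr (_ <= _); ring.
Qed.

(** * Coefficients of the Laurent series *)

(** The modulus [normc] takes values in R, so a complex limit is expressed by a real sequence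
    tending to 0. *)
Definition clim (R : realType) (u : nat -> R[i]) (l : R[i]) : Prop :=
  (fun N => normc (u N - l)) @ \oo --> (0 : R).

Lemma clim_le (R : realType) (u : nat -> R[i]) (l c : R[i]) (B : R) (N0 : nat) :
  clim u l -> (forall N, (N0 <= N)%N -> normc (u N - c) <= B) -> normc (l - c) <= B.
Proof.
move=> ul uB; apply/ler_addgt0Pr => e e0.
have /cvgrPdist_lt/(_ e e0) [N _ hN] := ul.
pose n := maxn N N0.
have := hN n (leq_maxl _ _); rewrite /= sub0r normrN ger0_norm ?normc_ge0// => h.
apply: le_trans (normc_triangle l (u n) c) _; rewrite addrC.
by apply: lerD; [exact: uB (leq_maxr _ _)|rewrite normcB ltW].
Qed.

Lemma climB (R : realType) (u v : nat -> R[i]) (l m : R[i]) :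
  clim u l -> clim v m -> clim (fun N => u N - v N) (l - m).
Proof.
move=> ul vm; rewrite /clim.
apply: (@squeeze_cvgr _ _ _ _ (fun=> 0) (fun N => normc (u N - l) + normc (v N - m))).
- apply: nearW => N; rewrite normc_ge0/=.
  rewrite (_ : u N - v N - (l - m) = (u N - l) - (v N - m)); last by ring.
  by have := le_normcD (u N - l) (- (v N - m)); rewrite normcN.
- exact: cvg_cst.
- by rewrite -[X in _ --> X](addr0 0); exact: cvgD.
Qed.

Lemma clim_bounded (R : realType) (u : nat -> R[i]) (l : R[i]) : clim u l ->
  exists B : R, forall N, normc (u N) <= B.
Proof.
move=> ul; have /cvg_seq_bounded [M [_ hM]] : cvgn (fun N => normc (u N - l)).
  by apply/cvg_ex; exists 0.
exists (M + 1 + normc l) => N.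
have := le_normcD (u N - l) l; rewrite subrK => /le_trans; apply.
rewrite lerD2r; have /= := hM (M + 1) (ltr_pwDr ltr01 (lexx M)) N I.
by apply: le_trans; exact: ler_norm.
Qed.

(** The term z^-n b n is a difference of consecutive partial sums, which are bounded. In the
    application [c] is the leading term z. *)
Lemma coef_le_expr (R : realType) (b : nat -> R[i]) (z l c : R[i]) : z != 0 ->
  clim (fun N => c + \sum_(0 <= n < N) z ^- n * b n) l ->
  exists2 C : R, 0 <= C & forall n, normc (b n) <= C * normc z ^+ n.
Proof.
move=> z0 /clim_bounded[B hB]; exists (B + B).
  by have := normc_ge0 (c + \sum_(0 <= n < 0) z ^- n * b n); have := hB 0%N; lra.
move=> n.
have e : b n = z ^+ n * ((c + \sum_(0 <= m < n.+1) z ^- m * b m) - (c + \sum_(0 <= m < n) z ^- m * b m)).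
  rewrite big_nat_recr//= addrA [_ + z ^- n * _]addrC addrK mulrA mulfV ?mul1r//.
  by rewrite expf_neq0.
rewrite e normcM normcX mulrC ler_wpM2r ?exprn_ge0 ?normc_ge0//.
have := le_normcD (c + \sum_(0 <= m < n.+1) z ^- m * b m) (- (c + \sum_(0 <= m < n) z ^- m * b m)).
by rewrite normcN => /le_trans; apply; exact: lerD.
Qed.

Lemma geometric_sum_le (R : realType) (q : R) (m n : nat) : 0 < q < 1 ->
  \sum_(m <= i < n) q ^+ i <= q ^+ m / (1 - q).
Proof.
move=> /andP[q0 q1]; have q1' : 0 < 1 - q by rewrite subr_gt0.
rewrite ler_pdivlMr//.
have [nm|mn] := leqP n m; first by rewrite big_geq// mul0r exprn_ge0// ltW.
suff -> : (\sum_(m <= i < n) q ^+ i) * (1 - q) = q ^+ m - q ^+ n.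
  by rewrite gerBl exprn_ge0// ltW.
rewrite mulr_suml (eq_bigr (fun i => - (q ^+ i.+1 - q ^+ i))); last first.
  by move=> i _; rewrite exprS; ring.
by rewrite sumrN telescope_sumr ?opprB// ltnW.
Qed.

(** Of the decay e^(-sn), one half absorbs the growth of b n, taken with r = e^(s/2), and one
    quarter absorbs n^2; e^(-sn/4) is left. The factor n^2 is what second-order estimates of e^(-nw)
    produce. *)
Lemma coef_weight (R : realType) (b : nat -> R[i]) (s : R) : 0 < s ->
  (forall r : R, 1 < r -> exists2 C : R, 0 <= C & forall n, normc (b n) <= C * r ^+ n) ->
  exists (K q : R), [/\ 0 <= K, 0 < q < 1 &
    forall n, n%:R ^+ 2 * normc (b n) * expR (- s *+ n) <= K * q ^+ n].
Proof.
move=> s0 hb.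
have [|C C0 hC] := hb (expR (s / 2)).
  by rewrite -expR0 ltr_expR divr_gt0.
exists (64 / s ^+ 2 * C), (expR (- (s / 4))); split.
- by rewrite mulr_ge0// divr_ge0// sqr_ge0.
- by rewrite expR_gt0/= -expR0 ltr_expR oppr_lt0 divr_gt0.
move=> n.
(* Squaring n s / 8 <= e^(sn/8) gives the constant 64. *)
have n2 : n%:R ^+ 2 <= 64 / s ^+ 2 * expR (s / 4) ^+ n.
  have : n%:R * (s / 8) <= expR (s / 8) ^+ n.
    rewrite -expRM_natl; apply: le_trans (expR_ge1Dx _).
    by rewrite -mulr_natl ler_wpDl// mulrC.
  move=> h.
  have e4 : expR (s / 4) = expR (s / 8) ^+ 2.
    by rewrite expr2 -expRD; congr expR; field.
  rewrite e4 exprAC mulrAC ler_pdivlMr ?exprn_gt0//.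
  have h0 : 0 <= n%:R * (s / 8) by rewrite mulr_ge0// divr_ge0// ltW.
  have : (n%:R * (s / 8)) ^+ 2 <= (expR (s / 8) ^+ n) ^+ 2.
    by rewrite ler_pXn2r// nnegrE// (le_trans h0 h).
  rewrite (_ : (n%:R * (s / 8)) ^+ 2 = n%:R ^+ 2 * s ^+ 2 / 64); last by field.
  by rewrite ler_pdivrMr// [_ * 64]mulrC.
have e1 : 0 <= expR (- s *+ n) := expR_ge0 _.
apply: le_trans (_ : 64 / s ^+ 2 * expR (s / 4) ^+ n * (C * expR (s / 2) ^+ n) * expR (- s *+ n) <= _).
  apply: ler_wpM2r => //; apply: ler_pM => //; exact: normc_ge0.
rewrite le_eqVlt; apply/orP; left; apply/eqP.
have -> : expR (- s *+ n) = expR (- s) ^+ n by rewrite -expRM_natl mulr_natl.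
have -> : expR (- (s / 4)) ^+ n = expR (s / 4) ^+ n * expR (s / 2) ^+ n * expR (- s) ^+ n.
  by rewrite -!exprMn -!expRD; congr (expR _ ^+ n); field.
by ring.
Qed.

(* g z = z + sum of b n / z^n, as pointwise convergence outside the closed unit disc. *)
Definition outer_series (R : realType) (b : nat -> R[i]) (g : R[i] -> R[i]) : Prop :=
  forall z, 1 < normc z -> clim (fun N => z + \sum_(0 <= n < N) z ^- n * b n) (g z).

Lemma outer_series_coef (R : realType) (b : nat -> R[i]) (g : R[i] -> R[i]) :
  outer_series b g ->
  forall r : R, 1 < r -> exists2 C : R, 0 <= C & forall n, normc (b n) <= C * r ^+ n.
Proof.
move=> gb r r1; have r0 : 0 < r by apply: lt_trans r1.
have nr : normc (r%:C)%C = r by rewrite normcR gtr0_norm.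
have := gb (r%:C)%C; rewrite nr => /(_ r1) /coef_le_expr; rewrite nr; apply.
by rewrite -normc_gt0 nr.
Qed.

(** Written as exp (k w) with the real number k = -n, the form to which [cexp_scale_near] and
    [cexp_scale_lip] apply. *)
Definition expterm (R : realType) (n : nat) (w : R[i]) : R[i] := cexp ((- n%:R : R)%:C%C * w).

Lemma exptermE (R : realType) n (w : R[i]) : expterm n w = cexp w ^- n.
Proof.
rewrite /expterm -cexpMn -cexpN; congr cexp.
by rewrite -[w *+ n]mulr_natl rmorphN rmorph_nat mulNr.
Qed.

Lemma normc_expterm (R : realType) n (w : R[i]) : normc (expterm n w) = expR (- (n%:R * complex.Re w)).
Proof.
by rewrite normc_cexp; congr expR; case: w => x y /=; rewrite mul0r subr0 mulNr.
Qed.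

(* In the coordinate w = log z, g becomes w |-> g (e^w); exppart is its truncation
   at order m, and expderiv the derivative of exppart. *)
Definition exppart (R : realType) (b : nat -> R[i]) (m : nat) (w : R[i]) : R[i] :=
  cexp w + \sum_(0 <= n < m) expterm n w * b n.

Definition expderiv (R : realType) (b : nat -> R[i]) (m : nat) (w : R[i]) : R[i] :=
  cexp w + \sum_(0 <= n < m) (- n%:R : R)%:C%C * expterm n w * b n.

Lemma exppart_clim (R : realType) (b : nat -> R[i]) (g : R[i] -> R[i]) (w : R[i]) :
  outer_series b g -> 0 < complex.Re w ->
  clim (fun N => exppart b N w) (g (cexp w)).
Proof.
move=> gb w0; have := gb (cexp w); rewrite normc_cexp -expR0 ltr_expR => /(_ w0).
rewrite /exppart; congr clim; apply/funext => N; congr (_ + _).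
by apply: eq_bigr => n _; rewrite exptermE.
Qed.

Lemma weight_sum_le (R : realType) (u : nat -> R) (K q : R) (m n : nat) : 0 < q < 1 ->
  (forall n, u n <= K * q ^+ n) -> 0 <= K -> \sum_(m <= i < n) u i <= K * (q ^+ m / (1 - q)).
Proof.
move=> q01 uK K0; apply: le_trans (ler_sum _ (fun i _ => uK i)) _.
by rewrite -mulr_sumr ler_wpM2l// geometric_sum_le.
Qed.

Section exp_estimates.
Variables (R : realType) (b : nat -> R[i]) (s s' K q : R).
Hypotheses (K0 : 0 <= K) (q01 : 0 < q < 1).
Hypothesis bK : forall n, n%:R ^+ 2 * normc (b n) * expR (- (s / 2) *+ n) <= K * q ^+ n.

(** On Re w' >= s the term has size at most e^(-ns), and a displacement d <= s / 2 costs at most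
    e^(nd) <= e^(ns/2). This is the origin of the weight e^(-ns/2) in [bK]. *)
Lemma expterm_near n (d : R) (w w' w0 : R[i]) : d <= s / 2 ->
  normc (w - w') <= d -> normc (w0 - w') <= d -> s <= complex.Re w' ->
  normc ((expterm n w - expterm n w' - (- n%:R : R)%:C%C * expterm n w0 * (w - w')) * b n) <=
  8 * d * normc (w - w') * (n%:R ^+ 2 * normc (b n) * expR (- (s / 2) *+ n)).
Proof.
move=> ds vd ud sw; rewrite normcM.
have n0 : 0 <= n%:R :> R by [].
have eM : expR (- n%:R * complex.Re w') <= expR (- (n%:R * s)).
  by rewrite ler_expR mulNr lerN2 ler_wpM2l.
have d0 : 0 <= d by apply: le_trans vd; exact: normc_ge0.
have := cexp_scale_near vd ud eM; rewrite normrN ger0_norm// sqrrN => h.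
apply: le_trans (ler_wpM2r (normc_ge0 _) h) _.
rewrite [leLHS](_ : _ = 8 * d * normc (w - w') * (n%:R ^+ 2 * normc (b n) *
  (expR (- (n%:R * s)) * expR (n%:R * d)))); last by ring.
apply: ler_wpM2l; first by rewrite !mulr_ge0 ?normc_ge0.
apply: ler_wpM2l; first by rewrite mulr_ge0 ?normc_ge0 ?sqr_ge0.
rewrite -expRD ler_expR -mulr_natl.
have : n%:R * d <= n%:R * (s / 2) by rewrite ler_wpM2l.
lra.
Qed.

Lemma expterm_lip n (d : R) (w w' : R[i]) : d <= s / 2 ->
  normc (w - w') <= d -> s <= complex.Re w' ->
  normc ((expterm n w - expterm n w') * b n) <=
  3 * normc (w - w') * (n%:R ^+ 2 * normc (b n) * expR (- (s / 2) *+ n)).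
Proof.
move=> ds vd sw; rewrite normcM.
have n0 : 0 <= n%:R :> R by [].
have eM : expR (- n%:R * complex.Re w') <= expR (- (n%:R * s)).
  by rewrite ler_expR mulNr lerN2 ler_wpM2l.
have d0 : 0 <= d by apply: le_trans vd; exact: normc_ge0.
have := cexp_scale_lip vd eM; rewrite normrN ger0_norm// => h.
apply: le_trans (ler_wpM2r (normc_ge0 _) h) _.
rewrite [leLHS](_ : _ = 3 * normc (w - w') * (n%:R * (normc (b n) *
  (expR (- (n%:R * s)) * expR (n%:R * d))))); last by ring.
apply: ler_wpM2l; first by rewrite !mulr_ge0 ?normc_ge0.
rewrite -mulrA; apply: ler_pM => //.
- by rewrite !mulr_ge0 ?normc_ge0 ?expR_ge0.
(* Replacing n by n^2 lets the first-order estimate share the weight of the second-order one. *)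
- by rewrite -natrX ler_nat; case: (n) => // k; rewrite expnS expn1 leq_pmulr.
apply: ler_wpM2l; first exact: normc_ge0.
rewrite -expRD ler_expR -mulr_natl.
have : n%:R * d <= n%:R * (s / 2) by rewrite ler_wpM2l.
lra.
Qed.

(** Terms below m are linearised; those from m to N are only estimated by their Lipschitz constants,
    whose sum is a geometric tail. The bound does not involve N, so [outer_series_near] can let N
    tend to infinity with m fixed. *)
Lemma exppart_near m N (d : R) (w w' w0 : R[i]) : (m <= N)%N -> d <= s / 2 -> d <= 1 ->
  normc (w - w') <= d -> normc (w0 - w') <= d -> s <= complex.Re w' <= s' ->
  normc (exppart b N w - exppart b N w' - expderiv b m w0 * (w - w')) <=
  (8 * d * (expR (s' + 1) + K / (1 - q)) + 3 * (K * (q ^+ m / (1 - q)))) * normc (w - w').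
Proof.
move=> mN ds d1 vd ud /andP[sw ws'].
have d0 : 0 <= d by apply: le_trans vd; exact: normc_ge0.
have v0 := normc_ge0 (w - w').
pose u n : R := n%:R ^+ 2 * normc (b n) * expR (- (s / 2) *+ n).
rewrite (_ : _ - _ = (cexp w - cexp w' - cexp w0 * (w - w')) +
  (\sum_(0 <= n < m) (expterm n w - expterm n w' - (- n%:R : R)%:C%C * expterm n w0 * (w - w')) * b n +
   \sum_(m <= n < N) (expterm n w - expterm n w') * b n)); last first.
  rewrite /exppart /expderiv !(big_cat_nat (leq0n m) mN)/=.
  have -> : \sum_(0 <= n < m) (expterm n w - expterm n w' - (- n%:R : R)%:C%C * expterm n w0 * (w - w')) * b n =
    \sum_(0 <= n < m) expterm n w * b n - \sum_(0 <= n < m) expterm n w' * b n -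
    (\sum_(0 <= n < m) (- n%:R : R)%:C%C * expterm n w0 * b n) * (w - w').
    by rewrite mulr_suml -!sumrB; apply: eq_bigr => n _; ring.
  have -> : \sum_(m <= n < N) (expterm n w - expterm n w') * b n =
    \sum_(m <= n < N) expterm n w * b n - \sum_(m <= n < N) expterm n w' * b n.
    by rewrite -sumrB; apply: eq_bigr => n _; ring.
  ring.
have h1 : normc (cexp w - cexp w' - cexp w0 * (w - w')) <= 8 * d * expR (s' + 1) * normc (w - w').
  have := @cexp_scale_near R 1 d (expR s') w w' w0 vd ud.
  rewrite mul1r ler_expR => /(_ ws'); rewrite !mul1r normr1 mul1r expr1n mulr1 => /le_trans; apply.
  apply: ler_wpM2r => //; rewrite expRD.
  rewrite [leLHS](_ : _ = 8 * d * (expR s' * expR d)); last by ring.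
  apply: ler_wpM2l; first by rewrite mulr_ge0.
  by apply: ler_wpM2l; [exact: expR_ge0|rewrite ler_expR].
have h2 : normc (\sum_(0 <= n < m) (expterm n w - expterm n w' - (- n%:R : R)%:C%C * expterm n w0 * (w - w')) * b n)
    <= 8 * d * normc (w - w') * (K / (1 - q)).
  apply: le_trans (normc_sum _ _ _) _.
  apply: le_trans (ler_sum _ (fun n _ => expterm_near n ds vd ud sw)) _.
  rewrite -mulr_sumr; apply: ler_wpM2l; first by rewrite !mulr_ge0.
  by have := @weight_sum_le R u K q 0 m q01 bK K0; rewrite expr0 mul1r.
have h3 : normc (\sum_(m <= n < N) (expterm n w - expterm n w') * b n)
    <= 3 * normc (w - w') * (K * (q ^+ m / (1 - q))).
  apply: le_trans (normc_sum _ _ _) _.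
  apply: le_trans (ler_sum _ (fun n _ => expterm_lip n ds vd sw)) _.
  rewrite -mulr_sumr; apply: ler_wpM2l; first by rewrite !mulr_ge0.
  exact: (@weight_sum_le R u K q m N q01 bK K0).
apply: le_trans (le_normcD _ _) _.
apply: le_trans (lerD h1 (le_trans (le_normcD _ _) (lerD h2 h3))) _.
by rewrite le_eqVlt; apply/orP; left; apply/eqP; ring.
Qed.

Lemma expderiv_le m (w : R[i]) : 0 < s -> s <= complex.Re w <= s' ->
  normc (expderiv b m w) <= expR s' + K / (1 - q).
Proof.
move=> s0 /andP[sw ws]; apply: le_trans (le_normcD _ _) _; apply: lerD.
  by rewrite normc_cexp ler_expR.
pose u n : R := n%:R ^+ 2 * normc (b n) * expR (- (s / 2) *+ n).
apply: le_trans (normc_sum _ _ _) _.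
have : \sum_(0 <= i < m) u i <= K / (1 - q).
  by have := @weight_sum_le R u K q 0 m q01 bK K0; rewrite expr0 mul1r.
apply: le_trans; apply: ler_sum => n _.
have n0 : 0 <= n%:R :> R by [].
rewrite !normcM normcR normrN ger0_norm// normc_expterm /u mulrAC.
apply: ler_pM; rewrite ?mulr_ge0 ?normc_ge0 ?expR_ge0//.
  apply: ler_wpM2r; first exact: normc_ge0.
  by rewrite -natrX ler_nat; case: (n) => // k; rewrite expnS expn1 leq_pmulr.
rewrite ler_expR (_ : - (s / 2) *+ n = - (n%:R * (s / 2))) ?lerN2; last by rewrite mulNrn mulr_natl.
apply: ler_wpM2l => //.
by apply: le_trans sw; rewrite ler_pdivrMr// ler_pMr// ler1n.
Qed.

Lemma outer_series_near (g : R[i] -> R[i]) m (d : R) (w w' w0 : R[i]) :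
  outer_series b g -> 0 < s -> d <= s / 2 -> d <= 1 ->
  normc (w - w') <= d -> normc (w0 - w') <= d -> s <= complex.Re w' <= s' -> s <= complex.Re w ->
  normc (g (cexp w) - g (cexp w') - expderiv b m w0 * (w - w')) <=
  (8 * d * (expR (s' + 1) + K / (1 - q)) + 3 * (K * (q ^+ m / (1 - q)))) * normc (w - w').
Proof.
move=> gb s0 ds d1 vd ud sw sw1.
have w1 : 0 < complex.Re w by apply: lt_le_trans sw1.
have w2 : 0 < complex.Re w' by case/andP: sw => sw _; apply: lt_le_trans sw.
have := climB (exppart_clim gb w1) (exppart_clim gb w2).
move=> /(@clim_le _ _ _ (expderiv b m w0 * (w - w')) _ m); apply => N mN.
exact: exppart_near.
Qed.

End exp_estimates.

(** * Area swept by an annulus *)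

Lemma sqr_normcE (R : realType) (z : R[i]) : ((normc z ^+ 2)%:C)%C = z * (z^*)%C.
Proof. by rewrite normc_sqr add_Re2_Im2 sqr_normc. Qed.

(* Parseval on the N-th roots of unity is exact for polynomials of degree < N, so the
   angular Riemann sums need no limit. *)
Lemma parseval_roots (R : realType) (o : R[i]) (N L : nat) (p : nat -> R[i]) :
  normc o = 1 -> o ^+ N = 1 -> (forall j, (0 < j < N)%N -> o ^+ j != 1) -> (L <= N)%N ->
  \sum_(k < N) normc (\sum_(0 <= m < L) p m * o ^+ (m * k)) ^+ 2 =
  N%:R * \sum_(0 <= m < L) normc (p m) ^+ 2.
Proof.
move=> o1 oN oj LN; apply: complexI.
have o0 : o != 0 by rewrite -normc_gt0 o1.
have oc : (o^*)%C = o^-1.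
  by apply: (mulfI o0); rewrite -sqr_normcE o1 expr1n mulfV.
rewrite rmorphM rmorph_nat !rmorph_sum/=.
transitivity (\sum_(k < N) \sum_(0 <= m < L) \sum_(0 <= l < L)
    (p m * (p l)^*%C) * (o ^+ m / o ^+ l) ^+ k).
  apply: eq_bigr => k _; rewrite sqr_normcE rmorph_sum big_distrlr/=.
  apply: eq_bigr => m _; apply: eq_bigr => l _.
  rewrite rmorphM rmorphXn/= oc exprMn -!exprM exprVn mulrACA; congr (_ * (_ * _)).
  by rewrite exprVn -exprM.
rewrite exchange_big/=.
rewrite [RHS]mulr_sumr !big_mkord; apply: eq_bigr => m _.
rewrite exchange_big/= big_mkord (bigD1 m)//= [X in _ + X]big1 ?addr0.
  rewrite -mulr_sumr divff ?expf_neq0// (eq_bigr (fun=> 1)); last by move=> k _; rewrite expr1n.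
  by rewrite sumr_const card_ord sqr_normcE mulrC.
move=> l lm; rewrite -mulr_sumr.
set x := o ^+ m / o ^+ l.
have x1 : x != 1.
  rewrite /x; apply/eqP => /(canRL (divfK (expf_neq0 _ o0))); rewrite mul1r.
  have key (u v : nat) : (u < v < L)%N -> o ^+ u = o ^+ v -> False.
    move=> /andP[uv vL]; rewrite -(subnK (ltnW uv)) exprD => /esym/eqP.
    rewrite -[X in _ == X]mul1r (inj_eq (mulIf (expf_neq0 _ o0))); apply/negP.
    apply: oj; rewrite subn_gt0 uv/=.
    by rewrite (leq_ltn_trans (leq_subr _ _))// (leq_trans vL).
  case: (ltngtP m l) lm => [ml _|ml _|/val_inj ->]; last by rewrite eqxx.
  - by move=> /key; apply; rewrite ml/=.
  - by move=> /esym/key; apply; rewrite ml/=.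
have xN : x ^+ N = 1 by rewrite /x exprMn exprVn -!exprM ![(_ * N)%N]mulnC !exprM oN !expr1n divr1.
(* A full period of powers of a nontrivial N-th root of unity sums to 0. *)
have := subrX1 x N; rewrite xN subrr => /esym/eqP; rewrite mulf_eq0 subr_eq0 (negbTE x1)/= => /eqP ->.
by rewrite mulr0.
Qed.

Lemma cos_eq1_lt (R : realType) (x : R) : `|x| < pi *+ 2 -> cos x = 1 -> x = 0.
Proof.
move=> xpi cx; apply/eqP; apply: contraT => x0.
have x2 : x = x / 2 + x / 2 by rewrite -splitr.
move: cx; rewrite x2 cosD -!expr2 cos2sin2 => h.
have {h} s0 : sin (x / 2) = 0 by apply/eqP; rewrite -sqrf_eq0; apply/eqP; lra.
have pos (y : R) : 0 < y < pi -> sin y != 0 by move=> h; rewrite gt_eqF// sin_gt0_pi.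
move: xpi; rewrite ltr_norml => /andP[h1 h2].
have pi0 := pi_gt0 R.
move: x0; rewrite neq_lt => /orP[xn|xp].
  have : sin (- (x / 2)) != 0 by apply: pos; apply/andP; split; lra.
  by rewrite sinN s0 oppr0 eqxx.
have : sin (x / 2) != 0 by apply: pos; apply/andP; split; lra.
by rewrite s0 eqxx.
Qed.

Lemma cexp_inj (R : realType) (w w' : R[i]) :
  `|complex.Im w - complex.Im w'| < pi *+ 2 -> cexp w = cexp w' -> w = w'.
Proof.
move=> im e; have e1 : cexp (w - w') = 1 by rewrite cexpD cexpN e mulfV// cexp_neq0.
have r0 : complex.Re (w - w') = 0.
  by apply: expR_inj; rewrite -normc_cexp e1 normc1 expR0.
have i0 : complex.Im (w - w') = 0.
  apply: cos_eq1_lt; first by rewrite !ReImE.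
  by move: e1 => /(congr1 (@complex.Re R)); rewrite /cexp/= r0 expR0 mul1r.
apply/eqP; rewrite -subr_eq0; apply/eqP.
by move: r0 i0; case: (w - w') => x y /= -> ->.
Qed.

Lemma le_of_le_addn (R : realType) (x y C : R) (N0 : nat) :
  (forall N, (N0 < N)%N -> x <= y + C / N%:R) -> x <= y.
Proof.
move=> h; apply/ler_addgt0Pr => e e0.
have [M hM] : exists M : nat, `|C| / e < M%:R.
  by exists (Num.truncn (`|C| / e)).+1; exact: truncnS_gt.
apply: le_trans (h (maxn N0 M).+1 _) _; first by rewrite ltnS leq_maxl.
rewrite lerD2l ler_pdivrMr//.
apply: le_trans (ler_norm _) _; rewrite -ler_pdivrMl// mulrC; apply: ltW; apply: lt_trans hM _.
by rewrite ltr_nat ltnS leq_maxr.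
Qed.

(* With x = log r: pi * Hpart b m x is the area enclosed by the image of the circle
   |z| = r under the truncated series, and 2 * pi * Spart b m x its derivative in x.
   By Parseval, 2 * pi * Spart is also the integral of |expderiv|^2 over Re w = x. *)
Definition gterm (R : realType) (b : nat -> R[i]) (x : R) (n : nat) : R :=
  n%:R * normc (b n) ^+ 2 * expR (- (2 * n%:R * x)).

Definition Hpart (R : realType) (b : nat -> R[i]) (m : nat) (x : R) : R :=
  expR (2 * x) - \sum_(0 <= n < m) gterm b x n.

Definition Spart (R : realType) (b : nat -> R[i]) (m : nat) (x : R) : R :=
  expR (2 * x) + \sum_(0 <= n < m) n%:R * gterm b x n.

Lemma cexp_line (R : realType) (x y : R) k :
  cexp ((x +i* (k%:R * y))%C : R[i]) = (expR x)%:C%C * cexp ((0 +i* y)%C : R[i]) ^+ k.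
Proof.
rewrite -cexpMn (_ : ((x +i* (k%:R * y))%C : R[i]) = (x +i* 0)%C + (0 +i* y)%C *+ k).
  by rewrite cexpD; congr (_ * _); rewrite /cexp/= cos0 sin0 mulr1 mulr0.
suff -> : ((0 +i* y)%C : R[i]) *+ k = (0 +i* (k%:R * y))%C.
  by apply/eqP; rewrite eq_complex/= addr0 add0r !eqxx.
elim: k => [|k IH]; first by rewrite mulr0n mul0r.
by rewrite mulrSr IH; apply/eqP; rewrite eq_complex/= addr0 eqxx/= -natr1 mulrDl mul1r.
Qed.

Lemma expderiv_parseval (R : realType) (b : nat -> R[i]) (m N : nat) (x : R) : (m < N)%N ->
  \sum_(k < N) normc (expderiv b m ((x +i* (k%:R * (pi *+ 2 / N%:R)))%C)) ^+ 2 =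
  N%:R * Spart b m x.
Proof.
move=> mN; have N0 : (0 < N)%N by apply: leq_ltn_trans mN.
have NR : 0 < N%:R :> R by rewrite ltr0n.
have pi2 : 0 < pi *+ 2 :> R by rewrite pmulrn_lgt0 ?pi_gt0.
pose z : R[i] := cexp ((0 +i* (pi *+ 2 / N%:R))%C).
pose o : R[i] := z^-1.
have z0 : z != 0 by exact: cexp_neq0.
have z1 : normc z = 1 by rewrite normc_cexp/= expR0.
(* Multiplication by o^k, of modulus 1, turns e^x z^k into the constant e^x and z^(-nk) into
   o^((n+1)k). So [expderiv] becomes a polynomial in o^k with m + 1 coefficients, whence the
   condition m < N. *)
pose p (l : nat) : R[i] := if l is n.+1 then (- n%:R : R)%:C%C * (expR (- (n%:R * x)))%:C%C * b n
  else (expR x)%:C%C.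
have cz j : z ^+ j = cexp ((0 +i* (j%:R * (pi *+ 2 / N%:R)))%C).
  by rewrite cexp_line expR0 mul1r.
have -> : Spart b m x = \sum_(0 <= l < m.+1) normc (p l) ^+ 2.
  have p0 : normc (p 0%N) = expR x by rewrite normcR ger0_norm// expR_ge0.
  rewrite big_nat_recl// p0; congr (_ + _).
    by rewrite expr2 -expRD; congr expR; ring.
  apply: eq_bigr => n _; rewrite !normcM !normcR !exprMn normrN.
  rewrite !real_normK ?num_real// /gterm [expR _ ^+ 2]expr2 -expRD.
  rewrite (_ : - (n%:R * x) - n%:R * x = - (2 * n%:R * x)); last by ring.
  by ring.
rewrite -(@parseval_roots _ o)//; last 3 first.
- by rewrite normcV z1 invr1.
- rewrite /o exprVn cz mulrCA divff ?gt_eqF// mulr1 /cexp/= expR0 !mul1r.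
  by rewrite cos2pi sin2pi invr1.
- move=> j /andP[j0 jN]; rewrite /o exprVn invr_eq1 cz; apply/eqP => e.
  have : ((0 +i* (j%:R * (pi *+ 2 / N%:R)))%C : R[i]) = 0.
    apply: cexp_inj; last by rewrite e cexp0.
    rewrite /= subr0 ger0_norm; last by rewrite mulr_ge0// divr_ge0// ltW.
    by rewrite mulrCA gtr_pMr// ltr_pdivrMr// mul1r ltr_nat.
  move=> [] /eqP; rewrite mulf_eq0 pnatr_eq0 eqn0Ngt j0/=.
  by rewrite mulf_eq0 invr_eq0 !gt_eqF.
apply: eq_bigr => k _; congr (_ ^+ 2).
rewrite -[LHS]mul1r -[X in X * _](_ : normc (o ^+ k) = 1); last first.
  by rewrite normcX normcV z1 invr1 expr1n.
rewrite -normcM; congr normc.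
rewrite /expderiv mulrDr big_nat_recl//= mul0n expr0 mulr1; congr (_ + _).
  by rewrite cexp_line -/z mulrCA -exprMn mulVf// expr1n mulr1.
rewrite mulr_sumr; apply: eq_bigr => n _.
rewrite exptermE cexp_line -/z exprMn invfM -exprM [(k * n)%N]mulnC.
rewrite (_ : (expR (- (n%:R * x)))%:C%C = (((expR x)%:C)%C ^+ n)^-1); last first.
  by rewrite expRN fmorphV expRM_natl rmorphXn.
rewrite mulSn exprD (_ : z ^- (n * k) = o ^+ (n * k)); last by rewrite exprVn.
by move: (_^-1) (o ^+ (n * k)) (o ^+ k) => u v v'; ring.
Qed.

Lemma expR_riemann (R : realType) (k x a : R) :
  `|expR (k * (x + a)) - expR (k * x) - k * a * expR (k * x)| <=
  k ^+ 2 * a ^+ 2 * expR (`|k| * `|a|) * expR (k * x).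
Proof.
rewrite (_ : _ - _ = expR (k * x) * (expR (k * a) - 1 - k * a)); last first.
  by rewrite mulrDr expRD; ring.
rewrite normrM ger0_norm ?expR_ge0// mulrC; apply: ler_wpM2r; first exact: expR_ge0.
by apply: le_trans (expRB1B_le _) _; rewrite exprMn normrM.
Qed.

(** The derivative of [Hpart] is 2 [Spart], and the second-order remainder is bounded term by term.
    Since x >= s >= 0 the decaying exponentials are at most 1, so C does not depend on x. *)
Lemma Hpart_riemann (R : realType) (b : nat -> R[i]) (m : nat) (s s' A : R) : 0 <= s ->
  exists2 C : R, 0 <= C & forall x a : R, s <= x <= s' -> 0 <= a <= A ->
    `|Hpart b m (x + a) - Hpart b m x - 2 * a * Spart b m x| <= C * a ^+ 2.
Proof.
move=> s0.
exists (4 * expR (2 * A) * expR (2 * s') +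
  \sum_(0 <= n < m) n%:R * normc (b n) ^+ 2 * (4 * n%:R ^+ 2 * expR (2 * n%:R * A))).
  apply: addr_ge0; first by rewrite !mulr_ge0 ?expR_ge0.
  by apply: sumr_ge0 => n _; rewrite !mulr_ge0 ?expR_ge0 ?exprn_ge0 ?normc_ge0.
move=> x a /andP[sx xs] /andP[a0 aA].
have x0 : 0 <= x by apply: le_trans sx.
rewrite (_ : _ - _ = (expR (2 * (x + a)) - expR (2 * x) - 2 * a * expR (2 * x)) -
  \sum_(0 <= n < m) (gterm b (x + a) n - gterm b x n - (- (2 * n%:R)) * a * gterm b x n)); last first.
  rewrite /Hpart /Spart.
  have -> : \sum_(0 <= n < m) (gterm b (x + a) n - gterm b x n - (- (2 * n%:R)) * a * gterm b x n) =
    \sum_(0 <= n < m) gterm b (x + a) n - \sum_(0 <= n < m) gterm b x n +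
    2 * a * \sum_(0 <= n < m) n%:R * gterm b x n.
    by rewrite mulr_sumr -sumrB -big_split/=; apply: eq_bigr => n _; ring.
  ring.
apply: le_trans (ler_normB _ _) _; rewrite [leRHS]mulrDl; apply: lerD.
  apply: le_trans (expR_riemann _ _ _) _; rewrite !ger0_norm//.
  rewrite [leLHS](_ : _ = 4 * expR (2 * a) * expR (2 * x) * a ^+ 2); last by ring.
  apply: ler_wpM2r; first exact: sqr_ge0.
  apply: ler_pM; rewrite ?mulr_ge0 ?expR_ge0//.
    by rewrite ler_wpM2l// ler_expR ler_wpM2l.
  by rewrite ler_expR ler_wpM2l.
apply: le_trans (ler_norm_sum _ _ _) _; rewrite mulr_suml; apply: ler_sum => n _.
rewrite (_ : gterm b (x + a) n - gterm b x n - (- (2 * n%:R)) * a * gterm b x n =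
  n%:R * normc (b n) ^+ 2 * (expR (- (2 * n%:R) * (x + a)) - expR (- (2 * n%:R) * x) -
   (- (2 * n%:R)) * a * expR (- (2 * n%:R) * x))); last first.
  by rewrite /gterm !mulNr; ring.
have c0 : 0 <= n%:R * normc (b n) ^+ 2 by rewrite mulr_ge0 ?exprn_ge0 ?normc_ge0.
rewrite normrM ger0_norm// -[leRHS]mulrA; apply: ler_wpM2l => //.
apply: le_trans (expR_riemann _ _ _) _; rewrite normrN !ger0_norm ?mulr_ge0//.
rewrite sqrrN [leLHS](_ : _ = 4 * n%:R ^+ 2 * expR (2 * n%:R * a) * expR (- (2 * n%:R) * x) * a ^+ 2); last by ring.
apply: ler_wpM2r; first exact: sqr_ge0.
rewrite -[leRHS]mulr1; apply: ler_pM; rewrite ?mulr_ge0 ?expR_ge0 ?sqr_ge0//.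
  apply: ler_wpM2l; first by rewrite mulr_ge0 ?sqr_ge0.
  by rewrite ler_expR ler_wpM2l ?mulr_ge0.
by rewrite -expR0 ler_expR mulNr oppr_le0 !mulr_ge0.
Qed.

(** A Riemann sum with left endpoints, matching the left corners at which the grid in
    [annulus_area_near] evaluates [expderiv]. *)
Lemma Hpart_riemann_sum (R : realType) (b : nat -> R[i]) (m : nat) (s A : R) : 0 <= s -> 0 <= A ->
  exists2 C : R, 0 <= C & forall N, (0 < N)%N ->
    `|(Hpart b m (s + A) - Hpart b m s) -
      \sum_(j < N) 2 * (A / N%:R) * Spart b m (s + j%:R * (A / N%:R))| <= C / N%:R.
Proof.
move=> s0 A0; have [C C0 hC] := Hpart_riemann b m (s + A) A s0.
exists (C * A ^+ 2) => [|N N0]; first by rewrite mulr_ge0 ?sqr_ge0.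
have NR : 0 < N%:R :> R by rewrite ltr0n.
have [a aE] : exists a : R, a = A / N%:R by eexists.
rewrite -aE.
have Na : N%:R * a = A by rewrite aE mulrC divfK// gt_eqF.
have a0 : 0 <= a by rewrite aE divr_ge0.
have aA : a <= A by rewrite -Na ler_peMl// ler1n.
have -> : Hpart b m (s + A) - Hpart b m s =
   \sum_(j < N) (Hpart b m (s + j%:R * a + a) - Hpart b m (s + j%:R * a)).
  rewrite (eq_bigr (fun j : 'I_N => Hpart b m (s + j.+1%:R * a) - Hpart b m (s + j%:R * a))).
    rewrite -(big_mkord xpredT (fun j => Hpart b m (s + j.+1%:R * a) - Hpart b m (s + j%:R * a))).
    by rewrite (telescope_sumr (fun j => Hpart b m (s + j%:R * a)))// mul0r addr0 Na.
  by move=> j _; rewrite -natr1 mulrDl mul1r addrA.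
rewrite -sumrB; apply: le_trans (ler_norm_sum _ _ _) _.
apply: (@le_trans _ _ (\sum_(j < N) C * a ^+ 2)).
  apply: ler_sum => j _; apply: hC; last by rewrite a0 aA.
  rewrite lerDl mulr_ge0//= lerD2l -Na ler_wpM2r// ler_nat; exact: ltnW.
rewrite sumr_const card_ord -mulr_natl aE le_eqVlt; apply/orP; left; apply/eqP; field.
by rewrite gt_eqF.
Qed.

Lemma cexp_polar (R : realType) (z : R[i]) : z != 0 ->
  exists w, [/\ cexp w = z, complex.Re w = ln (normc z) & 0 < complex.Im w <= pi *+ 2].
Proof.
move=> z0; have n0 : 0 < normc z by rewrite normc_gt0.
have pi0 := pi_gt0 R.
have [x [y [zE xy]]] : exists x y : R, z = ((normc z * x) +i* (normc z * y))%C /\ x ^+ 2 + y ^+ 2 = 1.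
  exists (complex.Re z / normc z), (complex.Im z / normc z); split.
    by rewrite ![normc z * _]mulrC !divfK ?gt_eqF//; case: (z).
  by rewrite !expr_div_n -mulrDl -normc_sqr divff// sqrf_eq0 gt_eqF.
have x1 : -1 <= x <= 1.
  by rewrite -ler_norml -(@ler_pXn2r _ 2)// ?nnegrE// real_normK ?num_real// expr1n -xy lerDl sqr_ge0.
have sx : Num.sqrt (1 - x ^+ 2) = `|y| by rewrite -xy addrAC subrr add0r sqrtr_sqr.
have [t [ct st t0]] : exists t : R, [/\ cos t = x, sin t = y & 0 < t <= pi *+ 2].
  have a0 := acos_ge0 x1; have api := acos_lepi x1.
  (* For y > 0 the angle is acos x. Otherwise it is 2 pi - acos x, which on the positive real axis
     yields 2 pi instead of 0, as the half-open range demands. *)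
  have [y0|y0] := ltP 0 y.
    exists (acos x); rewrite acosK ?in_itv// sin_acos// sx gtr0_norm//; split=> //.
    apply/andP; split; last by lra.
    rewrite acos_gt0//; case/andP: x1 => -> x1 /=.
    by rewrite lt_neqAle x1 andbT; apply/eqP => x1'; move: xy; rewrite x1'; nra.
  exists (pi *+ 2 - acos x); rewrite cosB sinB cos2pi sin2pi acosK ?in_itv// sin_acos// sx ler0_norm//.
  by split; [ring|ring|apply/andP; split; lra].
exists (ln (normc z) +i* t)%C; split => //.
by rewrite /cexp/= lnK ?posrE// ct st -zE.
Qed.

Lemma image_cexp_hbox (R : realType) (s s' : R) :
  [set z | expR s < normc z <= expR s'] = @cexp R @` hbox s s' 0 (pi *+ 2).
Proof.
apply/seteqP; split => [z /= /andP[h1 h2]|_ [w [/andP[h1 h2] _] <-]]; last first.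
  by rewrite /mkset normc_cexp ltr_expR ler_expR h1.
have n0 : 0 < normc z by apply: lt_trans h1; exact: expR_gt0.
have [w [wz wr wi]] := @cexp_polar R z (ltac:(by rewrite -normc_gt0)).
exists w => //; split=> //; rewrite wr.
by rewrite -ltr_expR lnK ?posrE// h1/= -ler_expR lnK ?posrE.
Qed.

Lemma normc_hbox_corner (R : realType) (s t a b : R) (w : R[i]) :
  hbox s (s + a) t (t + b) w -> normc ((s +i* t)%C - w) <= a + b.
Proof.
move=> [/andP[? ?] /andP[? ?]].
apply: le_trans (normc_le _) _; apply: lerD.
  by rewrite !ReImE ler_norml /=; apply/andP; split; lra.
by rewrite !ReImE ler_norml /=; apply/andP; split; lra.
Qed.

(** The half-open strip makes the exponential injective, and s >= 0 keeps its values where g is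
    injective. *)
Lemma set_inj_cexp (R : realType) (g : R[i] -> R[i]) (s s' : R) : 0 <= s ->
  set_inj [set z | 1 < normc z] g ->
  set_inj (hbox s s' 0 (pi *+ 2)) (g \o @cexp R).
Proof.
move=> s0 ig w w' /set_mem[/andP[h1 _] /andP[h3 h4]] /set_mem[/andP[k1 _] /andP[k3 k4]] e.
have out (v : R[i]) : s < complex.Re v -> cexp v \in [set z : R[i] | 1 < normc z].
  by move=> v0; rewrite inE /mkset normc_cexp -expR0 ltr_expR; apply: le_lt_trans v0.
apply: cexp_inj; first by rewrite ltr_norml; apply/andP; split; lra.
by apply: ig e; exact: out.
Qed.

(** The box of width A and height 2 pi is cut into N by N cells. The linearisation error is C8 d +
    e, where d = L / N is half the perimeter of a cell and e comes from the tail of order m. Letting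
    N tend to infinity leaves only e. *)
Lemma annulus_area_near (R : realType) (b : nat -> R[i]) (g : R[i] -> R[i]) (s A K q : R) (m : nat) :
  outer_series b g -> set_inj [set z | 1 < normc z] g -> 0 < s -> 0 < A ->
  0 <= K -> 0 < q < 1 ->
  (forall n, n%:R ^+ 2 * normc (b n) * expR (- (s / 2) *+ n) <= K * q ^+ n) ->
  let V := g @` [set z | expR s < normc z <= expR (s + A)] in
  let e := 3 * (K * (q ^+ m / (1 - q))) in
  e < 1 ->
  [/\ cmeas V, (carea V < +oo)%E &
   `|fine (carea V) - pi * (Hpart b m (s + A) - Hpart b m s)| <=
     e * ((A + pi *+ 2) ^+ 2 * (3 * (expR (s + A) + K / (1 - q)) + 4))].
Proof.
move=> gb ig s0 A0 K0 q01 bK V e e1.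
have pi2 : 0 < pi *+ 2 :> R by rewrite pmulrn_lgt0 ?pi_gt0.
have q1 : 0 < 1 - q by case/andP: q01 => _; rewrite subr_gt0.
have q0 : 0 <= q by case/andP: q01 => /ltW.
have e0 : 0 <= e.
  by apply: mulr_ge0 => //; apply: mulr_ge0 => //; apply: divr_ge0; [exact: exprn_ge0|exact: ltW].
pose L := A + pi *+ 2; have L0 : 0 < L by rewrite addr_gt0.
pose C8 := 8 * (expR (s + A + 1) + K / (1 - q)).
have C80 : 0 < C8 by rewrite mulr_gt0// ltr_pwDl ?expR_gt0// divr_ge0// ltW.
pose B := expR (s + A) + K / (1 - q).
have [C C0 hC] := Hpart_riemann_sum b m (ltW s0) (ltW A0).
(* Beyond [N0] four conditions hold: m < N for Parseval, d <= s / 2, d <= 1 and C8 d + e <= 1. *)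
pose N0 := (maxn m (Num.truncn (Num.max (L / (s / 2)) (Num.max L (C8 * L / (1 - e)))))).+1.
have main N : (N0 < N)%N -> [/\ cmeas V, (carea V < +oo)%E &
   `|fine (carea V) - pi * (Hpart b m (s + A) - Hpart b m s)| <=
     e * (L ^+ 2 * (3 * B + 4)) + (C8 * L * (L ^+ 2 * (3 * B + 4)) + pi * C) / N%:R].
  move=> N0N.
  have mN : (m < N)%N by apply: leq_ltn_trans N0N; apply: leqW; exact: leq_maxl.
  have NR : 0 < N%:R :> R by rewrite ltr0n; apply: leq_ltn_trans mN.
  have : Num.max (L / (s / 2)) (Num.max L (C8 * L / (1 - e))) <= N%:R.
    apply: ltW; apply: lt_le_trans (truncnS_gt _) _; rewrite ler_nat.
    by apply: leq_trans (ltnW N0N); rewrite ltnS leq_maxr.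
  rewrite !ge_max => /and3P[N1 N2 N3].
  have e1' : 0 < 1 - e by rewrite subr_gt0.
  have [d dE] : exists d : R, d = L / N%:R by eexists.
  have ds : d <= s / 2.
    by rewrite dE ler_pdivrMr// mulrC -ler_pdivrMr// divr_gt0.
  have d1 : d <= 1 by rewrite dE ler_pdivrMr// mul1r.
  have Cd1 : C8 * d + e <= 1.
    by rewrite -lerBrDr dE mulrA ler_pdivrMr// [_ * N%:R]mulrC -ler_pdivrMr.
  have d0 : 0 < d by rewrite dE divr_gt0.
  have Cd0 : 0 < C8 * d + e by rewrite ltr_pwDl// mulr_gt0.
  have [a aE] : exists a : R, a = A / N%:R by eexists.
  have [t tE] : exists t : R, t = pi *+ 2 / N%:R by eexists.
  have a0 : 0 < a by rewrite aE divr_gt0.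
  have t0 : 0 < t by rewrite tE divr_gt0.
  have atd : a + t = d by rewrite aE tE dE -mulrDl.
  have Na : N%:R * a = A by rewrite aE mulrC divfK// gt_eqF.
  have Nt : N%:R * t = pi *+ 2 by rewrite tE mulrC divfK// gt_eqF.
  pose D (j k : nat) := expderiv b m (((s + j%:R * a) +i* (k%:R * t))%C).
  have sj j : (j < N)%N -> s + j%:R * a + a <= s + A.
    by move=> jN; rewrite -addrA lerD2l -Na -[X in _ + X]mul1r -mulrDl natr1 ler_pM2r// ler_nat.
  have sj0 (j : nat) : s <= s + j%:R * a by rewrite lerDl mulr_ge0// ltW.
  have [|j k jN kN|j k jN kN z w Qz Qw|mV fV aV] := @carea_grid_near_linear R (g \o @cexp R) D s 0 a t
      (C8 * d + e) B N N a0 t0 Cd0 Cd1.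
  - by rewrite Na add0r Nt; exact: set_inj_cexp (ltW s0) ig.
  - apply: (expderiv_le K0 q01 bK) => //; rewrite sj0/=.
    by apply: le_trans (sj j jN); rewrite lerDl ltW.
  - rewrite (_ : _ - _ = g (cexp z) - g (cexp w) - D j k * (z - w)); last by rewrite /=; ring.
    have := @outer_series_near R b s (s + A) K q K0 q01 bK g m d z w (((s + j%:R * a) +i* (k%:R * t))%C)
      gb s0 ds d1.
    have zd : normc (z - w) <= d by rewrite -atd; exact: normc_hbox Qz Qw.
    have wd : normc (((s + j%:R * a) +i* (k%:R * t))%C - w) <= d.
      by rewrite -atd -[k%:R * t]add0r; exact: normc_hbox_corner Qw.
    move=> /(_ zd wd); case: Qw Qz => [/andP[w1 w2] _] [/andP[z1 z2] _].
    rewrite (le_trans (sj0 j) (ltW w1)) (le_trans w2 (sj j jN)) (le_trans (sj0 j) (ltW z1)).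
    move=> /(_ isT isT) /le_trans; apply; apply: ler_wpM2r; first exact: normc_ge0.
    by rewrite le_eqVlt; apply/orP; left; apply/eqP; rewrite /C8 /e; ring.
  move: mV fV aV; rewrite Na add0r Nt -image_comp -image_cexp_hbox -/V => mV fV aV.
  split=> //.
  (* For fixed j Parseval gives N [Spart], and N a t = 2 pi a: the grid sum is exactly pi times a
     Riemann sum of 2 [Spart]. *)
  have SE : (\sum_(j < N) \sum_(k < N) normc (D j k) ^+ 2) * (a * t) =
    pi * (\sum_(j < N) 2 * a * Spart b m (s + j%:R * a)).
    rewrite mulr_suml mulr_sumr; apply: eq_bigr => j _.
    rewrite /D tE expderiv_parseval// aE; field.
    by rewrite gt_eqF.
  have := hC N (leq_ltn_trans (leq0n _) mN); rewrite -aE => hCN.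
  have pi0 := pi_ge0 R.
  have := ler_wpM2l pi0 hCN; rewrite -[X in X * `|_|](ger0_norm pi0) -normrM mulrBr -SE => h2.
  rewrite (_ : fine (carea V) - pi * (Hpart b m (s + A) - Hpart b m s) =
    (fine (carea V) - (\sum_(j < N) \sum_(k < N) normc (D j k) ^+ 2) * (a * t)) -
    (pi * (Hpart b m (s + A) - Hpart b m s) - (\sum_(j < N) \sum_(k < N) normc (D j k) ^+ 2) * (a * t)));
    last by ring.
  apply: le_trans (ler_normB _ _) _; apply: le_trans (lerD aV h2) _.
  rewrite atd dE le_eqVlt; apply/orP; left; apply/eqP; field.
  by rewrite gt_eqF.
have [mV fV _] := main N0.+1 (ltnSn _); split=> //.
by apply: (@le_of_le_addn _ _ _ _ N0) => N /main[_ _]; exact.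
Qed.

Lemma gterm_ge0 (R : realType) (b : nat -> R[i]) (x : R) n : 0 <= gterm b x n.
Proof. by rewrite /gterm !mulr_ge0 ?exprn_ge0 ?normc_ge0 ?expR_ge0. Qed.

Lemma partial_sum_ndecr (R : realType) (u : nat -> R) : (forall n, 0 <= u n) ->
  {homo (fun m => \sum_(0 <= n < m) u n) : m m' / (m <= m')%N >-> m <= m'}.
Proof.
move=> u0 m m' mm'; rewrite (big_cat_nat (leq0n m) mm')/= lerDl.
by apply: sumr_ge0.
Qed.

(** Each term is at most the square of n^2 |b n| e^(-xn), hence at most K^2 q^(2n). *)
Lemma gterm_cvg (R : realType) (b : nat -> R[i]) (x : R) : 0 < x ->
  (forall r : R, 1 < r -> exists2 C : R, 0 <= C & forall n, normc (b n) <= C * r ^+ n) ->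
  cvgn (fun m => \sum_(0 <= n < m) gterm b x n).
Proof.
move=> x0 hb; have [K [q [K0 q01 hK]]] := coef_weight x0 hb.
have q0 : 0 <= q by case/andP: q01 => /ltW.
have q1 : q <= 1 by case/andP: q01 => _ /ltW.
apply: nondecreasing_is_cvgn; first exact: partial_sum_ndecr (gterm_ge0 b x).
exists (K ^+ 2 * (1 / (1 - q))) => _ [m _ <-].
have le n : gterm b x n <= K ^+ 2 * q ^+ n.
  rewrite /gterm.
  have h0 : 0 <= n%:R ^+ 2 * normc (b n) * expR (- x *+ n).
    by rewrite !mulr_ge0 ?exprn_ge0 ?normc_ge0 ?expR_ge0.
  have := hK n; rewrite -(ler_pXn2r (_ : 0 < 2)%N)// ?nnegrE ?mulr_ge0 ?exprn_ge0//.
  rewrite !exprMn => h.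
  apply: le_trans (le_trans h _); last first.
    rewrite ler_wpM2l ?sqr_ge0// -exprM mulnC exprM; apply: lerXn2r; rewrite ?nnegrE ?exprn_ge0//.
    by rewrite expr2 ler_piMl.
  rewrite (_ : expR (- x *+ n) ^+ 2 = expR (- (2 * n%:R * x))); last first.
    by rewrite expr2 -expRD; congr expR; rewrite mulNrn -mulr_natl; ring.
  apply: ler_wpM2r; first exact: expR_ge0.
  apply: ler_wpM2r; first exact: sqr_ge0.
  rewrite -exprD -natrX ler_nat; case: (n) => // k.
  exact: (@leq_pexp2l k.+1 1 4).
apply: le_trans (ler_sum _ (fun n _ => le n)) _.
rewrite -mulr_sumr; apply: ler_wpM2l; first exact: sqr_ge0.
by rewrite -(expr0 q); exact: geometric_sum_le.
Qed.

Definition Gsum (R : realType) (b : nat -> R[i]) (x : R) : R :=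
  limn (fun m => \sum_(0 <= n < m) gterm b x n).

Lemma Hpart_cvg (R : realType) (b : nat -> R[i]) (x : R) : 0 < x ->
  (forall r : R, 1 < r -> exists2 C : R, 0 <= C & forall n, normc (b n) <= C * r ^+ n) ->
  (fun m => Hpart b m x) @ \oo --> expR (2 * x) - Gsum b x.
Proof.
move=> x0 hb; apply: cvgB; first exact: cvg_cst.
exact: gterm_cvg.
Qed.

Lemma cvg_dist_le (R : realType) (u v : nat -> R) (l : R) (x : R) (m0 : nat) :
  u @ \oo --> l -> v @ \oo --> (0 : R) -> (forall m, (m0 <= m)%N -> `|x - u m| <= v m) -> x = l.
Proof.
move=> ul v0 h; apply/esym; apply: (@cvg_unique _ _ (u @ \oo)) => //.
apply/cvgrPdist_le => e e0.
have /cvgrPdist_le/(_ e e0) [M _ hM] := v0.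
exists (maxn m0 M) => // m /=; rewrite geq_max => /andP[m0m Mm].
apply: le_trans (h m m0m) _; apply: le_trans (ler_norm _) _.
by have := hM m Mm; rewrite /= sub0r normrN.
Qed.

(** The area does not depend on m, while the error left by [annulus_area_near] tends to 0 like
    q^m. *)
Lemma annulus_area (R : realType) (b : nat -> R[i]) (g : R[i] -> R[i]) (s s' : R) :
  outer_series b g -> set_inj [set z | 1 < normc z] g -> 0 < s -> s < s' ->
  let V := g @` [set z | expR s < normc z <= expR s'] in
  cmeas V /\
  carea V = (pi * ((expR (2 * s') - Gsum b s') - (expR (2 * s) - Gsum b s)))%:E.
Proof.
move=> gb ig s0 ss' V.
have hb := outer_series_coef gb.
have s20 : 0 < s / 2 by rewrite divr_gt0.
have [K [q [K0 q01 hK]]] := coef_weight s20 hb.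
have [q0 q1] := andP q01.
have A0 : 0 < s' - s by rewrite subr_gt0.
have near m := @annulus_area_near R b g s (s' - s) K q m gb ig s0 A0 K0 q01 hK.
move: near; rewrite addrC subrK -/V /= => near.
have e0 : (fun m => 3 * (K * (q ^+ m / (1 - q)))) @ \oo --> (0 : R).
  rewrite (_ : 0 = 3 * (K * (0 / (1 - q)))); last by rewrite mul0r !mulr0.
  apply: cvgMr; apply: cvgMr; apply: cvgMl; apply: cvg_expr.
  by rewrite ger0_norm// ltW.
have [m0 _ hm0] : \forall m \near \oo, 3 * (K * (q ^+ m / (1 - q))) < 1.
  have /cvgrPdist_lt/(_ 1 ltr01) := e0.
  apply: filterS => m; rewrite /= sub0r normrN; apply: le_lt_trans; exact: ler_norm.
have [mV fV _] := near m0 (hm0 m0 (leqnn _)).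
split=> //.
rewrite -[LHS]fineK ?ge0_fin_numE ?carea_fin_ge0//; congr EFin.
apply: (@cvg_dist_le _ (fun m => pi * (Hpart b m s' - Hpart b m s))
  (fun m => 3 * (K * (q ^+ m / (1 - q))) * ((s' - s + pi *+ 2) ^+ 2 * (3 * (expR s' + K / (1 - q)) + 4)))
  _ _ m0).
- by apply: cvgMr; apply: cvgB; apply: Hpart_cvg => //; exact: lt_trans ss'.
- rewrite -[X in _ --> X](mul0r ((s' - s + pi *+ 2) ^+ 2 * (3 * (expR s' + K / (1 - q)) + 4))).
  exact: cvgMl.
- by move=> m /hm0 hm; have [_ _] := near m hm.
Qed.

(** * Area of discs *)

Definition cdisc (R : realType) (r : R) : set R[i] := [set z | normc z <= r].

Lemma cmeas_cdisc (R : realType) (r : R) : cmeas (cdisc r).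
Proof.
have [r0|r0] := ltP r 0.
  rewrite (_ : cdisc r = set0); first exact: cmeas0.
  by apply/seteqP; split=> // z /(le_trans (normc_ge0 z)); rewrite leNgt r0.
have mf : measurable_fun setT (fun p : measurableTypeR R * measurableTypeR R => p.1 ^+ 2 + p.2 ^+ 2).
  by apply: measurable_funD; apply: measurable_funX; [exact: measurable_fst|exact: measurable_snd].
rewrite /cmeas (_ : _ @^-1` _ = (fun p : measurableTypeR R * measurableTypeR R => p.1 ^+ 2 + p.2 ^+ 2) @^-1` `]-oo, r ^+ 2]%classic).
  by rewrite -[X in measurable X]setTI; exact: mf.
apply/seteqP; split=> -[x y]; rewrite /cdisc /= in_itv/= => h.
  by rewrite -[X in X <= _]sqr_sqrtr ?addr_ge0 ?sqr_ge0// ler_pXn2r// nnegrE// sqrtr_ge0.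
by rewrite -(ger0_norm r0) -sqrtr_sqr ler_wsqrtr.
Qed.

(* The area of a disc is obtained from annulus_area applied to the identity. *)
Lemma carea_cdisc_scale (R : realType) (r t : R) : 0 < t ->
  carea (cdisc (t * r)) = ((t ^+ 2)%:E * carea (cdisc r))%E.
Proof.
move=> t0; have t1 : (t^-1)%:C%C != 0 :> R[i].
  by rewrite -normc_eq0 normcR normr_eq0 invr_eq0 gt_eqF.
have [_] := carea_affine 0 t1 (cmeas_cdisc r).
have ti : 0 <= t^-1 by rewrite invr_ge0 ltW.
rewrite normcR ger0_norm// exprVn invrK => <-.
congr carea; apply/seteqP; split => z; rewrite /cdisc/mkset addr0 normcM normcR.
  by rewrite ger0_norm// ler_pdivrMl.
by rewrite ger0_norm// ler_pdivrMl.
Qed.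

Lemma outer_series_id (R : realType) : outer_series (fun=> 0 : R[i]) id.
Proof.
move=> z _; rewrite /clim (_ : (fun N => _) = cst 0); first exact: cvg_cst.
by apply/funext => N; rewrite big1 ?addr0 ?subrr ?normc0// => n _; rewrite mulr0.
Qed.

Lemma carea_cdisc (R : realType) (r : R) : 0 < r -> carea (cdisc r) = (pi * r ^+ 2)%:E.
Proof.
move=> r0.
suff d1 : carea (cdisc 1) = (pi : R)%:E.
  by rewrite -[r]mulr1 carea_cdisc_scale// d1 -EFinM mulr1 mulrC.
have fin1 : carea (cdisc 1) = (fine (carea (@cdisc R 1)))%:E.
  rewrite fineK// ge0_fin_numE ?carea_fin_ge0//.
  apply: (@le_lt_trans _ _ (carea (@cbox R (-1) 1 (-1) 1))).
    apply: le_carea; [exact: cmeas_cdisc|exact: cmeas_cbox|].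
    move=> z z1; split; rewrite -ler_norml; apply: le_trans z1;
      [exact: le_normc_Re|exact: le_normc_Im].
  by rewrite carea_cbox ?ltry//; lra.
have ig : set_inj [set z : R[i] | 1 < normc z] id by move=> x y _ _.
have G0 (x : R) : Gsum (fun=> 0 : R[i]) x = 0.
  rewrite /Gsum (_ : (fun m => _) = cst 0); first exact: lim_cst.
  by apply/funext => m; rewrite big1// => n _; rewrite /gterm normc0 expr0n mulr0 mul0r.
(* With m the area of the unit disc, finite by [fin1], and u = e^2, scaling the discs of radii e and
   e^2 gives u^2 m = u m + pi (u^2 - u). *)
have [mV] := annulus_area (@outer_series_id R) ig ltr01 (ltr1n R 2).
rewrite !G0 !subr0 mulr1; rewrite image_id in mV *; move=> aV.
have cut : cdisc (expR 2) = cdisc (expR 1) `|` [set z : R[i] | expR 1 < normc z <= expR 2].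
  apply/seteqP; split=> z; rewrite /cdisc/mkset.
    by move=> z2; have [h|h] := leP (normc z) (expR 1); [left|right; rewrite h].
  by case=> [h|/andP[]//]; apply: le_trans h _; rewrite ler_expR ler1n.
have [|_] := careaU (cmeas_cdisc (expR 1)) mV _.
  by move=> z; rewrite /cdisc/mkset => /le_lt_trans h /andP[/h]; rewrite ltxx.
rewrite -cut aV -[in LHS](mulr1 (expR 2)) -[in RHS](mulr1 (expR 1)) !carea_cdisc_scale ?expR_gt0// fin1 -!EFinM -EFinD => -[] h.
congr EFin; have : expR 1 ^+ 2 < expR 2 ^+ 2 :> R.
  by rewrite ltr_pXn2r ?nnegrE ?expR_ge0// ltr_expR ltr1n.
move: h; rewrite (_ : expR (2 * 2) = expR 2 ^+ 2); last by rewrite expr2 -expRD mulr2n mulrDl mul1r.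
rewrite (_ : expR (2 : R) = expR 1 ^+ 2); last by rewrite expr2 -expRD mulr2n.
move: (fine _) (expR 1 ^+ 2) => m u h u2.
have /mulfI : u ^+ 2 - u != 0 by rewrite subr_eq0 gt_eqF.
by apply; lra.
Qed.

(** * The omitted set near infinity *)

(* The holomorphic part of g in the coordinate u = 1/z: sum of b n * u^n. *)
Definition innerfun (R : realType) (b : nat -> R[i]) (g : R[i] -> R[i]) (u : R[i]) : R[i] :=
  if u == 0 then b 0%N else g u^-1 - u^-1.

Lemma innerfun_clim (R : realType) (b : nat -> R[i]) (g : R[i] -> R[i]) (u : R[i]) :
  outer_series b g -> normc u < 1 ->
  clim (fun N => \sum_(0 <= n < N) u ^+ n * b n) (innerfun b g u).
Proof.
move=> gb u1; rewrite /innerfun; have [->|u0] := eqVneq u 0.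
  rewrite /clim; apply: cvg_near_cst; exists 1%N => // -[//|N] _ /=.
  rewrite big_nat_recl// expr0 mul1r big1 ?addr0 ?subrr ?normc0// => n _.
  by rewrite exprS !mul0r.
have n0 : 0 < normc u by rewrite normc_gt0.
have := gb u^-1; rewrite normcV invf_gt1// => /(_ u1).
move=> h; rewrite /clim (_ : (fun N => _) =
  (fun N => normc (u^-1 + \sum_(0 <= n < N) u^-1 ^- n * b n - g u^-1)))//.
apply/funext => N; congr normc; rewrite opprB addrA [_ + u^-1]addrC; congr (_ + _ - _).
by apply: eq_bigr => n _; rewrite exprVn invrK.
Qed.

Lemma normc_subrX (R : realType) (u v : R[i]) (p : R) n : normc u <= p -> normc v <= p ->
  normc (u ^+ n.+1 - v ^+ n.+1) <= n.+1%:R * p ^+ n * normc (u - v).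
Proof.
move=> up vp; have p0 : 0 <= p by apply: le_trans up; exact: normc_ge0.
rewrite subrXX normcM mulrC; apply: ler_wpM2r; first exact: normc_ge0.
apply: le_trans (normc_sum _ _ _) _.
rewrite -[n.+1 in leRHS]card_ord mulr_natl -sumr_const; apply: ler_sum => i _.
rewrite normcM !normcX /= -[in leRHS](subnK (ltn_ord i : (i <= n)%N)).
by rewrite exprD; apply: ler_pM; rewrite ?exprn_ge0 ?normc_ge0//; apply: lerXn2r; rewrite ?nnegrE ?normc_ge0.
Qed.

Lemma innerfun_near (R : realType) (b : nat -> R[i]) (g : R[i] -> R[i]) (C r : R) (u v : R[i]) :
  outer_series b g -> 0 <= C -> (forall n, normc (b n) <= C * 2 ^+ n) -> 8 <= r ->
  normc u <= r^-1 -> normc v <= r^-1 ->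
  normc (innerfun b g u - innerfun b g v - b 1%N * (u - v)) <= 32 * C / r * normc (u - v).
Proof.
move=> gb C0 bC r8 ur vr.
have r0 : 0 < r by apply: lt_le_trans r8.
have p0 : 0 <= r^-1 by rewrite invr_ge0 ltW.
have p8 : r^-1 <= 8^-1 by rewrite lef_pV2 ?posrE.
have u1 : normc u < 1 by lra.
have v1 : normc v < 1 by lra.
have := climB (innerfun_clim gb u1) (innerfun_clim gb v1).
move=> /(@clim_le _ _ _ (b 1%N * (u - v)) _ 2); apply => N N2.
rewrite -sumrB (big_cat_nat (leq0n 2) N2)/= big_nat_recl// big_nat1 !expr0 subrr add0r !expr1.
rewrite (_ : _ - _ = \sum_(2 <= i < N) (u ^+ i * b i - v ^+ i * b i)); last by ring.
apply: le_trans (normc_sum _ _ _) _.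
(* At exponent k + 2 the factors k + 2 <= 4 2^k, r^-k <= 8^-k and 2^k from the bound on b multiply
   to at most 4 2^-k; this is where r >= 8 is used. The final 32 is 64 times the sum of 2^-i over i
   >= 2. *)
apply: (@le_trans _ _ (\sum_(2 <= i < N) 64 * C / r * normc (u - v) * (2^-1) ^+ i)).
  rewrite !big_nat; apply: ler_sum => -[//|[//|k]] _.
  rewrite -mulrBl normcM.
  have h := ler_pM (normc_ge0 _) (normc_ge0 _) (normc_subrX k.+1 ur vr) (bC k.+2).
  apply: le_trans h _.
  have k2 : k.+2%:R <= 4 * 2 ^+ k :> R.
    by rewrite -natrX -natrM ler_nat -(expnD 2 2 k) ltnW// ltn_expl.
  have h8 : r^-1 ^+ k <= 8^-1 ^+ k by apply: lerXn2r => //; rewrite nnegrE// invr_ge0.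
  rewrite [leLHS](_ : _ = C / r * normc (u - v) * 4 * (k.+2%:R * (r^-1 ^+ k * 2 ^+ k))); last first.
    by rewrite !exprS; ring.
  rewrite [leRHS](_ : _ = C / r * normc (u - v) * 4 * (4 * 2 ^+ k * (8^-1 ^+ k * 2 ^+ k))); last first.
    rewrite -[4 * 2 ^+ k * _]mulrA (_ : 2 ^+ k * (8^-1 ^+ k * 2 ^+ k) = 2^-1 ^+ k); last first.
      by rewrite -!exprMn; congr (_ ^+ _); field.
    by rewrite !exprS; field; rewrite gt_eqF.
  apply: ler_wpM2l.
    by rewrite !mulr_ge0 ?normc_ge0.
  apply: ler_pM => //; first by rewrite mulr_ge0 ?exprn_ge0.
  by apply: ler_wpM2r => //; rewrite exprn_ge0.
rewrite -mulr_sumr.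
have h2 : 0 < (2^-1 : R) < 1 by rewrite invr_gt0 ltr0n invf_lt1 ?ltr1n.
have c0 : 0 <= 64 * C / r * normc (u - v) by rewrite !mulr_ge0 ?normc_ge0.
apply: le_trans (ler_wpM2l c0 (geometric_sum_le 2 N h2)) _.
rewrite le_eqVlt; apply/orP; left; apply/eqP; field.
by rewrite gt_eqF.
Qed.

(* 1/z outside the disc of radius r, continued inside by conj z / r^2, with which it
   agrees on the circle. Thus z + innerfun b g (circinv r z) extends g from |z| > r to
   a homeomorphism of the whole plane, for r large. *)
Definition circinv (R : realType) (r : R) (z : R[i]) : R[i] :=
  if normc z <= r then (r ^- 2)%:C%C * (z^*)%C else z^-1.

Lemma circinv_le (R : realType) (r : R) (z : R[i]) : 0 < r -> normc (circinv r z) <= r^-1.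
Proof.
move=> r0; rewrite /circinv; have [zr|zr] := leP (normc z) r.
  rewrite normcM normcR normc_conj -exprVn ger0_norm ?sqr_ge0// expr2 -mulrA.
  by rewrite ler_piMr ?invr_ge0 ?(ltW r0)// mulrC ler_pdivrMr// mul1r.
have z0 : 0 < normc z by apply: lt_trans zr.
by rewrite normcV lef_pV2 ?posrE//; exact: ltW.
Qed.

(** With p = r^2 and t = |w|^2, the squares of the two sides differ by (t - p) / (p^2 t) times t + p
    - 2 Re (z conj w); the last factor is at least |z - w|^2 because p >= |z|^2. *)
Lemma circinv_mixed (R : realType) (r : R) (z w : R[i]) : 0 < r -> normc z <= r -> r < normc w ->
  normc ((r ^- 2)%:C%C * (z^*)%C - w^-1) <= r ^- 2 * normc (z - w).
Proof.
move=> r0 zr rw.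
have w0 : 0 < normc w by apply: lt_trans rw.
have r2 : 0 <= r ^- 2 by rewrite -exprVn sqr_ge0.
rewrite -(@ler_pXn2r _ 2)// ?nnegrE ?mulr_ge0 ?normc_ge0//.
have zr2 : normc z ^+ 2 <= r ^+ 2 by rewrite ler_pXn2r// nnegrE ?normc_ge0// ltW.
have rw2 : r ^+ 2 < normc w ^+ 2 by rewrite ltr_pXn2r// nnegrE ?normc_ge0// ltW.
have wE : w^-1 = ((normc w ^- 2)%:C)%C * (w^*)%C.
  have w1 : w != 0 by rewrite -normc_gt0.
  apply: (mulfI w1); rewrite mulfV// mulrCA -sqr_normcE -rmorphM mulVf// sqrf_eq0 gt_eqF//.
rewrite wE exprMn.
have [p pE] : exists p : R, p = r ^+ 2 by eexists.
have [t tE] : exists t : R, t = normc w ^+ 2 by eexists.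
rewrite -pE -tE {wE}; rewrite -pE in zr2 rw2; rewrite -tE in rw2.
have p0 : 0 < p by rewrite pE exprn_gt0.
have t0 : 0 < t by apply: lt_trans rw2.
move: tE zr2; rewrite !normc_sqr; case: (z) => x y; case: (w) => u v /= tE zr2.
rewrite !mul0r !subr0 !addr0.
rewrite -subr_ge0.
rewrite (_ : _ - _ = (t - p) / (p ^+ 2 * t) * (t + p - 2 * (x * u + y * v))).
  apply: mulr_ge0.
    by rewrite divr_ge0 ?subr_ge0 ?mulr_ge0 ?exprn_ge0// ltW.
  have := sqr_ge0 (x - u); have := sqr_ge0 (y - v); nra.
rewrite tE; field.
by rewrite -tE !gt_eqF.
Qed.

(** The constant r^-2 is valid on the whole plane, across the circle too; this is what makes the
    extension of g a contractive perturbation of the identity. *)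
Lemma circinv_lip (R : realType) (r : R) (z w : R[i]) : 0 < r ->
  normc (circinv r z - circinv r w) <= r ^- 2 * normc (z - w).
Proof.
move=> r0; rewrite /circinv; have [zr|zr] := leP (normc z) r; have [wr|wr] := leP (normc w) r.
- by rewrite -mulrBr -rmorphB normcM normcR normc_conj -exprVn ger0_norm ?sqr_ge0.
- exact: circinv_mixed.
- by rewrite normcB [normc (z - w)]normcB; exact: circinv_mixed.
have z0 : 0 < normc z by apply: lt_trans zr.
have w0 : 0 < normc w by apply: lt_trans wr.
rewrite (_ : z^-1 - w^-1 = z^-1 * w^-1 * (w - z)); last first.
  by field; rewrite -!normc_eq0 !gt_eqF.
rewrite !normcM !normcV normcB; apply: ler_wpM2r; first exact: normc_ge0.
rewrite -exprVn expr2; apply: ler_pM; rewrite ?invr_ge0 ?normc_ge0//.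
  by rewrite lef_pV2 ?posrE// ltW.
by rewrite lef_pV2 ?posrE// ltW.
Qed.

Definition omitted (R : realType) (g : R[i] -> R[i]) (r : R) : set R[i] :=
  ~` (g @` [set z | r < normc z]).

Lemma outer_bigcup (R : realType) (s : R) :
  [set z : R[i] | expR s < normc z] =
  \bigcup_n [set z | expR s < normc z <= expR (s + n.+1%:R)].
Proof.
apply/seteqP; split=> [z /= sz|z [n _] /andP[]//].
have n0 : 0 < normc z by apply: lt_trans sz; exact: expR_gt0.
exists (Num.truncn (ln (normc z) - s)) => //; rewrite /mkset sz/=.
rewrite -[X in X <= _]lnK ?posrE// ler_expR -lerBlDl ltW//.
exact: truncnS_gt.
Qed.

(** The exterior of the disc is a countable union of annuli, whose images are measurable by
    [annulus_area]. *)
Lemma cmeas_omitted (R : realType) (b : nat -> R[i]) (g : R[i] -> R[i]) (r : R) :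
  outer_series b g -> set_inj [set z | 1 < normc z] g -> 1 < r -> cmeas (omitted g r).
Proof.
move=> gb ig r1; have r0 : 0 < r by apply: lt_trans r1.
suff h : cmeas (g @` [set z | r < normc z]).
  by rewrite /cmeas /omitted preimage_setC; exact: measurableC.
rewrite -[r]lnK ?posrE// outer_bigcup image_bigcup; apply: cmeas_bigcup => n.
have s0 : 0 < ln r by rewrite ln_gt0.
have ss : ln r < ln r + n.+1%:R by rewrite ltrDl.
by have [] := annulus_area gb ig s0 ss.
Qed.

(* T is the real-affine map that the extension of g is close to on |z| <= r; hence the
   omitted set lies between the T-images of discs of radius r - d and r + d. *)
Section large_radius.
Variables (R : realType) (b : nat -> R[i]) (g : R[i] -> R[i]) (C r : R).
Hypotheses (gb : outer_series b g) (ig : set_inj [set z | 1 < normc z] g).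
Hypotheses (C0 : 0 <= C) (bC : forall n, normc (b n) <= C * 2 ^+ n).
Hypotheses (r8 : 8 <= r) (rb : normc (b 1%N) <= r) (rC : 32 * C <= r).

Let k (z : R[i]) : R[i] := innerfun b g (circinv r z).
Let T (z : R[i]) : R[i] := z + (r ^- 2)%:C%C * b 1%N * z^*%C + b 0%N.

Let r0 : 0 < r. Proof. by apply: lt_le_trans r8. Qed.

Let kout z : r < normc z -> z + k z = g z.
Proof.
move=> zr; have z0 : z != 0 by rewrite -normc_gt0; exact: lt_trans zr.
rewrite /k /circinv leNgt zr/= /innerfun invr_eq0 (negbTE z0) invrK.
by rewrite addrC subrK.
Qed.

Let Tin z : normc z <= r -> T z = z + b 1%N * circinv r z + b 0%N.
Proof. by move=> zr; rewrite /T /circinv zr; ring. Qed.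

Let k_near z w : normc (k z - k w - b 1%N * (circinv r z - circinv r w)) <=
  32 * C / r * normc (circinv r z - circinv r w).
Proof.
by apply: innerfun_near => //; exact: circinv_le.
Qed.

(** [innerfun_near] with second point 0, where [innerfun] equals b 0. *)
Let k0 z : normc (k z - b 0%N - b 1%N * circinv r z) <= 32 * C / r ^+ 2.
Proof.
have := @innerfun_near R b g C r (circinv r z) 0 gb C0 bC r8 (circinv_le z r0).
rewrite normc0 invr_ge0 (ltW r0) {2}/innerfun eqxx !subr0 -/(k z) => /(_ isT) /le_trans; apply.
rewrite [leRHS](_ : _ = 32 * C / r * r^-1); last by field; rewrite gt_eqF.
apply: ler_wpM2l; last exact: circinv_le.
by rewrite !mulr_ge0 ?invr_ge0 ?(ltW r0).
Qed.

Let b1r : normc (b 1%N) * r ^- 2 <= 8^-1.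
Proof.
apply: (@le_trans _ _ (r * r ^- 2)).
  by rewrite ler_wpM2r// -exprVn sqr_ge0.
by rewrite expr2 invfM mulrA divff ?gt_eqF// mul1r lef_pV2 ?posrE.
Qed.

(** Both 32 C / r^3 and |b 1| / r^2 are at most 1/8. *)
Let k_lip z w : normc (k z - k w) <= 2^-1 * normc (z - w).
Proof.
have -> : k z - k w = (k z - k w - b 1%N * (circinv r z - circinv r w)) +
  b 1%N * (circinv r z - circinv r w) by rewrite subrK.
apply: le_trans (le_normcD _ _) _.
apply: le_trans (lerD (k_near z w) (lexx _)) _.
rewrite normcM -mulrDl.
have cl := circinv_lip z w r0.
have c0 : 0 <= 32 * C / r + normc (b 1%N).
  by rewrite addr_ge0 ?normc_ge0// !mulr_ge0// invr_ge0 ltW.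
apply: le_trans (ler_wpM2l c0 cl) _; rewrite mulrA; apply: ler_wpM2r; first exact: normc_ge0.
rewrite mulrDl.
have h1 : 32 * C / r * r ^- 2 <= 8^-1.
  apply: (@le_trans _ _ (1 * r ^- 2)).
    by apply: ler_wpM2r; [rewrite -exprVn sqr_ge0|rewrite ler_pdivrMr// mul1r].
  rewrite mul1r lef_pV2 ?posrE ?exprn_gt0//.
  by rewrite expr2; have := ler_pM (ltW (ltr0n R 8)) (ltW (ltr0n R 8)) r8 r8; lra.
by move: b1r h1; lra.
Qed.

(** Since |b 1| / r^2 <= 1/8, the perturbed vector keeps at least 7/8 of |v|, in particular half of
    it. *)
Let T_expand (v u : R[i]) (e : R) : normc u <= r ^- 2 * normc v ->
  normc (v + b 1%N * u) <= e -> normc v <= 2 * e.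
Proof.
move=> uv h.
have := le_normcD (v + b 1%N * u) (- (b 1%N * u)).
rewrite addrK normcN normcM => h2.
have h3 : normc (b 1%N) * normc u <= 8^-1 * normc v.
  apply: le_trans (ler_wpM2l (normc_ge0 _) uv) _.
  by rewrite mulrA; apply: ler_wpM2r; first exact: normc_ge0.
have n0 := normc_ge0 v.
lra.
Qed.

(** Twice the bound in [k0], the factor 2 coming from [T_expand]. *)
Let d : R := 64 * C / r ^+ 2.

Let T_conj z w : T z - T w = z - w + b 1%N * ((r ^- 2)%:C%C * (z - w)^*%C).
Proof. by rewrite /T rmorphB; ring. Qed.

(** Every T w is z + k z for some z. If |z| > r this is g z, which is not omitted; so |z| <= r,
    where z + k z is within 32 C / r^2 of T z. *)
Lemma omitted_sub_disc (w : R[i]) : omitted g r (T w) -> normc w <= r + d.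
Proof.
move=> oTw.
have [B [B0 kB]] : exists B : R, 0 <= B /\ forall z, normc (k z) <= B.
  exists (32 * C / r ^+ 2 + normc (b 0%N) + normc (b 1%N) * r^-1); split.
    by rewrite !addr_ge0 ?normc_ge0// !mulr_ge0 ?normc_ge0 ?invr_ge0 ?exprn_ge0 ?(ltW r0).
  move=> z; have -> : k z = (k z - b 0%N - b 1%N * circinv r z) + b 0%N + b 1%N * circinv r z by ring.
  apply: le_trans (le_normcD _ _) _; apply: lerD.
    by apply: le_trans (le_normcD _ _) _; rewrite lerD2r.
  by rewrite normcM; apply: ler_wpM2l; [exact: normc_ge0|exact: circinv_le].
(* The half-width B bounds k, so that T w - k z remains in the box. *)
pose S := cbox (complex.Re (T w) - B) (complex.Re (T w) + B) (complex.Im (T w) - B) (complex.Im (T w) + B).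
have [|||z0 Sz|z Sz zE] := @perturbation_onto R S k 2^-1 (T w) (@compact_cbox R _ _ _ _).
- exists (T w); rewrite /S /cbox /mkset.
  by split; rewrite lerBlDr lerDl B0.
- by rewrite invf_lt1 ?ltr1n.
- by move=> z z' _ _; exact: k_lip.
- have h := kB z0.
  have := le_trans (le_normc_Re _) h; have := le_trans (le_normc_Im _) h.
  rewrite !ler_norml => /andP[k1 k2] /andP[k3 k4].
  by split; rewrite !ReImE; apply/andP; split; lra.
have [zr|zr] := leP (normc z) r; last first.
  by exfalso; apply: oTw; exists z; rewrite // -kout.
have wz : normc (w - z) <= 2 * (32 * C / r ^+ 2).
  have := k0 z; rewrite (_ : k z - b 0%N - b 1%N * circinv r z = T w - T z); last first.
    by rewrite (Tin zr) -zE; ring.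
  rewrite T_conj; apply: T_expand.
  by rewrite normcM normcR normc_conj -exprVn ger0_norm ?sqr_ge0.
have := le_normcD (w - z) z; rewrite subrK => /le_trans; apply.
rewrite addrC; apply: lerD => //; apply: le_trans wz _.
by rewrite /d !mulrA -natrM.
Qed.

(** If T w = g z with |z| > r, then [T_expand] gives |w - z| <= d and so |z| <= r. *)
Lemma disc_sub_omitted (w : R[i]) : normc w <= r - d -> omitted g r (T w).
Proof.
move=> wr [z zr gz].
have d0 : 0 <= d by rewrite /d !mulr_ge0 ?invr_ge0 ?exprn_ge0 ?(ltW r0).
have wr' : normc w <= r by apply: le_trans wr _; rewrite gerBl.
have := k0 z.
have -> : k z - b 0%N - b 1%N * circinv r z = w - z + b 1%N * (circinv r w - circinv r z).
  have : k z = T w - z by rewrite -gz -(kout zr) addrC addKr.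
  by move=> ->; rewrite Tin//; ring.
move=> /(T_expand (circinv_lip w z r0)) h.
have : r < r.
  apply: lt_le_trans zr _.
  have := le_normcD (z - w) w; rewrite subrK normcB => /le_trans; apply.
  have -> : r = d + (r - d) by rewrite addrC subrK.
  apply: lerD => //; apply: le_trans h _.
  by rewrite /d !mulrA -natrM.
by rewrite ltxx.
Qed.

(** The preimage [Y] of the omitted set under T lies between two discs, and T multiplies areas by 1
    - |b 1|^2 / r^4. In the constant, 128 C comes from 2 r d, the next term from d^2 and the last
    one from this determinant. *)
Lemma carea_omitted_large :
  (carea (omitted g r) < +oo)%E /\
  `|fine (carea (omitted g r)) - pi * r ^+ 2| <=
    pi * (128 * C + (64 * C) ^+ 2 + normc (b 1%N) ^+ 2) / r.
Proof.
have r1 : 1 < r by apply: lt_le_trans r8; rewrite ltr1n.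
have mo := cmeas_omitted gb ig r1.
pose t : R[i] := (r ^- 2)%:C%C * b 1%N.
have tE : normc t = normc (b 1%N) * r ^- 2.
  by rewrite normcM normcR mulrC ger0_norm// -exprVn sqr_ge0.
have t8 : normc t <= 8^-1 by rewrite tE.
have t1 : normc t < 1 by apply: le_lt_trans t8 _; rewrite invf_lt1 ?ltr1n.
have [] := carea_conj_affine (b 0%N) t1 mo.
have [Y YE] : exists Y : set R[i], Y = [set z | omitted g r (z + t * z^*%C + b 0%N)] by eexists.
rewrite -YE => mT aT.
have t0 := normc_ge0 t.
have d0 : 0 <= d by rewrite /d !mulr_ge0 ?invr_ge0 ?exprn_ge0 ?(ltW r0).
have rd : 0 < r - d.
  have : d <= 2 * r / r ^+ 2.
    rewrite /d; apply: ler_wpM2r; first by rewrite invr_ge0 exprn_ge0// ltW.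
    by have := ler_wpM2l (ler0n R 2) rC; rewrite mulrA -natrM.
  rewrite expr2 invfM mulrA mulfK ?gt_eqF// => dr.
  rewrite subr_gt0; apply: le_lt_trans dr _.
  rewrite ltr_pdivrMr//; have := r8; nra.
have rd' : 0 < r + d by rewrite ltr_pwDl.
have le1 : (carea Y <= (pi * (r + d) ^+ 2)%:E)%E.
  rewrite -carea_cdisc//; apply: le_carea => //; first exact: cmeas_cdisc.
  by rewrite YE => z /omitted_sub_disc.
have ge1 : ((pi * (r - d) ^+ 2)%:E <= carea Y)%E.
  rewrite -carea_cdisc//; apply: le_carea => //; first exact: cmeas_cdisc.
  by rewrite YE => z /disc_sub_omitted.
have t2 : 0 < 1 - normc t ^+ 2.
  have : normc t ^+ 2 <= 8^-1 ^+ 2 by rewrite ler_pXn2r// nnegrE// invr_ge0.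
  lra.
have fT : carea Y =
   (fine (carea Y))%:E.
  by rewrite fineK// ge0_fin_numE ?carea_fin_ge0//; exact: le_lt_trans le1 (ltry _).
have aE : carea (omitted g r) = ((1 - normc t ^+ 2)%:E * carea Y)%E.
  by rewrite aT muleA -EFinM divff ?gt_eqF// mul1e.
move: le1 ge1 aE; rewrite fT; move: (fine (carea Y)) => m.
rewrite -EFinM !lee_fin => le1 ge1 ->; split; first exact: ltry.
have pi0 := pi_ge0 R.
rewrite /=.
have key : normc t ^+ 2 * r ^+ 2 <= normc (b 1%N) ^+ 2 / r.
  rewrite tE exprMn -mulrA; apply: ler_wpM2l; first exact: sqr_ge0.
  rewrite expr2 -mulrA mulVf ?mulr1; last by rewrite expf_eq0 gt_eqF.
  rewrite lef_pV2 ?posrE ?exprn_gt0// expr2 ler_peMl// ltW//.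
have d1 : r * d = 64 * C / r by rewrite /d; field; rewrite gt_eqF.
have d2 : d ^+ 2 <= (64 * C) ^+ 2 / r.
  rewrite /d expr_div_n; apply: ler_wpM2l; first exact: sqr_ge0.
  rewrite lef_pV2 ?posrE ?exprn_gt0// -exprM -[X in X <= _]expr1.
  by rewrite ler_eXn2l.
have ppos : 0 <= pi * (normc t ^+ 2) :> R by rewrite mulr_ge0 ?sqr_ge0.
have m0 : 0 <= m by apply: le_trans ge1; rewrite mulr_ge0 ?sqr_ge0.
rewrite ler_distl; apply/andP; split.
  have h1 : (1 - normc t ^+ 2) * (pi * (r - d) ^+ 2) <= (1 - normc t ^+ 2) * m.
    by apply: ler_wpM2l => //; exact: ltW.
  apply: le_trans h1.
  have h2 : pi * (normc t ^+ 2 * (r - d) ^+ 2) <= pi * (normc (b 1%N) ^+ 2 / r).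
    apply: ler_wpM2l => //; apply: le_trans key; apply: ler_wpM2l; first exact: sqr_ge0.
    by rewrite ler_pXn2r ?nnegrE ?(ltW r0) ?(ltW rd)// gerBl.
  have h3 : 0 <= pi * ((64 * C) ^+ 2 / r) by rewrite !mulr_ge0 ?sqr_ge0 ?invr_ge0 ?(ltW r0).
  have h4 : 0 <= pi * d ^+ 2 by rewrite mulr_ge0 ?sqr_ge0.
  have h5 : pi * (r * d) = pi * (64 * C / r) by rewrite d1.
  rewrite [X in X <= _](_ : _ = pi * r ^+ 2 - 2 * (pi * (64 * C / r)) - pi * ((64 * C) ^+ 2 / r) -
    pi * (normc (b 1%N) ^+ 2 / r)); last by ring.
  rewrite [X in _ <= X](_ : _ = pi * r ^+ 2 - 2 * (pi * (r * d)) + pi * d ^+ 2 -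
    pi * (normc t ^+ 2 * (r - d) ^+ 2)); last by ring.
  rewrite h5; lra.
have h1 : (1 - normc t ^+ 2) * m <= m by rewrite ler_piMl// gerBl sqr_ge0.
apply: le_trans h1 _; apply: le_trans le1 _.
have h3 : 0 <= pi * (normc (b 1%N) ^+ 2 / r) by rewrite !mulr_ge0 ?normc_ge0 ?invr_ge0 ?(ltW r0).
have h4 : pi * d ^+ 2 <= pi * ((64 * C) ^+ 2 / r) by rewrite ler_wpM2l.
have h5 : pi * (r * d) = pi * (64 * C / r) by rewrite d1.
rewrite [X in _ <= X](_ : _ = pi * r ^+ 2 + 2 * (pi * (64 * C / r)) + pi * ((64 * C) ^+ 2 / r) +
  pi * (normc (b 1%N) ^+ 2 / r)); last by ring.
rewrite [X in X <= _](_ : _ = pi * r ^+ 2 + 2 * (pi * (r * d)) + pi * d ^+ 2); last by ring.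
rewrite h5; lra.
Qed.

End large_radius.

(** * The area theorem *)

Lemma le_Gsum (R : realType) (b : nat -> R[i]) (g : R[i] -> R[i]) (s : R) :
  outer_series b g -> 0 < s -> forall m, \sum_(0 <= n < m) gterm b s n <= Gsum b s.
Proof.
move=> gb s0 m; apply: nondecreasing_cvgn_le.
  exact: partial_sum_ndecr (gterm_ge0 b s).
exact: gterm_cvg s0 (outer_series_coef gb).
Qed.

(** The factor n removes the term n = 0, and every other one decays at least like e^(-2x). Hence
    [Gsum] tends to 0 at infinity. *)
Lemma gterm_le (R : realType) (b : nat -> R[i]) (s s' : R) n : s <= s' ->
  gterm b s' n <= expR (- (2 * (s' - s))) * gterm b s n.
Proof.
move=> ss'; rewrite /gterm; case: n => [|n]; first by rewrite !mul0r mulr0.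
rewrite [leRHS](_ : _ = n.+1%:R * normc (b n.+1) ^+ 2 *
   (expR (- (2 * (s' - s))) * expR (- (2 * n.+1%:R * s)))); last by ring.
apply: ler_wpM2l; first by rewrite mulr_ge0 ?exprn_ge0 ?normc_ge0.
rewrite -expRD ler_expR.
have : 1 * (s' - s) <= n.+1%:R * (s' - s) by rewrite ler_wpM2r ?subr_ge0// ler1n.
lra.
Qed.

Lemma Gsum_le (R : realType) (b : nat -> R[i]) (g : R[i] -> R[i]) (s s' : R) :
  outer_series b g -> 0 < s -> s <= s' -> Gsum b s' <= expR (- (2 * (s' - s))) * Gsum b s.
Proof.
move=> gb s0 ss'; apply: limr_le.
  by apply: gterm_cvg (outer_series_coef gb); exact: lt_le_trans ss'.
apply: nearW => m; apply: (@le_trans _ _ (\sum_(0 <= n < m) expR (- (2 * (s' - s))) * gterm b s n)).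
  by apply: ler_sum => n _; exact: gterm_le.
by rewrite -mulr_sumr ler_wpM2l ?expR_ge0//; exact: le_Gsum gb s0 m.
Qed.

(** By injectivity, a value taken on the annulus is not taken again beyond r', so it is omitted
    there. *)
Lemma omitted_cut (R : realType) (g : R[i] -> R[i]) (r r' : R) : 1 <= r -> r <= r' ->
  set_inj [set z | 1 < normc z] g ->
  omitted g r' = omitted g r `|` g @` [set z | r < normc z <= r'] /\
  (forall z, omitted g r z -> (g @` [set z | r < normc z <= r']) z -> False).
Proof.
move=> r1 rr' ig; split.
  apply/seteqP; split=> [w ow|w [ow [z zr gz]|[z /andP[zr zr'] <-]]].
  - have [[z zr gz]|h] := pselect ((g @` [set z | r < normc z]) w); last by left.
    right; exists z => //; rewrite /mkset zr/= leNgt; apply/negP => zr'.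
    by apply: ow; exists z.
  - by apply: ow; exists z => //; exact: le_lt_trans zr.
  - move=> [z' zr1 gz']; have e : z' = z.
      apply: ig => //; rewrite inE /mkset; last exact: le_lt_trans zr.
      by apply: le_lt_trans zr1; exact: le_trans rr'.
    by move: zr1; rewrite e /mkset ltNge zr'.
by move=> w ow [z /andP[zr _] gz]; apply: ow; exists z.
Qed.

(** The image of the annulus from e^s to e^N is the difference of two omitted sets. The larger has
    area pi e^(2N) + o(1) and [Gsum b N] tends to 0, so e^(2N) cancels; all errors are at most a
    constant over N. *)
Lemma carea_omitted (R : realType) (b : nat -> R[i]) (g : R[i] -> R[i]) (s : R) :
  outer_series b g -> set_inj [set z | 1 < normc z] g -> 0 < s ->
  carea (omitted g (expR s)) = (pi * (expR (2 * s) - Gsum b s))%:E.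
Proof.
move=> gb ig s0.
have [C C0 bC] := outer_series_coef gb (ltr1n R 2).
have r1 (x : R) : 0 < x -> 1 < expR x by move=> x0; rewrite -expR0 ltr_expR.
pose Cst := pi * (128 * C + (64 * C) ^+ 2 + normc (b 1%N) ^+ 2).
pose N0 := (Num.truncn (Num.max 8 (Num.max (normc (b 1%N)) (Num.max (32 * C) s)))).+1.
have main N : (N0 < N)%N -> (carea (omitted g (expR s)) < +oo)%E /\
    `|fine (carea (omitted g (expR s))) - pi * (expR (2 * s) - Gsum b s)| <=
     0 + (Cst + pi * (expR (2 * s) * Gsum b s)) / N%:R.
  move=> N0N; have NR : 0 < N%:R :> R by rewrite ltr0n; apply: leq_ltn_trans N0N.
  have : Num.max 8 (Num.max (normc (b 1%N)) (Num.max (32 * C) s)) < N%:R.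
    by apply: lt_le_trans (truncnS_gt _) _; rewrite ler_nat ltnW.
  rewrite !gt_max => /and4P[N1 N2 N3 sN].
  have eN : N%:R <= expR N%:R :> R by apply: le_trans (expR_ge1Dx _); rewrite lerDr.
  have [fL aL] := @carea_omitted_large R b g C (expR N%:R) gb ig C0 bC
    (le_trans (ltW N1) eN) (le_trans (ltW N2) eN) (le_trans (ltW N3) eN).
  have [mV aV] := annulus_area gb ig s0 sN.
  have e1 : expR s <= expR N%:R by rewrite ler_expR ltW.
  have [cut dis] := omitted_cut (ltW (r1 _ s0)) e1 ig.
  have [_] := careaU (cmeas_omitted gb ig (r1 _ s0)) mV dis.
  rewrite -cut aV => aU.
  have fs : (carea (omitted g (expR s)) < +oo)%E.
    apply: le_lt_trans fL; apply: le_carea; try exact: cmeas_omitted gb ig (r1 _ _).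
    by rewrite cut => z; left.
  split=> //.
  have fE (S : set R[i]) : (carea S < +oo)%E -> carea S = (fine (carea S))%:E.
    by move=> fS; rewrite fineK// ge0_fin_numE// carea_fin_ge0.
  move: aU aL; rewrite (fE _ fL) (fE _ fs) /=.
  generalize (fine (carea (omitted g (expR N%:R)))) (fine (carea (omitted g (expR s)))) => x y.
  rewrite -EFinD => -[->].
  have G0 : 0 <= Gsum b N%:R by have := le_Gsum gb (lt_trans s0 sN) 0; rewrite big_geq.
  have Gs0 : 0 <= Gsum b s by have := le_Gsum gb s0 0; rewrite big_geq.
  have GN : Gsum b N%:R <= expR (2 * s) * Gsum b s / N%:R.
    apply: le_trans (Gsum_le gb s0 (ltW sN)) _.
    rewrite mulrAC; apply: ler_wpM2r => //.
    have -> : - (2 * (N%:R - s)) = 2 * s + - (N%:R *+ 2) by rewrite mulr2n; ring.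
    rewrite expRD expRN; apply: ler_wpM2l; first exact: expR_ge0.
    rewrite lef_pV2 ?posrE ?expR_gt0//; apply: le_trans eN _.
    by rewrite ler_expR mulr2n lerDl.
  have e2 : expR N%:R ^+ 2 = expR (2 * N%:R) :> R by rewrite expr2 -expRD mulr2n mulrDl mul1r.
  rewrite e2 => aL.
  have h1 : pi * Gsum b N%:R <= pi * (expR (2 * s) * Gsum b s / N%:R).
    by apply: ler_wpM2l => //; exact: pi_ge0.
  have h0 : 0 <= pi * Gsum b N%:R by rewrite mulr_ge0 ?pi_ge0.
  have h2 : Cst / expR N%:R <= Cst / N%:R.
    apply: ler_wpM2l; last by rewrite lef_pV2 ?posrE ?expR_gt0.
    by rewrite mulr_ge0 ?pi_ge0 ?addr_ge0 ?sqr_ge0 ?mulr_ge0.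
  rewrite add0r [leRHS](_ : _ = Cst / N%:R + pi * (expR (2 * s) * Gsum b s / N%:R)); last by field; rewrite gt_eqF.
  move: aL; rewrite -/Cst !ler_distl => /andP[k1 k2].
  by apply/andP; split; lra.
have [fs _] := main N0.+1 (ltnSn _).
rewrite -[LHS]fineK ?ge0_fin_numE ?carea_fin_ge0//; congr EFin.
apply/eqP; rewrite -subr_eq0 -normr_le0.
apply: (@le_of_le_addn R _ 0 (Cst + pi * (expR (2 * s) * Gsum b s)) N0) => N hN.
by have [_ h] := main N hN.
Qed.

(** By e^(-y) >= 1 - y, a fixed partial sum loses only an amount linear in s as s tends to 0. *)
Lemma le_gterm (R : realType) (b : nat -> R[i]) (s : R) n :
  n%:R * normc (b n) ^+ 2 - 2 * s * (n%:R ^+ 2 * normc (b n) ^+ 2) <= gterm b s n.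
Proof.
rewrite /gterm [leLHS](_ : _ = n%:R * normc (b n) ^+ 2 * (1 - 2 * n%:R * s)); last by ring.
apply: ler_wpM2l; first by rewrite mulr_ge0 ?exprn_ge0 ?normc_ge0.
exact: expR_ge1Dx.
Qed.

Theorem area_theorem (R : realType) (b : nat -> R[i]) (g : R[i] -> R[i]) :
  outer_series b g -> set_inj [set z | 1 < normc z] g ->
  exists S : R, [/\ (fun m => \sum_(0 <= n < m) n%:R * normc (b n) ^+ 2) @ \oo --> S,
    S <= 1, cmeas (omitted g 1) & carea (omitted g 1) = (pi * (1 - S))%:E].
Proof.
move=> gb ig.
pose u n : R := n%:R * normc (b n) ^+ 2.
have u0 n : 0 <= u n by rewrite mulr_ge0 ?exprn_ge0 ?normc_ge0.
pose D m : R := \sum_(0 <= n < m) n%:R ^+ 2 * normc (b n) ^+ 2.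
have pi0 := pi_gt0 R.
have low m (s : R) : 0 < s -> \sum_(0 <= n < m) u n - 2 * s * D m <= Gsum b s.
  move=> s0; apply: le_trans (le_Gsum gb s0 m).
  by rewrite mulr_sumr -sumrB; apply: ler_sum => n _; exact: le_gterm.
have Gexp (s : R) : 0 < s -> Gsum b s <= expR (2 * s).
  move=> s0; rewrite -subr_ge0 -(pmulr_rge0 _ pi0) -lee_fin -(carea_omitted gb ig s0).
  exact: carea_fin_ge0.
have exple (s : R) : 0 < s <= 1 -> expR (2 * s) <= 1 + 2 * s * expR 2.
  move=> /andP[s0 s1]; have := expRB1_le (2 * s).
  have e2 : expR (2 * s) <= expR 2 by rewrite ler_expR ler_piMr.
  rewrite !ger0_norm ?mulr_ge0 ?(ltW s0)//; last first.
    by rewrite subr_ge0 -expR0 ler_expR mulr_ge0// ltW.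
  have : 2 * s * expR (2 * s) <= 2 * s * expR 2 by rewrite ler_wpM2l// mulr_ge0// ltW.
  lra.
have N01 N : (0 < N)%N -> 0 < (N%:R^-1 : R) <= 1.
  by move=> N0; rewrite invr_gt0 ltr0n N0/= invf_le1 ?ltr0n// ler1n.
(* Areas being nonnegative, Gsum b s <= e^(2s); at s = 1/N this bounds the partial sum by 1 +
   O(1/N). *)
have bound m : \sum_(0 <= n < m) u n <= 1.
  apply: (@le_of_le_addn _ _ _ (2 * D m + 2 * expR 2) 0) => N N0.
  have [s0 s1] := andP (N01 N N0).
  have := low m _ s0; have := Gexp _ s0; have := exple _ (N01 N N0).
  lra.
have nd := partial_sum_ndecr u0.
have cv : cvgn (fun m => \sum_(0 <= n < m) u n).
  by apply: nondecreasing_is_cvgn => //; exists 1 => _ [m _ <-].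
pose S := limn (fun m => \sum_(0 <= n < m) u n).
have S1 : S <= 1 by apply: limr_le => //; exact: nearW.
have SG (s : R) : 0 < s -> Gsum b s <= S.
  move=> s0; apply: ler_lim => //; first exact: gterm_cvg s0 (outer_series_coef gb).
  apply: nearW => m; apply: ler_sum => n _.
  rewrite /gterm /u -[leRHS]mulr1; apply: ler_wpM2l; first exact: u0.
  by rewrite -expR0 ler_expR oppr_le0 !mulr_ge0// ltW.
pose F n := omitted g (expR n.+1%:R^-1).
have r1 n : 1 < expR n.+1%:R^-1 :> R by rewrite -expR0 ltr_expR invr_gt0.
have s0 n : 0 < n.+1%:R^-1 :> R by rewrite invr_gt0.
have mF n : cmeas (F n) by apply: cmeas_omitted gb ig _.
have FE : omitted g 1 = \bigcap_n F n.
  apply/seteqP; split=> [w ow n _ [z zr gz]|w oF [z zr gz]].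
    by apply: ow; exists z => //; exact: lt_trans zr.
  have n0 : 0 < normc z by apply: lt_trans zr.
  have l0 : 0 < ln (normc z) by rewrite ln_gt0.
  have [N _ hN] := near_infty_natSinv_lt (PosNum l0).
  apply: (oF N I); exists z => //.
  by rewrite /mkset -[X in _ < X]lnK ?posrE// ltr_expR; exact: hN N (leqnn N).
have m1 : cmeas (omitted g 1).
  by rewrite FE /cmeas preimage_bigcap; apply: bigcapT_measurable => n; exact: mF.
exists S; split=> //.
apply/eqP; rewrite eq_le; apply/andP; split.
  (* Upper bound: for fixed m compare with the omitted set at s = 1/N and let N grow; only then let
     m grow. *)
  have h m : (carea (omitted g 1) <= (pi * (1 - \sum_(0 <= n < m) u n))%:E)%E.
    have sub (s : R) : 0 < s -> (carea (omitted g 1) <= (pi * (expR (2 * s) - Gsum b s))%:E)%E.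
      move=> s0'; have e1 : 1 < expR s by rewrite -expR0 ltr_expR.
      rewrite -(carea_omitted gb ig s0'); apply: le_carea => //; first exact: cmeas_omitted gb ig e1.
      by move=> w ow [z zr gz]; apply: ow; exists z => //; exact: lt_trans zr.
    have f1 : carea (omitted g 1) = (fine (carea (omitted g 1)))%:E.
      rewrite fineK// ge0_fin_numE ?carea_fin_ge0//.
      exact: le_lt_trans (sub 1 ltr01) (ltry _).
    move: sub; rewrite f1; move: (fine _) => a sub; rewrite lee_fin.
    apply: (@le_of_le_addn _ _ _ (pi * (2 * D m + 2 * expR 2)) 0) => N N0.
    have [t0 t1] := andP (N01 N N0).
    have := sub _ t0; rewrite lee_fin => /le_trans; apply.
    rewrite -mulrA -mulrDr; apply: ler_wpM2l; first exact: ltW.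
    have := low m _ t0; have := exple _ (N01 N N0).
    lra.
  have f1 : carea (omitted g 1) = (fine (carea (omitted g 1)))%:E.
    rewrite fineK// ge0_fin_numE ?carea_fin_ge0//.
    exact: le_lt_trans (h 0) (ltry _).
  move: h; rewrite f1; move: (fine _) => a h; rewrite lee_fin.
  have : S <= 1 - a / pi.
    apply: limr_le => //; apply: nearW => m.
    have := h m; rewrite lee_fin mulrC -ler_pdivrMr//; lra.
  rewrite lerBrDr -lerBrDl ler_pdivrMr// mulrC; exact.
(* Lower bound: continuity of the measure from above, since [F 0] has finite area; each F n has area
   at least pi (1 - S) because e^(2s) >= 1 and Gsum b s <= S. *)
have cF : (fun n => carea (F n)) @ \oo --> carea (omitted g 1).
  rewrite {2}/carea FE preimage_bigcap.
  apply: (@nonincreasing_cvg_mu _ _ _ (@leb2 R) (fun n => @toC R @^-1` F n)) => //.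
  - by change (carea (F 0%N) < +oo)%E; rewrite (carea_omitted gb ig (s0 0%N)); exact: ltry.
  - by have := m1; rewrite /cmeas FE preimage_bigcap.
  - move=> n m nm; apply/subsetPset => p ow [z zr gz]; apply: ow; exists z => //.
    by apply: le_lt_trans zr; rewrite ler_expR lef_pV2 ?posrE// ler_nat.
have : ((pi * (1 - S))%:E <= limn (fun n => carea (F n)))%E.
  apply: lime_ge; first by apply/cvg_ex; exists (carea (omitted g 1)).
  apply: nearW => n; rewrite (carea_omitted gb ig (s0 n)) lee_fin; apply: ler_wpM2l; first exact: ltW.
  apply: lerB; last exact: SG.
  by rewrite -expR0 ler_expR mulr_ge0.
by rewrite (cvg_lim _ cF).
Qed.

(** * Slices of the quaternions *)

Lemma qcoordN (R : realType) (q : quat R) :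
  (qre (- q) = - qre q) * (qi (- q) = - qi q) * (qj (- q) = - qj q) * (qk (- q) = - qk q).
Proof. by rewrite /qre /qi /qj /qk !mxE. Qed.

Lemma qcoordM (R : realType) (p q : quat R) :
  (qre (p * q) = qre p * qre q - qi p * qi q - qj p * qj q - qk p * qk q) *
  (qi (p * q) = qre p * qi q + qi p * qre q + qj p * qk q - qk p * qj q) *
  (qj (p * q) = qre p * qj q - qi p * qk q + qj p * qre q + qk p * qi q) *
  (qk (p * q) = qre p * qk q + qi p * qj q - qj p * qi q + qk p * qre q).
Proof. by do !split; rewrite /GRing.mul/= !qE. Qed.

Lemma qcoord1 (R : realType) : (qre (1 : quat R) = 1) * (qi (1 : quat R) = 0) *
  (qj (1 : quat R) = 0) * (qk (1 : quat R) = 0).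
Proof. by do !split; rewrite /GRing.one/= !qE. Qed.

Definition qcoordE (R : realType) :=
  (@qcoordD R, @qcoordN R, @qcoordZ R, @qcoordM R, @qcoord1 R).

Lemma imag_unit_qdot (R : realType) (I : quat R) : imag_unit I -> qdot I I = 1.
Proof.
case=> _ n1; rewrite -[LHS]sqr_sqrtr; first by rewrite -/(qnorm I) n1 expr1n.
by rewrite qdotE -!expr2 !addr_ge0// sqr_ge0.
Qed.

Lemma imag_unit_sqr (R : realType) (I : quat R) : imag_unit I -> I * I = -1.
Proof.
move=> uI; have := imag_unit_qdot uI; rewrite qdotE; case: uI => r0 _; rewrite r0 => n1.
by apply: quatP; rewrite !qcoordE r0; lra.
Qed.

Lemma imag_unit_anticomm (R : realType) (I J : quat R) :
  imag_unit I -> imag_unit J -> qdot I J = 0 -> J * I = - (I * J).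
Proof.
by case=> i0 _ [j0 _]; rewrite qdotE i0 j0 => d; apply: quatP; rewrite !qcoordE i0 j0; lra.
Qed.

Lemma imag_unit_conj (R : realType) (J : quat R) : imag_unit J -> qconj J = - J.
Proof. by case=> j0 _; apply: quatP; rewrite /qconj !qE !qcoordE// j0 oppr0. Qed.

(** * The splitting C_I + C_I J *)

Definition qemb (R : realType) (I : quat R) (z : R[i]) : quat R :=
  slice_pt I (complex.Re z) (complex.Im z).

Definition qcoef (R : realType) (I q : quat R) : R[i] := (qre q +i* qdot q I)%C.

Lemma qembD (R : realType) (I : quat R) z w : qemb I (z + w) = qemb I z + qemb I w.
Proof. by rewrite /qemb /slice_pt !ReImE !scalerDl addrACA. Qed.

Lemma qembM (R : realType) (I : quat R) z w : imag_unit I ->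
  qemb I (z * w) = qemb I z * qemb I w.
Proof.
move=> /imag_unit_sqr I2; case: z w => [x y] [u v]; rewrite /qemb /slice_pt/=.
rewrite mulrDl !mulrDr -!scalerAl -!scalerAr !mul1r mulr1 I2 !scalerA scalerBl !scalerDl scalerN.
by rewrite !addrA [X in X + _ = _]addrAC [LHS]addrAC.
Qed.

Lemma qemb1 (R : realType) (I : quat R) : qemb I 1 = 1.
Proof. by rewrite /qemb /slice_pt/= scale1r scale0r addr0. Qed.

Lemma qembX (R : realType) (I : quat R) z n : imag_unit I -> qemb I (z ^+ n) = qemb I z ^+ n.
Proof. by move=> uI; elim: n => [|n IH]; rewrite ?expr0 ?qemb1// !exprS qembM// IH. Qed.

Lemma qembV (R : realType) (I : quat R) z : imag_unit I -> z != 0 -> qemb I z^-1 = (qemb I z)^-1.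
Proof.
move=> uI z0; have h : qemb I z^-1 * qemb I z = 1 by rewrite -qembM// mulVf// qemb1.
have h' : qemb I z * qemb I z^-1 = 1 by rewrite -qembM// mulfV// qemb1.
have u : qemb I z \is a GRing.unit by apply/unitrP; exists (qemb I z^-1).
by rewrite -[LHS]mulr1 -(mulrV u) mulrA h mul1r.
Qed.

Lemma qembXV (R : realType) (I : quat R) z n : imag_unit I -> z != 0 ->
  qemb I (z ^- n) = qemb I z ^- n.
Proof. by move=> uI z0; rewrite qembV ?expf_neq0// qembX. Qed.

Lemma qnorm_qemb (R : realType) (I : quat R) z : imag_unit I -> qnorm (qemb I z) = normc z.
Proof.
move=> uI; have := imag_unit_qdot uI; rewrite qdotE; case: uI => r0 _; rewrite r0 => n1.
case: z => x y /=; rewrite /qnorm qdotE /qemb /slice_pt/= !qcoordE r0 !(mulr1, mulr0, add0r, addr0); congr (Num.sqrt _).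
by rewrite -[y ^+ 2]mulr1 -n1; ring.
Qed.

Lemma qembK (R : realType) (I : quat R) : imag_unit I -> cancel (qemb I) (qcoef I).
Proof.
move=> uI; have := imag_unit_qdot uI; rewrite qdotE; case: uI => r0 _; rewrite r0 => n1 [x y].
rewrite /qcoef /qemb /slice_pt qdotE/= !qcoordE r0 !(mulr1, mulr0, add0r, addr0); congr Complex.
by rewrite -[RHS]mulr1 -n1; ring.
Qed.

(** Commuting with I means that the vector product of the imaginary parts vanishes, so the imaginary
    part of q is a multiple of I. Membership in C_I thus becomes an algebraic identity to check for
    [qproj1] and [qproj2]. *)
Lemma qcoefK (R : realType) (I q : quat R) : imag_unit I -> I * q = q * I ->
  qemb I (qcoef I q) = q.
Proof.
move=> uI; have := imag_unit_qdot uI; rewrite qdotE; case: uI => r0 _; rewrite r0 => n1 cq.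
have := congr1 (@qi R) cq; have := congr1 (@qj R) cq; have := congr1 (@qk R) cq.
rewrite !qcoordM !r0 => hk hj hi.
have h1 : qj q * qi I = qi q * qj I by lra.
have h2 : qk q * qi I = qi q * qk I by lra.
have h3 : qk q * qj I = qj q * qk I by lra.
apply: quatP; rewrite /qemb /slice_pt/= qdotE !qcoordE r0 !(mulr1, mulr0, add0r, addr0)//.
- rewrite -[RHS]mulr1 -n1.
  rewrite [LHS](_ : _ = qi q * qi I * qi I + (qj q * qi I) * qj I + (qk q * qi I) * qk I); last by ring.
  by rewrite h1 h2; ring.
- rewrite -[RHS]mulr1 -n1.
  rewrite [LHS](_ : _ = (qi q * qj I) * qi I + (qj q * qj I) * qj I + (qk q * qj I) * qk I); last by ring.
  by rewrite -h1 h3; ring.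
- rewrite -[RHS]mulr1 -n1.
  rewrite [LHS](_ : _ = (qi q * qk I) * qi I + (qj q * qk I) * qj I + (qk q * qk I) * qk I); last by ring.
  by rewrite -h2 -h3; ring.
Qed.

Lemma qemb_comm (R : realType) (I : quat R) z : I * qemb I z = qemb I z * I.
Proof.
by rewrite /qemb /slice_pt mulrDl mulrDr -!scalerAl -!scalerAr mul1r mulr1.
Qed.

Lemma slice_plane_qemb (R : realType) (I q : quat R) : slice_plane I q -> exists z, q = qemb I z.
Proof. by case=> x [y ->]; exists (x +i* y)%C. Qed.

Lemma Delta_sliceE (R : realType) (I : quat R) : imag_unit I ->
  Delta_slice I = qemb I @` [set z | 1 < normc z].
Proof.
move=> uI; apply/seteqP; split=> [q [Dq /slice_plane_qemb[z zE]]|_ [z z1 <-]].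
  by exists z => //; rewrite /mkset -(qnorm_qemb _ uI) -zE.
by split; [rewrite /Delta /mkset qnorm_qemb | exists (complex.Re z), (complex.Im z)].
Qed.

Lemma scaler_halfD (R : realType) (q : quat R) : 2^-1 *: (q + q) = q.
Proof. by rewrite -{1 2}[q]scale1r -scalerDl scalerA mulVf ?scale1r// pnatr_eq0. Qed.

Definition qproj1 (R : realType) (I q : quat R) : quat R := 2^-1 *: (q - I * q * I).

Definition qproj2 (R : realType) (I J q : quat R) : quat R :=
  2^-1 *: (q + I * q * I) * qconj J.

(** Since I^-1 = -I, q - I q I is q plus its conjugate by I, and conjugation by I exchanges the
    two. *)
Lemma qproj1_comm (R : realType) (I q : quat R) : imag_unit I ->
  I * qproj1 I q = qproj1 I q * I.
Proof.
move=> /imag_unit_sqr I2; rewrite /qproj1 -scalerAl -scalerAr mulrBl mulrBr; congr (_ *: _).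
by rewrite !mulrA I2 -!(mulrA (I * q)) I2 mulN1r mulrN1 mulNr !opprK addrC.
Qed.

(** Both q + I q I and J anticommute with I, so their product commutes with it. *)
Lemma qproj2_comm (R : realType) (I J q : quat R) : imag_unit I -> imag_unit J ->
  qdot I J = 0 -> I * qproj2 I J q = qproj2 I J q * I.
Proof.
move=> uI uJ IJ; have I2 := imag_unit_sqr uI; have anti := imag_unit_anticomm uI uJ IJ.
rewrite /qproj2 (imag_unit_conj uJ) -!scalerAl -scalerAr; congr (_ *: _).
rewrite !mulrN mulNr -(mulrA _ J I) anti mulrN opprK !mulrA -mulNr; congr (_ * J).
by rewrite mulrDl mulrDr -!(mulrA (I * q)) I2 !mulrA I2 mulN1r mulrN1 mulNr opprB.
Qed.

Lemma qproj_split (R : realType) (I J q : quat R) : imag_unit J ->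
  q = qproj1 I q + qproj2 I J q * J.
Proof.
move=> uJ; have J2 := imag_unit_sqr uJ.
rewrite /qproj2 (imag_unit_conj uJ) -(mulrA _ (- J)) mulNr J2 opprK mulr1 -scalerDr.
by rewrite addrACA addNr addr0 scaler_halfD.
Qed.

Lemma qproj_qemb (R : realType) (I J : quat R) (z w : R[i]) : imag_unit I -> imag_unit J ->
  qdot I J = 0 ->
  qproj1 I (qemb I z + qemb I w * J) = qemb I z /\
  qproj2 I J (qemb I z + qemb I w * J) = qemb I w.
Proof.
move=> uI uJ IJ; have I2 := imag_unit_sqr uI; have anti := imag_unit_anticomm uI uJ IJ.
have J2 := imag_unit_sqr uJ.
have e : I * (qemb I z + qemb I w * J) * I = - qemb I z + qemb I w * J.
  rewrite mulrDr mulrDl !mulrA !qemb_comm// -!mulrA I2 mulrN1 anti mulrN mulrN !mulrA.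
  by rewrite -(mulrA (qemb I w)) I2 mulrN1 mulNr opprK.
rewrite /qproj1 /qproj2 e (imag_unit_conj uJ); split.
  by rewrite opprD opprK addrACA subrr addr0 scaler_halfD.
by rewrite addrACA subrr add0r scaler_halfD -(mulrA _ J) mulrN J2 opprK mulr1.
Qed.

Lemma qdot_qemb (R : realType) (I J : quat R) (z w : R[i]) : imag_unit I -> imag_unit J ->
  qdot I J = 0 ->
  qdot (qemb I z + qemb I w * J) (qemb I z + qemb I w * J) = normc z ^+ 2 + normc w ^+ 2.
Proof.
move=> uI uJ; have := imag_unit_qdot uI; have := imag_unit_qdot uJ.
case: uI uJ => i0 _ [j0 _]; rewrite !qdotE i0 j0 !(mul0r, add0r).
case: z w => [x y] [u v]; rewrite !normc_sqr/= /qemb /slice_pt/= !qcoordE i0 j0.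
rewrite !(mulr1, mulr0, add0r, addr0, mul0r, subr0, sub0r).
move: (qi I) (qj I) (qk I) (qi J) (qj J) (qk J) => i1 i2 i3 j1 j2 j3 hJ hI hd.
(* Padding with |I|^2 = |J|^2 = 1 and I.J = 0 turns the claim into a polynomial identity, containing
   Lagrange's identity for |I J|^2. *)
rewrite [RHS](_ : _ = x ^+ 2 + y ^+ 2 * (i1 * i1 + i2 * i2 + i3 * i3) +
  u ^+ 2 * (j1 * j1 + j2 * j2 + j3 * j3) +
  v ^+ 2 * ((i1 * i1 + i2 * i2 + i3 * i3) * (j1 * j1 + j2 * j2 + j3 * j3)) +
  (2 * y * u - 2 * x * v) * (i1 * j1 + i2 * j2 + i3 * j3)); last by rewrite hI hJ hd; ring.
by ring.
Qed.

(* The quaternions are C_I + C_I J; these are the two components of [q]. *)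
Definition qcoef1 (R : realType) (I q : quat R) : R[i] := qcoef I (qproj1 I q).
Definition qcoef2 (R : realType) (I J q : quat R) : R[i] := qcoef I (qproj2 I J q).

Lemma qcoef_split (R : realType) (I J q : quat R) : imag_unit I -> imag_unit J ->
  qdot I J = 0 -> q = qemb I (qcoef1 I q) + qemb I (qcoef2 I J q) * J.
Proof.
move=> uI uJ IJ; rewrite /qcoef1 /qcoef2 !qcoefK//; first exact: qproj_split.
  exact: qproj2_comm.
exact: qproj1_comm.
Qed.

Lemma qcoef_qemb (R : realType) (I J : quat R) (z w : R[i]) : imag_unit I -> imag_unit J ->
  qdot I J = 0 -> qcoef1 I (qemb I z + qemb I w * J) = z /\
  qcoef2 I J (qemb I z + qemb I w * J) = w.
Proof.
by move=> uI uJ IJ; rewrite /qcoef1 /qcoef2; have [-> ->] := qproj_qemb z w uI uJ IJ; rewrite !qembK.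
Qed.

Lemma qcoefD (R : realType) (I J p q : quat R) : imag_unit I -> imag_unit J ->
  qdot I J = 0 -> qcoef1 I (p + q) = qcoef1 I p + qcoef1 I q /\
  qcoef2 I J (p + q) = qcoef2 I J p + qcoef2 I J q.
Proof.
move=> uI uJ IJ; rewrite {1 3}(qcoef_split p uI uJ IJ) {1 3}(qcoef_split q uI uJ IJ).
by rewrite addrACA -mulrDl -!qembD; exact: qcoef_qemb.
Qed.

Lemma qcoefM (R : realType) (I J q : quat R) (z : R[i]) : imag_unit I -> imag_unit J ->
  qdot I J = 0 -> qcoef1 I (qemb I z * q) = z * qcoef1 I q /\
  qcoef2 I J (qemb I z * q) = z * qcoef2 I J q.
Proof.
move=> uI uJ IJ; rewrite {1 3}(qcoef_split q uI uJ IJ) mulrDr mulrA -!qembM//.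
exact: qcoef_qemb.
Qed.

Lemma qcoef_norm (R : realType) (I J q : quat R) : imag_unit I -> imag_unit J ->
  qdot I J = 0 -> qnorm q ^+ 2 = normc (qcoef1 I q) ^+ 2 + normc (qcoef2 I J q) ^+ 2.
Proof.
move=> uI uJ IJ; rewrite -(qdot_qemb _ _ uI uJ IJ) -qcoef_split//.
by rewrite sqr_sqrtr// qdotE -!expr2 !addr_ge0// sqr_ge0.
Qed.

(** * From quaternionic to complex series *)

Lemma qemb0 (R : realType) (I : quat R) : qemb I 0 = 0.
Proof. by rewrite /qemb /slice_pt/= !scale0r addr0. Qed.

(** Convergence is given in the sup norm; four coordinates account for the factor 2. *)
Lemma qnorm_le_norm (R : realType) (q : quat R) : qnorm q <= 2 * `|q|.
Proof.
rewrite -(@ler_pXn2r _ 2)// ?nnegrE ?sqrtr_ge0 ?mulr_ge0//.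
rewrite /qnorm sqr_sqrtr; last by rewrite qdotE -!expr2 !addr_ge0// sqr_ge0.
have h (i : 'I_4) : q 0 i * q 0 i <= `|q| ^+ 2.
  rewrite -expr2 -real_normK ?num_real// ler_sqr ?nnegrE//.
  by rewrite {2}/Num.norm/= mx_normrE; exact: (le_bigmax _ (fun ij => `|q ij.1 ij.2|) (0, i)).
rewrite exprMn; have := h 0; have := h 1; have := h 2; have := h 3.
rewrite qdotE /qre /qi /qj /qk; lra.
Qed.

Lemma cvg_qnorm (R : realType) (u : nat -> quat R) (l : quat R) :
  u @ \oo --> l -> (fun N => qnorm (u N - l)) @ \oo --> (0 : R).
Proof.
move=> ul; have h : (fun N => 2 * `|u N - l|) @ \oo --> (0 : R).
  rewrite -(mulr0 2); apply: cvgMr; rewrite -(normr0 (quat R)) -(subrr l).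
  by apply: cvg_norm; apply: cvgB => //; exact: cvg_cst.
apply: squeeze_cvgr h; last exact: cvg_cst.
by apply: nearW => N; rewrite sqrtr_ge0 qnorm_le_norm.
Qed.

Lemma le_normc_qnorm (R : realType) (I J q : quat R) : imag_unit I -> imag_unit J ->
  qdot I J = 0 -> normc (qcoef1 I q) <= qnorm q /\ normc (qcoef2 I J q) <= qnorm q.
Proof.
move=> uI uJ IJ; have := qcoef_norm q uI uJ IJ => e.
by split; rewrite -(@ler_pXn2r _ 2)// ?nnegrE ?normc_ge0 ?sqrtr_ge0// e ?lerDl ?lerDr sqr_ge0.
Qed.

Definition quat_series (R : realType) (a : nat -> quat R) (f : quat R -> quat R) : Prop :=
  forall q, @Delta R q -> (fun N : nat => q + \sum_(0 <= n < N) q ^- n * a n) @ \oo --> f q.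

(** The leading term q lies in C_I and disappears from the second component; adding z restores the
    normalisation of the area theorem. *)
Lemma outer_series_qcoef (R : realType) (I J : quat R) (a : nat -> quat R)
    (f : quat R -> quat R) : imag_unit I -> imag_unit J -> qdot I J = 0 ->
  quat_series a f ->
  outer_series (qcoef1 I \o a) (fun z => qcoef1 I (f (qemb I z))) /\
  outer_series (qcoef2 I J \o a) (fun z => z + qcoef2 I J (f (qemb I z))).
Proof.
move=> uI uJ IJ fa.
have add p q := qcoefD p q uI uJ IJ.
have mul z q := qcoefM q z uI uJ IJ.
have zero : qcoef1 I 0 = 0 /\ qcoef2 I J 0 = 0.
  by have := qcoef_qemb 0 0 uI uJ IJ; rewrite !qemb0 mul0r addr0.
have id z : qcoef1 I (qemb I z) = z /\ qcoef2 I J (qemb I z) = 0.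
  by have := qcoef_qemb z 0 uI uJ IJ; rewrite qemb0 mul0r addr0.
have opp q : qcoef1 I (- q) = - qcoef1 I q /\ qcoef2 I J (- q) = - qcoef2 I J q.
  have [h1 h2] := add q (- q); rewrite subrr zero.1 in h1; rewrite subrr zero.2 in h2.
  by split; apply/eqP; rewrite -addr_eq0 addrC -?h1 -?h2.
have part (z : R[i]) N : z != 0 ->
    qcoef1 I (qemb I z + \sum_(0 <= n < N) qemb I z ^- n * a n) =
      z + \sum_(0 <= n < N) z ^- n * qcoef1 I (a n) /\
    qcoef2 I J (qemb I z + \sum_(0 <= n < N) qemb I z ^- n * a n) =
      \sum_(0 <= n < N) z ^- n * qcoef2 I J (a n).
  move=> z0; rewrite (add _ _).1 (add _ _).2 (id z).1 (id z).2 add0r.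
  elim: N => [|N [h1 h2]]; first by rewrite !big_geq// zero.1 zero.2.
  rewrite !big_nat_recr//= (add _ _).1 (add _ _).2 -qembXV// (mul _ _).1 (mul _ _).2.
  by rewrite !addrA h1 h2.
have bound z N : 1 < normc z ->
    normc (z + \sum_(0 <= n < N) z ^- n * qcoef1 I (a n) - qcoef1 I (f (qemb I z))) <=
      qnorm (qemb I z + \sum_(0 <= n < N) qemb I z ^- n * a n - f (qemb I z)) /\
    normc (\sum_(0 <= n < N) z ^- n * qcoef2 I J (a n) - qcoef2 I J (f (qemb I z))) <=
      qnorm (qemb I z + \sum_(0 <= n < N) qemb I z ^- n * a n - f (qemb I z)).
  move=> z1; have z0 : z != 0 by rewrite -normc_gt0 (lt_trans _ z1).
  have [<- <-] := part z N z0; rewrite -(opp _).1 -(opp _).2 -(add _ _).1 -(add _ _).2.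
  exact: le_normc_qnorm.
have lim z : 1 < normc z ->
    (fun N => qnorm (qemb I z + \sum_(0 <= n < N) qemb I z ^- n * a n - f (qemb I z))) @ \oo
      --> (0 : R).
  by move=> z1; apply/cvg_qnorm/fa; rewrite /Delta /mkset qnorm_qemb.
split=> z z1; apply: squeeze_cvgr (lim z z1); try exact: cvg_cst; apply: nearW => N.
  by rewrite normc_ge0 (bound z N z1).1.
by rewrite opprD addrACA subrr add0r normc_ge0 (bound z N z1).2.
Qed.

(** b 1 is the derivative at 0 of [innerfun]. As g determines that function only away from 0, a
    difference quotient between 1/r and 1/(2r) is used, with r tending to infinity. *)
Lemma outer_series_coef1_uniq (R : realType) (b b' : nat -> R[i]) (g : R[i] -> R[i]) :
  outer_series b g -> outer_series b' g -> b 1%N = b' 1%N.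
Proof.
move=> gb gb'; have r12 : 1 < (2 : R) by rewrite ltr1n.
have [C C0 bC] := outer_series_coef gb r12; have [C' C'0 bC'] := outer_series_coef gb' r12.
have main (r : R) : 8 <= r -> normc (b 1%N - b' 1%N) <= 32 * (C + C') / r.
  move=> r8; have r0 : 0 < r by lra.
  pose u : R[i] := (r^-1)%:C%C; pose v : R[i] := ((2 * r)^-1)%:C%C.
  have nu : normc u = r^-1 by rewrite normcR gtr0_norm ?invr_gt0.
  have nv : normc v = (2 * r)^-1 by rewrite normcR gtr0_norm// invr_gt0 mulr_gt0.
  have vr : normc v <= r^-1 by rewrite nv lef_pV2 ?posrE ?mulr_gt0//; lra.
  have ur : normc u <= r^-1 by rewrite nu.
  have h := innerfun_near gb C0 bC r8 ur vr.
  have h' := innerfun_near gb' C'0 bC' r8 ur vr.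
  have u0 : u != 0 by rewrite -normc_gt0 nu invr_gt0.
  have v0 : v != 0 by rewrite -normc_gt0 nv invr_gt0 mulr_gt0.
  have uv : 0 < normc (u - v).
    by rewrite normc_gt0 subr_eq0; apply/eqP => /(congr1 (@normc R)); rewrite nu nv => /invr_inj; lra.
  move: h h'; rewrite /innerfun (negbTE u0) (negbTE v0) => h h'.
  rewrite -(ler_pM2r uv) -normcM.
  have [w wE] : exists w : R[i], w = g u^-1 - u^-1 - (g v^-1 - v^-1) by eexists.
  rewrite -wE in h h'.
  rewrite (_ : _ * (u - v) = (w - b' 1%N * (u - v)) - (w - b 1%N * (u - v))); last by ring.
  apply: le_trans (le_normcD _ _) _; rewrite normcN addrC.
  by apply: le_trans (lerD h h') _; rewrite -mulrDl -mulrDl mulrDr.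
apply/eqP; rewrite -subr_eq0 -normc_eq0 eq_le normc_ge0 andbT.
rewrite leNgt; apply/negP => e0.
have [e eE] : exists e : R, e = normc (b 1%N - b' 1%N) by eexists.
rewrite -eE in e0 main.
have k0 : 0 <= 32 * (C + C') by rewrite mulr_ge0// addr_ge0.
(* For this r the product e r exceeds 32 (C + C'). *)
have := main (8 + 32 * (C + C') / e + 1).
have r0 : 0 < 8 + 32 * (C + C') / e + 1 by have : 0 <= 32 * (C + C') / e := divr_ge0 k0 (ltW e0); lra.
rewrite ler_pdivlMr// !mulrDr mulrCA divff ?gt_eqF// !mulr1.
have : 0 <= 32 * (C + C') / e := divr_ge0 k0 (ltW e0).
lra.
Qed.

(** The outer measure agrees with the measure on the measurable set [omitted g 1], and only points
    of C_I are tested, so the complement in H may be traced on the plane. *)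
Lemma slice_outer_measure_omitted (R : realType) (I : quat R) (g : R[i] -> R[i])
    (F : quat R -> quat R) : imag_unit I -> cmeas (omitted g 1) ->
  (forall z, 1 < normc z -> F (qemb I z) = qemb I (g z)) ->
  slice_outer_measure I (~` (F @` Delta_slice I)) = carea (omitted g 1).
Proof.
move=> uI mg Fg; rewrite /slice_outer_measure /carea.
rewrite (_ : [set p | _] = @toC R @^-1` omitted g 1); first exact: (@measurable_mu_extE _ _ _ (@leb2 R)).
apply/seteqP; split=> p np.
  move=> [z z1 gz]; apply: np; rewrite Delta_sliceE//; exists (qemb I z); first by exists z.
  by rewrite Fg// gz.
rewrite Delta_sliceE// => -[_ [z z1 <-]]; rewrite Fg// => gz; apply: np; exists z => //.
by rewrite -[LHS](qembK uI) gz; exact: (qembK uI (toC p)).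
Qed.

Lemma quat_series_head (R : realType) (a : nat -> quat R) (f : quat R -> quat R) (c0 c1 : quat R) :
  a 0%N = c0 -> a 1%N = c1 -> (forall n, (2 <= n)%N -> a n = 0) ->
  (forall q, @Delta R q -> f q = q + c0 + q^-1 * c1) <-> quat_series a f.
Proof.
move=> a0 a1 a2.
have eq q : (fun N : nat => q + \sum_(0 <= n < N) q ^- n * a n) @ \oo --> q + c0 + q^-1 * c1.
  apply: cvg_near_cst; exists 2%N => // N /= N2.
  rewrite (big_cat_nat (leq0n 2) N2)/= big_nat_recl// big_nat1 a0 a1 expr0 invr1 mul1r expr1.
  by rewrite big_nat big1 ?addr0 ?addrA// => n /andP[n2 _]; rewrite a2// mulr0.
split=> [fq q Dq|fa q Dq]; first by rewrite fq//; exact: eq.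
exact: (cvg_unique _ (fa q Dq) (eq q)).
Qed.

(** The last clause of (3) keeps the condition on [c1]: the identity function has the same shape
    with c1 = 0, and there the inequality is strict. *)
Theorem theorem3p13 (R : realType) (f : quat R -> quat R) (a : nat -> quat R)
    (I J : quat R) (f1 f2 : quat R -> quat R)
    (f_regular : slice_regular (@Delta R) f)
    (f_series : forall q, @Delta R q ->
       (fun N : nat => q + \sum_(0 <= n < N) q ^- n * a n) @ \oo --> f q)
    (I_unit : imag_unit I) (J_unit : imag_unit J) (IJ_orth : qdot I J = 0)
    (f1_holo : slice_holomorphic I (Delta_slice I) f1)
    (f2_holo : slice_holomorphic I (Delta_slice I) f2)
    (f_split : forall z, Delta_slice I z -> f z = f1 z + f2 z * J)
    (f1_univalent : set_inj (Delta_slice I) f1)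
    (f2_univalent : set_inj (Delta_slice I) (fun z => z + f2 z)) :
  [/\ (slice_outer_measure I
         (~` ((fun z => 2^-1 *: (f z - I * f z * I))%R @` Delta_slice I))
       + slice_outer_measure I
         (~` ((fun z => z + 2^-1 *: (f z + I * f z * I) * qconj J)%R
                @` Delta_slice I))
       = pi%:E * (2%:E - \sum_(1 <= n <oo) (n%:R * qnorm (a n) ^+ 2)%:E))%E,
      (\sum_(1 <= n <oo) (n%:R * qnorm (a n) ^+ 2)%:E <= 2%:E)%E
    & [/\ qnorm (a 1%N) <= Num.sqrt 2,
          qnorm (a 1%N) = Num.sqrt 2 ->
            forall q, @Delta R q -> f q = q + a 0%N + q^-1 * a 1%N
        & qnorm (a 1%N) = Num.sqrt 2 <->
            exists c0 c1 : quat R, qnorm c1 = Num.sqrt 2 /\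
              forall q, @Delta R q -> f q = q + c0 + q^-1 * c1]].
Proof.
have [gb1 gb2] := outer_series_qcoef I_unit J_unit IJ_orth f_series.
set g1 := (fun z => qcoef1 I (f (qemb I z))) in gb1.
set g2 := (fun z => z + qcoef2 I J (f (qemb I z))) in gb2.
have Dz z : 1 < normc z -> Delta_slice I (qemb I z).
  by move=> z1; rewrite Delta_sliceE//; exists z.
(* f1 and f2 take values in C_I, so by uniqueness of the splitting they are the components of f. *)
have fE z : 1 < normc z -> f1 (qemb I z) = qemb I (g1 z) /\
    qemb I z + f2 (qemb I z) = qemb I (g2 z).
  move=> z1; have [u uE] := slice_plane_qemb (f1_holo.1 _ (Dz z z1)).
  have [v vE] := slice_plane_qemb (f2_holo.1 _ (Dz z z1)).
  rewrite /g1 /g2 qembD (f_split _ (Dz z z1)) uE vE.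
  by have [-> ->] := qcoef_qemb u v I_unit J_unit IJ_orth.
have inj (h : quat R -> quat R) (g : R[i] -> R[i]) : set_inj (Delta_slice I) h ->
    (forall z, 1 < normc z -> h (qemb I z) = qemb I (g z)) ->
    set_inj [set z | 1 < normc z] g.
  move=> ih hg z w; rewrite !inE => z1 w1 gzw.
  apply: (can_inj (qembK I_unit)); apply: ih; rewrite ?inE; try exact: Dz.
  by rewrite !hg// gzw.
have ig1 := inj _ _ f1_univalent (fun z z1 => (fE z z1).1).
have ig2 := inj _ _ f2_univalent (fun z z1 => (fE z z1).2).
have [S1 [cv1 S1le m1 area1]] := area_theorem gb1 ig1.
have [S2 [cv2 S2le m2 area2]] := area_theorem gb2 ig2.
pose u n : R := n%:R * qnorm (a n) ^+ 2.
have u0 n : 0 <= u n by rewrite mulr_ge0 ?exprn_ge0 ?sqrtr_ge0.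
have cv : (fun m => \sum_(0 <= n < m) u n) @ \oo --> S1 + S2.
  rewrite (_ : (fun m => _) = (fun m => \sum_(0 <= n < m) n%:R * normc ((qcoef1 I \o a) n) ^+ 2
    + \sum_(0 <= n < m) n%:R * normc ((qcoef2 I J \o a) n) ^+ 2)); first exact: cvgD.
  apply/funext => m; rewrite -big_split/=; apply: eq_bigr => n _.
  by rewrite /u (qcoef_norm _ I_unit J_unit IJ_orth) mulrDr.
(* The factor n makes the term n = 0 vanish, so summation may start at 0 or 1. *)
have sumE : (\sum_(1 <= n <oo) (u n)%:E = (S1 + S2)%:E)%E.
  apply/cvg_lim => //.
  rewrite (_ : (fun n => _) = (fun m => (\sum_(0 <= n < m) u n)%:E)); last first.
    apply/funext => -[|m]; first by rewrite !big_geq.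
    by rewrite [in RHS]big_ltn// /u mul0r add0r sumEFin.
  by apply: cvg_EFin; [exact: nearW | exact: cv].
have le_partial m : \sum_(0 <= n < m) u n <= 2.
  apply: (@le_trans _ _ (S1 + S2)); last by lra.
  rewrite -(cvg_lim _ cv)//; apply: nondecreasing_cvgn_le; last by apply/cvg_ex; exists (S1 + S2).
  exact: partial_sum_ndecr.
have a1_le : qnorm (a 1%N) ^+ 2 <= 2.
  by have := le_partial 2; rewrite big_nat_recr//= big_nat1 /u mul0r add0r mul1r.
have s2 : 0 <= Num.sqrt 2 :> R by exact: sqrtr_ge0.
have head : qnorm (a 1%N) = Num.sqrt 2 ->
    forall q, @Delta R q -> f q = q + a 0%N + q^-1 * a 1%N.
  move=> a1; apply/(quat_series_head (a := a)) => // n n2.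
  have := le_partial n.+1; rewrite big_nat_recr//= (big_cat_nat (leq0n 2) n2)/=.
  rewrite big_nat_recr//= big_nat1 {1}/u mul0r add0r {1}/u mul1r a1 sqr_sqrtr//.
  have : 0 <= \sum_(2 <= i < n) u i by apply: sumr_ge0.
  have := u0 n; rewrite /u => h1 h2 h3.
  have : n%:R * qnorm (a n) ^+ 2 == 0 by apply/eqP; lra.
  rewrite mulf_eq0 pnatr_eq0 gtn_eqF ?(leq_trans _ n2)//= sqrf_eq0 sqrtr_eq0 => a0.
  by apply/eqP; rewrite -qdot_eq0 eq_le a0 qdotE -!expr2 !addr_ge0// sqr_ge0.
split.
- have A1 := @slice_outer_measure_omitted _ I g1 (fun z => qproj1 I (f z)) I_unit m1.
  have A2 := @slice_outer_measure_omitted _ I g2 (fun z => z + qproj2 I J (f z)) I_unit m2.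
  rewrite A1 => [|z z1]; last by rewrite qcoefK//; exact: qproj1_comm.
  rewrite A2 => [|z z1]; last by rewrite qembD /qcoef2 qcoefK//; exact: qproj2_comm.
  by rewrite sumE area1 area2 -EFinD -EFinB -EFinM; congr EFin; ring.
- by rewrite sumE lee_fin; lra.
- split=> //.
    rewrite -(@ler_pXn2r _ 2)// ?nnegrE//; last exact: sqrtr_ge0.
    by rewrite (sqr_sqrtr (ler0n _ 2)).
  split=> [a1|[c0 [c1 [n1 fc]]]]; first by exists (a 0%N), (a 1%N); split=> //; exact: head.
  (* Padded by zeros, c0 and c1 form a second coefficient sequence of f; comparing both components
     gives a 1 = c1. *)
  pose c n : quat R := if n is n'.+1 then if n' is _.+1 then 0 else c1 else c0.
  have fc' : quat_series c f.
    have c2 n : (2 <= n)%N -> c n = 0 by case: n => [//|[//|n]].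
    exact: (@quat_series_head _ c f c0 c1 erefl erefl c2).1.
  have [gc1 gc2] := outer_series_qcoef I_unit J_unit IJ_orth fc'.
  have e1 := outer_series_coef1_uniq gb1 gc1; have e2 := outer_series_coef1_uniq gb2 gc2.
  rewrite -n1 (qcoef_split (a 1%N) I_unit J_unit IJ_orth).
  by move: e1 e2 => /= -> ->; rewrite -qcoef_split.
Qed.
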